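(* Let $\phi\in C^1(\mathbb R)$ and $u^0\in L^\infty(\mathbb R)\cap BV(\mathbb R)$, with $\alpha=\operatorname{ess\,inf}u^0$, $\beta=\operatorname{ess\,sup}u^0$ and $M=\max_{\xi\in[\alpha,\beta]}|\phi'(\xi)|$. Fix $s\in(0,1]$ and $\lambda>0$ with $\lambda\ge M$. For each $\Delta x>0$, with $\Delta t=\Delta x/\lambda$, let $(u_\Delta,v_\Delta)$ be the piecewise constant functions built from the D1Q2 scheme with relaxation parameter $s$ and initial data $u_j^0=\frac1{\Delta x}\int_{x_j}^{x_{j+1}}u^0(x)\,dx$, $v_j^0=\phi(u_j^0)$. Then from every sequence of mesh sizes $\Delta x\to0$ (with $\Delta t=\Delta x/\lambda$) one can extract a subsequence, and there exist functions $$u,v\in L^\infty(\mathbb R^+\times\mathbb R)\cap BV([0,T]\times\mathbb R)\quad\text{for all }T>0,$$ such that, along the subsequence, $$(u_\Delta,v_\Delta)\longrightarrow(u,v)\quad\text{in }L^1_{\rm loc}([0,+\infty[\times\mathbb R)\times L^1_{\rm loc}([0,+\infty[\times\mathbb R).$$ In addition, $u$ is a weak solution on $[0,+\infty[\times\mathbb R$ of the Cauchy problem $$\partial_t u+\partial_x\phi(u)=0\ (t>0,\ x\in\mathbb R),\qquad u(0,x)=u^0(x)\ (x\in\mathbb R),$$ and $v=\phi(u)$.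
   Context: Bounded variation: for $\Omega\subset\mathbb R^d$ open and $g\in L^1_{\rm loc}(\Omega)$, $TV_\Omega(g)=\sup\{\int_\Omega g\,\operatorname{div}\varphi:\ \varphi\in C^1_c(\Omega;\mathbb R^d),\ \|\varphi\|_\infty\le1\}$, and $BV(\Omega)=\{g\in L^1_{\rm loc}(\Omega):TV_\Omega(g)<+\infty\}$ (integrability over all of $\Omega$ is not required). $BV([0,T]\times\mathbb R)$ means $BV$ of the interior $(0,T)\times\mathbb R$. D1Q2 scheme. $\mathbb N=\{0,1,2,\dots\}$; $x_j=j\Delta x$ ($j\in\mathbb Z$), $t^n=n\Delta t$ ($n\in\mathbb N$), $\Delta t=\Delta x/\lambda$. The scheme computes moments $(u_j^n,v_j^n)$, equivalently particle distributions $f_j^{\pm,n}$, linked by $u_j^n=f_j^{+,n}+f_j^{-,n}$, $v_j^n=\lambda(f_j^{+,n}-f_j^{-,n})$, i.e. $f_j^{\pm,n}=\frac12u_j^n\pm\frac1{2\lambda}v_j^n$. Starting from $(u_j^0,v_j^0)_{j\in\mathbb Z}$, one time step consists, for all $j\in\mathbb Z$, of - relaxation: $u_j^{n+1/2}=u_j^n$, $v_j^{n+1/2}=(1-s)v_j^n+s\,\phi(u_j^n)$, $f_j^{\pm,n+1/2}=\frac12u_j^{n}\pm\frac1{2\lambda}v_j^{n+1/2}$; - transport: $f_j^{+,n+1}=f_{j-1}^{+,n+1/2}$, $f_j^{-,n+1}=f_{j+1}^{-,n+1/2}$. Approximate solutions: $u_\Delta(t,x)=u_j^n$ and $v_\Delta(t,x)=v_j^n$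 for $(t,x)\in[t^n,t^{n+1})\times[x_j,x_{j+1})$. Weak solution: $u$ is a weak solution of the Cauchy problem on $[0,+\infty[\times\mathbb R$ if for every $\varphi\in C_c^\infty([0,+\infty[\times\mathbb R)$, $\int_0^\infty\int_{\mathbb R}\big(u\,\partial_t\varphi+\phi(u)\,\partial_x\varphi\big)\,dx\,dt+\int_{\mathbb R}u^0(x)\varphi(0,x)\,dx=0$. *)

(* Defs.v *)
From HB Require Import structures.
From mathcomp Require Import all_boot all_order all_algebra archimedean.
From mathcomp Require Import all_classical all_reals all_analysis.

Set Implicit Arguments.
Unset Strict Implicit.
Unset Printing Implicit Defensive.

Import Order.TTheory GRing.Theory Num.Theory.
Import numFieldNormedType.Exports.

Local Open Scope classical_set_scope.
Local Open Scope ring_scope.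

(* Points of the plane are pairs (t, x). *)
Definition leb2 (R : realType) :
    {measure set (measurableTypeR R * measurableTypeR R) -> \bar R} :=
  (@lebesgue_measure R \x @lebesgue_measure R)%E.

Definition half_plane (R : realType) : set (R * R) := `[0, +oo[ `*` setT.

Arguments half_plane R : clear implicits.

Definition strip (R : realType) (T : R) : set (R * R) := `]0, T[ `*` setT.

Definition C1 (R : realType) (f : R -> R) : Prop :=
  (forall x, derivable f x 1) /\ continuous (derive1 f).

Definition d_t (R : realType) (f : R * R -> R) (p : R * R) : R :=
  'D_((1, 0) : R * R) f p.

Definition d_x (R : realType) (f : R * R -> R) (p : R * R) : R :=
  'D_((0, 1) : R * R) f p.

Fixpoint Ck2 (R : realType) (k : nat) (f : R * R -> R) : Prop :=
  match k with
  | 0 => continuous f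
  | k'.+1 =>
      [/\ continuous f,
          forall p, derivable f p ((1, 0) : R * R),
          forall p, derivable f p ((0, 1) : R * R),
          Ck2 k' (d_t f) & Ck2 k' (d_x f)]
  end.

Definition Cinfty2 (R : realType) (f : R * R -> R) : Prop :=
  forall k, Ck2 k f.

(* Elements of C_c(Omega) are identified with their extension by zero. *)
Definition compactly_supported (R : realType) (T : topologicalType)
    (Omega : set T) (f : T -> R) : Prop :=
  let supp := closure [set p | f p != 0] in
  compact supp /\ supp `<=` Omega.

Definition TV1 (R : realType) (Omega : set R) (g : R -> R) : \bar R :=
  ereal_sup [set
    (\int[lebesgue_measure]_(x in Omega) (g x * derive1 phi x))%:E |
    phi in [set phi : R -> R | [/\ C1 phi, compactly_supported Omega phi &
      forall x, `|phi x| <= 1]]].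

Definition TV2 (R : realType) (Omega : set (R * R)) (g : R * R -> R) : \bar R :=
  ereal_sup [set
    (\int[leb2 R]_(p in Omega) (g p * (d_t phi.1 p + d_x phi.2 p)))%:E |
    phi in [set phi : (R * R -> R) * (R * R -> R) |
      [/\ Ck2 1 phi.1 /\ Ck2 1 phi.2,
          compactly_supported Omega phi.1 /\ compactly_supported Omega phi.2 &
          forall p, Num.sqrt (phi.1 p ^+ 2 + phi.2 p ^+ 2) <= 1]]].

(* The planar counterpart of [locally_integrable]; the domain need not be open,
   so that it also covers L^1_loc of the closed half-plane. *)
Definition L1loc2 (R : realType) (D : set (R * R)) (g : R * R -> R) : Prop :=
  measurable_fun (D : set (measurableTypeR R * measurableTypeR R)) g /\
  forall K : set (R * R), compact K -> K `<=` D ->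
    (\int[leb2 R]_(p in K) `|g p|%:E < +oo)%E.

Definition BV1 (R : realType) (Omega : set R) (g : R -> R) : Prop :=
  locally_integrable Omega g /\ (TV1 Omega g < +oo)%E.

Definition BV2 (R : realType) (Omega : set (R * R)) (g : R * R -> R) : Prop :=
  L1loc2 Omega g /\ (TV2 Omega g < +oo)%E.

(* Membership in [Lfun] includes Borel measurability: an element of L^infty is
   represented by a Borel function. *)
Definition Linfty1 (R : realType) (g : R -> R) : Prop :=
  g \in Lfun lebesgue_measure +oo%E.

Definition Linfty2 (R : realType) (D : set (R * R)) (g : R * R -> R) : Prop :=
  (g \_ D : measurableTypeR R * measurableTypeR R -> R)
    \in Lfun (leb2 R) +oo%E.

Definition cvg_L1loc2 (R : realType) (D : set (R * R))
    (g_ : nat -> R * R -> R) (g : R * R -> R) : Prop :=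
  [/\ forall k, L1loc2 D (g_ k), L1loc2 D g &
      forall K : set (R * R), compact K -> K `<=` D ->
        (\int[leb2 R]_(p in K) `|g_ k p - g p|%:E)%E @[k --> \oo] --> 0%E].

(* A state is the pair of moments (u_j, v_j), j ranging over the integers. *)
Definition D1Q2_step (R : realType) (phi : R -> R) (s lambda : R)
    (w : (int -> R) * (int -> R)) : (int -> R) * (int -> R) :=
  let v_half := fun j => (1 - s) * w.2 j + s * phi (w.1 j) in
  let fp_half := fun j => w.1 j / 2 + v_half j / (2 * lambda) in
  let fm_half := fun j => w.1 j / 2 - v_half j / (2 * lambda) in
  let fp := fun j : int => fp_half (j - 1) in
  let fm := fun j : int => fm_half (j + 1) in
  (fun j => fp j + fm j, fun j => lambda * (fp j - fm j)).

Definition D1Q2_init (R : realType) (phi : R -> R) (u0 : R -> R) (dx : R) :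
    (int -> R) * (int -> R) :=
  let u_init := fun j : int =>
    dx^-1 *
    \int[lebesgue_measure]_(x in `[j%:~R * dx, (j + 1)%:~R * dx]) u0 x in
  (u_init, fun j => phi (u_init j)).

Definition D1Q2 (R : realType) (phi : R -> R) (s lambda : R) (u0 : R -> R)
    (dx : R) (n : nat) : (int -> R) * (int -> R) :=
  iter n (D1Q2_step phi s lambda) (D1Q2_init phi u0 dx).

(* The value w n j on [n dt, (n+1) dt) x [j dx, (j+1) dx), see
   [piecewise_constantE]; the value at negative times is irrelevant. *)
Definition piecewise_constant (R : realType) (dt dx : R)
    (w : nat -> int -> R) (p : R * R) : R :=
  w (Num.truncn (p.1 / dt)) (Num.floor (p.2 / dx)).

Lemma piecewise_constantE (R : realType) (dt dx : R) (w : nat -> int -> R)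
    (n : nat) (j : int) (t x : R) : 0 < dt -> 0 < dx ->
  n%:R * dt <= t < n.+1%:R * dt -> j%:~R * dx <= x < (j + 1)%:~R * dx ->
  piecewise_constant dt dx w (t, x) = w n j.
Proof.
move=> dt0 dx0 ht hx; rewrite /piecewise_constant/=; congr (w _ _).
  by apply: truncn_def; rewrite ler_pdivlMr// ltr_pdivrMr.
by apply: floor_def; rewrite ler_pdivlMr// ltr_pdivrMr.
Qed.

Definition u_Delta (R : realType) (phi : R -> R) (s lambda : R) (u0 : R -> R)
    (dx : R) : R * R -> R :=
  piecewise_constant (dx / lambda) dx
    (fun n j => (D1Q2 phi s lambda u0 dx n).1 j).

Definition v_Delta (R : realType) (phi : R -> R) (s lambda : R) (u0 : R -> R)
    (dx : R) : R * R -> R :=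
  piecewise_constant (dx / lambda) dx
    (fun n j => (D1Q2 phi s lambda u0 dx n).2 j).

(* C_c^infty of the closed half-plane is taken to be the restrictions of the
   elements of C_c^infty(R^2); the integrals only see these restrictions. *)
Definition weak_solution (R : realType) (phi : R -> R) (u0 : R -> R)
    (u : R * R -> R) : Prop :=
  forall psi : R * R -> R, Cinfty2 psi -> compactly_supported setT psi ->
    \int[leb2 R]_(p in half_plane R) (u p * d_t psi p + phi (u p) * d_x psi p)
    + \int[lebesgue_measure]_x (u0 x * psi (0, x)) = 0.

Definition is_max (R : realType) (A : set R) (m : R) : Prop :=
  A m /\ ubound A m.

(* Main.v *)
(** With [f^+/- = u / 2 +/- v / (2 lambda)], the equilibria
    [u / 2 +/- phi(u) / (2 lambda)] are nondecreasing on [[alpha, beta]] because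
    [|phi'| <= lambda] there. Hence relaxation is monotone and conserves [u]: it
    contracts the l^1 distance of the pairs [(f^+, f^-)] and keeps each of them
    between its equilibrium values at [alpha] and [beta]; transport does the same.
    Comparing a solution with its translates in [x] and in [t] bounds its
    variation over the cells by that of [u0], and the defect [v - phi(u)], which
    relaxation multiplies by [1 - s], is summable in [j] with a bound that does
    not depend on the mesh, so that its L^1 norm is O(dx).

    The functions [u_Delta] thus have a common L^1 modulus of continuity under
    translations, up to O(dx). Their values on a fixed grid converge along an
    ultrafilter, and refining the grid produces the limit [u]. It inherits the
    modulus, which bounds the difference quotients that define its variation;
    [v = phi(u)] inherits it because [phi] is Lipschitz on [[alpha, beta]].

    Finally [u(t + dt, x) = f^+(t, x - dx) + f^-(t, x + dx)] after relaxation.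
    Testing with [psi] and moving the translations onto [psi] gives the difference
    quotients of [psi] along [(1, lambda)] and [(1, - lambda)]; in the limit
    [f^+] and [f^-] are the equilibria at [u], so that the two contributions
    recombine into [u psi_t + phi(u) psi_x], and the first time step yields the
    initial datum. *)

Require Import Defs.
From HB Require Import structures.
From mathcomp Require Import all_boot all_order all_algebra archimedean.
From mathcomp Require Import all_classical all_reals all_analysis.
From mathcomp Require Import measurable_realfun ess_sup_inf.
From mathcomp Require Import ring lra zify.

Set Implicit Arguments.
Unset Strict Implicit.
Unset Printing Implicit Defensive.

Import Order.TTheory GRing.Theory Num.Theory.
Import numFieldNormedType.Exports.

Local Open Scope classical_set_scope.
Local Open Scope ring_scope.

(** * Monotonicity of the D1Q2 scheme *)

(** Mesh functions jump in time, and two times at distance h may be h / dt + 1 steps apart, so the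
    modulus is only C (h + dx), which does not vanish with h at a fixed mesh. Compactness therefore
    compares each function with its own samples on a fixed coarser grid. A bounded region meets
    finitely many nodes, so convergence at the nodes is uniform there; the limit along the
    ultrafilter is read at nodes only, since as a function of the point it need not be measurable.
    The variation of the datum is a supremum over test functions, whereas the scheme needs
    increments of cell averages: C^1 approximations of hat functions link the two without loss in
    the constant. Conversely, for the limit, the derivative of the test function becomes a
    difference quotient, which a translation carries over to u. Sums over all cells are encoded as
    finite sums bounded uniformly over all windows. For the variation in time, the contraction
    compares the scheme with itself one step later: the data are at equilibrium, so the first step
    is pure transport and costs one spatial variation V. *)

Definition bounded_sums (R : realType) (F : int -> R) (V : R) : Prop :=
  forall (a : int) (m : nat), \sum_(i < m) F (a + i%:Z) <= V.

Lemma bounded_sums_ge0 (R : realType) (F : int -> R) V :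
  bounded_sums F V -> 0 <= V.
Proof. by move=> /(_ 0 0%N); rewrite big_ord0. Qed.

Lemma bounded_sums_le (R : realType) (F G : int -> R) V :
  (forall j, F j <= G j) -> bounded_sums G V -> bounded_sums F V.
Proof.
move=> FG h a m; apply: le_trans (h a m).
by apply: ler_sum => i _; exact: FG.
Qed.

Lemma bounded_sumsD (R : realType) (F G : int -> R) V W :
  bounded_sums F V -> bounded_sums G W ->
  bounded_sums (fun j => F j + G j) (V + W).
Proof. by move=> hF hG a m; rewrite big_split /=; apply: lerD; [exact: hF|exact: hG]. Qed.

Lemma bounded_sumsZ (R : realType) (F : int -> R) V c : 0 <= c ->
  bounded_sums F V -> bounded_sums (fun j => c * F j) (c * V).
Proof. by move=> c0 hF a m; rewrite -mulr_sumr; apply: ler_wpM2l => //; exact: hF. Qed.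

Lemma sum_subrange_le (R : realType) (F : int -> R) (a : int) (k l m : nat) :
  (forall j, 0 <= F j) -> (k + m <= l)%N ->
  \sum_(i < m) F (a + k%:Z + i%:Z) <= \sum_(i < l) F (a + i%:Z).
Proof.
move=> F0 kml.
rewrite (eq_bigr (fun i : 'I_m => F (a + (i + k)%N%:Z))); last first.
  by move=> i _; rewrite PoszD (addrC (i%:Z)) addrA.
rewrite -(big_mkord xpredT (fun i => F (a + (i + k)%N%:Z))).
rewrite -(big_mkord xpredT (fun i => F (a + i%:Z))).
have -> : \sum_(0 <= i < m) F (a + (i + k)%N%:Z) = \sum_(k <= i < k + m) F (a + i%:Z).
  have := @big_addn R 0 +%R 0%N (k + m)%N k xpredT (fun i => F (a + i%:Z)).
  by rewrite add0n addKn => ->.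
rewrite (@big_cat_nat _ _ _ k 0 l)//=; last by lia.
rewrite (@big_cat_nat _ _ _ (k + m)%N k l)//=; last by lia.
rewrite addrCA lerDl addr_ge0//; apply: sumr_ge0 => i _; exact: F0.
Qed.

(** Transport moves f^+ and f^- by different amounts. The two shifted windows fit into one larger
    window, where nonnegativity allows the missing terms to be added. *)
Lemma bounded_sums_shift (R : realType) (A B : int -> R) (c d : int) V :
  (forall j, 0 <= A j) -> (forall j, 0 <= B j) ->
  bounded_sums (fun j => A j + B j) V ->
  bounded_sums (fun j => A (j + c) + B (j + d)) V.
Proof.
move=> A0 B0 h a m.
pose e := Num.min c d.
have [p cE] : exists p : nat, c = e + p%:Z.
  by exists `|c - e|%N; rewrite /e; case: (leP c d) => ?; lia.
have [q dE] : exists q : nat, d = e + q%:Z.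
  by exists `|d - e|%N; rewrite /e; case: (leP c d) => ?; lia.
apply: le_trans (h (a + e) (m + (p + q))%N).
rewrite big_split/= big_split/=; apply: lerD.
- apply: le_trans (@sum_subrange_le R A (a + e) p (m + (p + q)) m A0 _); last lia.
  by apply: ler_sum => i _; rewrite [X in A X](_ : _ = a + e + p%:Z + i%:Z)// cE; ring.
- apply: le_trans (@sum_subrange_le R B (a + e) q (m + (p + q)) m B0 _); last lia.
  by apply: ler_sum => i _; rewrite [X in B X](_ : _ = a + e + q%:Z + i%:Z)// dE; ring.
Qed.

Section D1Q2_monotonicity.
Context (R : realType) (phi : R -> R) (s lambda alpha beta : R).
Hypotheses (hs : 0 < s <= 1) (lambda_gt0 : 0 < lambda).

Definition eq_plus (u : R) : R := u / 2 + phi u / (2 * lambda).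
Definition eq_minus (u : R) : R := u / 2 - phi u / (2 * lambda).

Hypothesis eq_plus_nd : {in `[alpha, beta] &, {homo eq_plus : x y / x <= y}}.
Hypothesis eq_minus_nd : {in `[alpha, beta] &, {homo eq_minus : x y / x <= y}}.

Definition state := ((int -> R) * (int -> R))%type.

Definition f_plus (w : state) (j : int) : R := w.1 j / 2 + w.2 j / (2 * lambda).
Definition f_minus (w : state) (j : int) : R :=
  w.1 j / 2 - w.2 j / (2 * lambda).

Definition relax (w : state) : state :=
  (w.1, fun j => (1 - s) * w.2 j + s * phi (w.1 j)).

Definition state_dist (w z : state) (j : int) : R :=
  `|f_plus w j - f_plus z j| + `|f_minus w j - f_minus z j|.

Definition shift_state (w : state) : state :=
  (fun j => w.1 (j + 1), fun j => w.2 (j + 1)).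

(** The invariant constrains the two distributions separately: a bound on u alone would leave v free
    and would not survive transport. *)
Definition admissible (w : state) : Prop := forall j,
  eq_plus alpha <= f_plus w j <= eq_plus beta /\
  eq_minus alpha <= f_minus w j <= eq_minus beta.

Local Notation step := (D1Q2_step phi s lambda).

Lemma moment_u w j : w.1 j = f_plus w j + f_minus w j.
Proof. by rewrite /f_plus /f_minus; field; rewrite lt0r_neq0. Qed.

Lemma moment_v w j : w.2 j = lambda * (f_plus w j - f_minus w j).
Proof. by rewrite /f_plus /f_minus; field; rewrite lt0r_neq0. Qed.

Lemma eq_plusDminus u : eq_plus u + eq_minus u = u.
Proof. by rewrite /eq_plus /eq_minus; field; rewrite lt0r_neq0. Qed.

Lemma eq_plusBminus u : lambda * (eq_plus u - eq_minus u) = phi u.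
Proof. by rewrite /eq_plus /eq_minus; field; rewrite lt0r_neq0. Qed.

Lemma f_plus_step w j : f_plus (step w) j = f_plus (relax w) (j - 1).
Proof.
by rewrite /f_plus /D1Q2_step /relax /=; field; rewrite lt0r_neq0.
Qed.

Lemma f_minus_step w j : f_minus (step w) j = f_minus (relax w) (j + 1).
Proof.
by rewrite /f_minus /D1Q2_step /relax /=; field; rewrite lt0r_neq0.
Qed.

Lemma f_plus_relax w j :
  f_plus (relax w) j = (1 - s) * f_plus w j + s * eq_plus (w.1 j).
Proof. by rewrite /f_plus /relax /eq_plus /=; field; rewrite lt0r_neq0. Qed.

Lemma f_minus_relax w j :
  f_minus (relax w) j = (1 - s) * f_minus w j + s * eq_minus (w.1 j).
Proof. by rewrite /f_minus /relax /eq_minus /=; field; rewrite lt0r_neq0. Qed.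

Lemma step_shift w : step (shift_state w) = shift_state (step w).
Proof.
rewrite /D1Q2_step /shift_state /=.
have E (j : int) : j - 1 + 1 = j + 1 - 1 by ring.
by congr pair; apply/funext => j; rewrite !E.
Qed.

Lemma iter_step_shift n w :
  iter n step (shift_state w) = shift_state (iter n step w).
Proof. by elim: n => //= n ->; rewrite step_shift. Qed.

Lemma admissible_u w j : admissible w -> alpha <= w.1 j <= beta.
Proof.
move=> /(_ j)[/andP[h1 h2] /andP[h3 h4]]; rewrite moment_u.
by rewrite -{1}(eq_plusDminus alpha) -{1}(eq_plusDminus beta); apply/andP; split; apply: lerD.
Qed.

Lemma admissible_equilibrium w : (forall j, alpha <= w.1 j <= beta) ->
  (forall j, w.2 j = phi (w.1 j)) -> admissible w.
Proof.
move=> hu hv j; have uj := hu j; rewrite /f_plus /f_minus hv.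
have ab : alpha <= beta by case/andP: uj; exact: le_trans.
have Ia : alpha \in `[alpha, beta] by rewrite in_itv/= lexx.
have Ib : beta \in `[alpha, beta] by rewrite in_itv/= lexx andbT.
have Iu : w.1 j \in `[alpha, beta] by rewrite in_itv.
case/andP: uj => au ub.
by split; apply/andP; split; [exact: eq_plus_nd|exact: eq_plus_nd|
  exact: eq_minus_nd|exact: eq_minus_nd].
Qed.

Lemma relax_admissible w : admissible w -> admissible (relax w).
Proof.
move=> adm j; rewrite f_plus_relax f_minus_relax.
have uj := admissible_u j adm.
have ab : alpha <= beta by case/andP: uj; exact: le_trans.
have Ia : alpha \in `[alpha, beta] by rewrite in_itv/= lexx.
have Ib : beta \in `[alpha, beta] by rewrite in_itv/= lexx andbT.
have Iu : w.1 j \in `[alpha, beta] by rewrite in_itv.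
case/andP: uj => au ub.
have [/andP[p1 p2] /andP[m1 m2]] := adm j.
have a1 := eq_plus_nd Ia Iu au; have a2 := eq_plus_nd Iu Ib ub.
have b1 := eq_minus_nd Ia Iu au; have b2 := eq_minus_nd Iu Ib ub.
case/andP: hs => s0 s1; split; apply/andP; split; nra.
Qed.

Lemma step_admissible w : admissible w -> admissible (step w).
Proof.
move=> /relax_admissible adm j; rewrite f_plus_step f_minus_step.
by split; [exact: (adm _).1|exact: (adm _).2].
Qed.

Lemma iter_step_admissible n w : admissible w -> admissible (iter n step w).
Proof. by move=> adm; elim: n => //= n; exact: step_admissible. Qed.

Lemma shift_admissible w : admissible w -> admissible (shift_state w).
Proof. by move=> adm j; exact: adm. Qed.

(* The two increments of the equilibria have the same sign. *)
Lemma eq_distE (u v : R) : u \in `[alpha, beta] -> v \in `[alpha, beta] ->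
  `|eq_plus u - eq_plus v| + `|eq_minus u - eq_minus v| = `|u - v|.
Proof.
move=> uI vI; wlog uv : u v uI vI / u <= v.
  move=> H; have [/H->//|/ltW vu] := leP u v.
  rewrite distrC (distrC (eq_minus u)) (distrC u); exact: H.
rewrite distrC (distrC (eq_minus u)) (distrC u).
rewrite !ger0_norm ?subr_ge0//; last 2 first.
- exact: eq_minus_nd.
- exact: eq_plus_nd.
by have := eq_plusDminus v; have := eq_plusDminus u; lra.
Qed.

(** Let a, b be the differences of f^+, f^- and c, d those of the equilibria. By [eq_distE] and u =
    f^+ + f^-, one has |c| + |d| = |a + b|, so the new distance is at most (1 - s) (|a| + |b|) + s
    |a + b|. *)
Lemma relax_contraction w z j : admissible w -> admissible z ->
  state_dist (relax w) (relax z) j <= state_dist w z j.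
Proof.
move=> aw az; rewrite /state_dist !f_plus_relax !f_minus_relax.
have Iw : w.1 j \in `[alpha, beta] by rewrite in_itv/=; exact: admissible_u.
have Iz : z.1 j \in `[alpha, beta] by rewrite in_itv/=; exact: admissible_u.
have := eq_distE Iw Iz.
have -> : w.1 j - z.1 j =
  (f_plus w j - f_plus z j) + (f_minus w j - f_minus z j).
  by rewrite !moment_u; ring.
set a := f_plus w j - _; set b := f_minus w j - _.
set c := eq_plus _ - _; set d := eq_minus _ - _ => E.
have -> : (1 - s) * f_plus w j + s * eq_plus (w.1 j) -
  ((1 - s) * f_plus z j + s * eq_plus (z.1 j)) = (1 - s) * a + s * c.
  by rewrite /a /c; ring.
have -> : (1 - s) * f_minus w j + s * eq_minus (w.1 j) -
  ((1 - s) * f_minus z j + s * eq_minus (z.1 j)) = (1 - s) * b + s * d.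
  by rewrite /b /d; ring.
have [s0 s1] : 0 <= s /\ 0 <= 1 - s by case/andP: hs => *; split; lra.
have h1 := ler_normD ((1 - s) * a) (s * c).
have h2 := ler_normD ((1 - s) * b) (s * d).
have h3 := ler_normD a b.
have := ler_wpM2l s0 h3.
move: h1 h2; rewrite !normrM (ger0_norm s0) (ger0_norm s1) -E.
lra.
Qed.

Lemma relax_sums w z V : admissible w -> admissible z ->
  bounded_sums (state_dist w z) V ->
  bounded_sums (state_dist (relax w) (relax z)) V.
Proof. by move=> aw az; apply: bounded_sums_le => j; exact: relax_contraction. Qed.

Lemma step_sums w z V : admissible w -> admissible z ->
  bounded_sums (state_dist w z) V ->
  bounded_sums (state_dist (step w) (step z)) V.
Proof.
move=> aw az /(relax_sums aw az) h.
apply: bounded_sums_le (bounded_sums_shift (-1) 1 _ _ h) => // j.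
by rewrite /state_dist !f_plus_step !f_minus_step.
Qed.

Lemma iter_step_sums n w z V : admissible w -> admissible z ->
  bounded_sums (state_dist w z) V ->
  bounded_sums (state_dist (iter n step w) (iter n step z)) V.
Proof.
move=> aw az h; elim: n => //= n IH; apply: step_sums => //;
  exact: iter_step_admissible.
Qed.

Lemma dist_u_le w z j : `|w.1 j - z.1 j| <= state_dist w z j.
Proof.
rewrite !moment_u /state_dist; apply: le_trans (ler_normD _ _).
by rewrite le_eqVlt; apply/orP; left; apply/eqP; congr (`| _ |); ring.
Qed.

(** [phi] is [lambda] times the difference of the two equilibria, whose absolute increments add up
    to that of the argument. *)
Lemma phi_lipschitz (u v : R) : u \in `[alpha, beta] -> v \in `[alpha, beta] ->
  `|phi u - phi v| <= lambda * `|u - v|.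
Proof.
move=> uI vI; rewrite -(eq_distE uI vI) -!eq_plusBminus -mulrBr normrM.
rewrite gtr0_norm//; apply: ler_wpM2l; first exact: ltW.
rewrite [X in `|X| <= _](_ : _ = (eq_plus u - eq_plus v) -
  (eq_minus u - eq_minus v)); last by ring.
exact: ler_normB.
Qed.

Lemma admissible_v w j : admissible w ->
  `|w.2 j| <= lambda * (`|eq_plus alpha| + `|eq_plus beta| +
    `|eq_minus alpha| + `|eq_minus beta|).
Proof.
move=> /(_ j)[/andP[h1 h2] /andP[h3 h4]]; rewrite moment_v normrM gtr0_norm//.
apply: ler_wpM2l; [exact: ltW|rewrite ler_norml].
have := ler_norm (eq_plus beta); have := ler_norm (- eq_plus alpha).
have := ler_norm (eq_minus beta); have := ler_norm (- eq_minus alpha).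
have := normr_ge0 (eq_plus beta); have := normr_ge0 (eq_plus alpha).
have := normr_ge0 (eq_minus beta); have := normr_ge0 (eq_minus alpha).
by rewrite !normrN => *; apply/andP; split; lra.
Qed.

Section from_equilibrium.
Context (u0 : int -> R) (V : R).
Hypothesis u0I : forall j, alpha <= u0 j <= beta.
Hypothesis u0V : bounded_sums (fun j => `|u0 (j + 1) - u0 j|) V.

Let w0 : state := (u0, fun j => phi (u0 j)).
Let w n := iter n step w0.

Let adm0 : admissible w0.
Proof. exact: admissible_equilibrium. Qed.

Let adm n : admissible (w n).
Proof. exact: iter_step_admissible. Qed.

(** Equilibrium data are unchanged by relaxation, which makes the first time step pure transport. *)
Let relax0 : relax w0 = w0.
Proof. by rewrite /relax /w0/=; congr pair; apply/funext => j; ring. Qed.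

Lemma u_bounds n j : alpha <= (w n).1 j <= beta.
Proof. exact: admissible_u. Qed.

Lemma v_bounds n j : `|(w n).2 j| <= lambda * (`|eq_plus alpha| +
  `|eq_plus beta| + `|eq_minus alpha| + `|eq_minus beta|).
Proof. exact: admissible_v. Qed.

Let shift_sums n : bounded_sums (state_dist (w n) (shift_state (w n))) V.
Proof.
rewrite -iter_step_shift; apply: iter_step_sums => //.
  exact: shift_admissible.
apply: bounded_sums_le u0V => j.
have I i : u0 i \in `[alpha, beta] by rewrite in_itv/=; exact: u0I.
by rewrite distrC -(eq_distE (I j) (I (j + 1))).
Qed.

Lemma u_space_variation n :
  bounded_sums (fun j => `|(w n).1 (j + 1) - (w n).1 j|) V.
Proof.
apply: bounded_sums_le (shift_sums n) => j.
by rewrite distrC; exact: (dist_u_le (w n) (shift_state (w n)) j).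
Qed.

(** By contraction it suffices to treat the first step, which only transports: f^+ at j is replaced
    by its value at j - 1 and f^- by its value at j + 1. This is the spatial increment of f^+
    shifted by -1 and that of f^- left in place. *)
Let step_sumsE n : bounded_sums (state_dist (w n) (w n.+1)) V.
Proof.
rewrite /w iterSr; apply: iter_step_sums => //; first exact: step_admissible.
apply: bounded_sums_le (bounded_sums_shift (-1) 0 _ _ (shift_sums 0%N)) => // j.
rewrite /state_dist f_plus_step f_minus_step relax0 addr0.
have E : j - 1 + 1 = j :> int by ring.
rewrite [X in X <= _](_ : _ = `|f_plus w0 (j - 1) - f_plus w0 j|
   + `|f_minus w0 j - f_minus w0 (j + 1)|); last by rewrite (distrC (f_plus w0 j)).
by rewrite {2}/f_plus -{2 3}E.
Qed.

Lemma u_step_variation n :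
  bounded_sums (fun j => `|(w n.+1).1 j - (w n).1 j|) V.
Proof.
by apply: bounded_sums_le (step_sumsE n) => j; rewrite distrC; exact: dist_u_le.
Qed.

Lemma u_time_variation n k :
  bounded_sums (fun j => `|(w (n + k)).1 j - (w n).1 j|) (k%:R * V).
Proof.
elim: k => [a m|k IH].
  by rewrite mul0r big1// => i _; rewrite addn0 subrr normr0.
rewrite -natr1 mulrDl mul1r addrC.
apply: bounded_sums_le (bounded_sumsD (u_step_variation (n + k)) IH) => j.
by rewrite addnS; apply: ler_distD.
Qed.

(** The sums D_n of the defect obey D_{n+1} <= (1 - s) D_n + 2 lambda V, with one lambda V for
    transport and one for the change of phi(u) during the step. The bound is the fixed point of this
    recursion, which starts from D_0 = 0. *)
Lemma equilibrium_defect n :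
  bounded_sums (fun j => `|(w n).2 j - phi ((w n).1 j)|) (2 * lambda * V / s).
Proof.
have V0 : 0 <= V := bounded_sums_ge0 u0V.
have s0 : 0 < s by case/andP: hs.
elim: n => [a m|n IH].
  rewrite big1 => [|i _]; last by rewrite subrr normr0.
  by rewrite divr_ge0 ?(ltW s0)// !mulr_ge0// ltW.
have s1 : 0 <= 1 - s by case/andP: hs => *; lra.
pose r := relax (w n).
have transport : bounded_sums (fun j => `|f_plus r (j - 1) - f_plus r j| +
    `|f_minus r j - f_minus r (j + 1)|) V.
  have h : bounded_sums (state_dist r (shift_state r)) V.
    exact: (relax_sums (adm n) (shift_admissible (adm n)) (shift_sums n)).
  apply: bounded_sums_le (bounded_sums_shift (-1) 0 _ _ h) => // j.
  have E : j - 1 + 1 = j :> int by ring.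
  by rewrite addr0 {2}/f_plus -{2 3}E.
have hD := bounded_sumsD (bounded_sumsD (bounded_sumsZ (ltW lambda_gt0) transport)
  (bounded_sumsZ s1 IH)) (bounded_sumsZ (ltW lambda_gt0) (u_step_variation n)).
have -> : 2 * lambda * V / s = lambda * V + (1 - s) * (2 * lambda * V / s) +
  lambda * V by field; rewrite lt0r_neq0.
apply: bounded_sums_le hD => j.
(* The three lines are the displacement of the distributions, the defect left by relaxation, and the
   change of the equilibrium flux. *)
have -> : (w n.+1).2 j - phi ((w n.+1).1 j) =
   lambda * ((f_plus r (j - 1) - f_plus r j) +
             (f_minus r j - f_minus r (j + 1))) +
   (1 - s) * ((w n).2 j - phi ((w n).1 j)) +
   (phi ((w n).1 j) - phi ((w n.+1).1 j)).
  have -> : (w n.+1).2 j = lambda * (f_plus r (j - 1) - f_minus r (j + 1)).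
    by rewrite moment_v f_plus_step f_minus_step.
  have -> : f_plus r j = f_minus r j + r.2 j / lambda.
    by rewrite /f_plus /f_minus; field; rewrite lt0r_neq0.
  by rewrite {5}/r /=; field; rewrite lt0r_neq0.
apply: le_trans (ler_normD _ _) _; apply: lerD; last first.
  rewrite distrC; apply: phi_lipschitz; rewrite in_itv/=.
    exact: (u_bounds n.+1 j).
  exact: (u_bounds n j).
apply: le_trans (ler_normD _ _) _; apply: lerD.
  by rewrite normrM gtr0_norm// ler_wpM2l ?ler_normD// ltW.
by rewrite normrM ger0_norm.
Qed.

Lemma u_transport n j :
  (w n.+1).1 j = f_plus (relax (w n)) (j - 1) + f_minus (relax (w n)) (j + 1).
Proof. by rewrite moment_u f_plus_step f_minus_step. Qed.

End from_equilibrium.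
End D1Q2_monotonicity.

(** * Lebesgue measure on the plane *)

Section plane_measure.
Context (R : realType).
Local Notation mu := (@lebesgue_measure R).
Local Notation line := (measurableTypeR R).
Local Notation plane := (measurableTypeR R * measurableTypeR R)%type.

Lemma measurable_fun_shift (a : R) :
  measurable_fun [set: line] (fun x : line => (x + a : line)).
Proof. exact: measurable_funD. Qed.

(** The pushforward under the shift agrees with Lebesgue measure on half-open intervals, and these
    determine it. *)
Lemma lebesgue_measure_shift (a : R) (A : set line) : measurable A ->
  mu ((fun x : line => (x + a : line)) @^-1` A) = mu A.
Proof.
move=> mA; have mf := measurable_fun_shift a.
rewrite -[LHS]/(pushforward mu (fun x : line => (x + a : line)) A).
apply/esym/lebesgue_measure_unique => //= _ [[b c]] _ <-.
rewrite /pushforward.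
rewrite (_ : _ @^-1` _ = `]b - a, c - a]%classic); last first.
  by apply/seteqP; split => x /=; rewrite !in_itv/= ltrBlDr lerBrDr.
by rewrite !lebesgue_measure_itv/= !lte_fin ltrD2r -!EFinB; congr (if _ then (_%:E) else _); ring.
Qed.

Lemma leb2X (A B : set line) : measurable A -> measurable B ->
  leb2 R (A `*` B) = (mu A * mu B)%E.
Proof. exact: product_measure1E. Qed.

Definition translate (a p : R * R) : R * R := (p.1 + a.1, p.2 + a.2).

Lemma measurable_translate (a : R * R) :
  measurable_fun [set: plane] (translate a : plane -> plane).
Proof.
apply/measurable_fun_pairP; split; apply: measurable_funD => //.
Qed.

(** The product measure is determined by its values on rectangles, so invariance follows coordinate
    by coordinate. *)
Lemma leb2_translate (a : R * R) (A : set plane) : measurable A ->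
  leb2 R ((translate a : plane -> plane) @^-1` A) = leb2 R A.
Proof.
move=> mA; have mf := measurable_translate a.
rewrite -[LHS]/(pushforward (leb2 R) (translate a : plane -> plane) A).
apply/esym/product_measure_unique => // B C mB mC.
rewrite [LHS](_ : _ = leb2 R (((fun x : line => (x + a.1 : line)) @^-1` B) `*`
  ((fun x : line => (x + a.2 : line)) @^-1` C)))//.
have mB' : measurable ((fun x : line => (x + a.1 : line)) @^-1` B).
  by rewrite -[X in measurable X]setTI; exact: measurable_fun_shift.
have mC' : measurable ((fun x : line => (x + a.2 : line)) @^-1` C).
  by rewrite -[X in measurable X]setTI; exact: measurable_fun_shift.
rewrite leb2X//.
by congr (_ * _)%E; exact: lebesgue_measure_shift.
Qed.

Lemma ge0_integral_translate (a : R * R) (f : plane -> \bar R) :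
  measurable_fun setT f -> (forall p, 0 <= f p)%E ->
  (\int[leb2 R]_p f (translate a p) = \int[leb2 R]_p f p)%E.
Proof.
move=> mf f0; have ms := measurable_translate a.
rewrite -[RHS](@eq_measure_integral _ _ _ _ (leb2 R)
  (pushforward (leb2 R) (translate a : plane -> plane))).
  by rewrite ge0_integral_pushforward.
by move=> A mA _; exact: leb2_translate.
Qed.

Lemma Rintegral_translate (a : R * R) (f : plane -> R) :
  measurable_fun setT f -> (leb2 R).-integrable setT (EFin \o f) ->
  \int[leb2 R]_p f (translate a p) = \int[leb2 R]_p f p.
Proof.
move=> mf intf; congr fine; have ms := measurable_translate a.
rewrite -[RHS](@eq_measure_integral _ _ _ _ (leb2 R)
  (pushforward (leb2 R) (translate a : plane -> plane))).
  rewrite integral_pushforward//; first exact/measurable_EFinP.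
  move/integrableP : intf => [m1 ltf]; apply/integrableP; split.
    exact: measurableT_comp.
  rewrite (@ge0_integral_translate a (fun p => `|(EFin \o f) p|%E))//.
  exact: measurableT_comp.
by move=> A mA _; exact: leb2_translate.
Qed.

Definition box (T N : R) : set (R * R) := `[0, T] `*` `[- N, N].

Lemma boxP T N (p : R * R) : box T N p <-> 0 <= p.1 <= T /\ - N <= p.2 <= N.
Proof. by rewrite /box /= !in_itv. Qed.

Lemma measurable_box T N : measurable (box T N : set plane).
Proof. exact: measurableX. Qed.

Lemma leb2_box T N : 0 <= T -> 0 <= N -> leb2 R (box T N) = (T * (2 * N))%:E.
Proof.
move=> T0 N0; rewrite leb2X// !lebesgue_measure_itv/= !lte_fin.
rewrite -!EFinB subr0 opprK.
have E (x : R) : 0 <= x -> (if 0 < x then x%:E else 0%E) = x%:E :> \bar R.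
  by rewrite le_eqVlt => /predU1P[<-|->//]; rewrite ltxx.
rewrite E// (_ : (- N < N) = (0 < N + N)); last by rewrite -subr_gt0 opprK.
by rewrite E ?addr_ge0// -EFinM; congr (_%:E); ring.
Qed.

Lemma leb2_box_lty T N : (leb2 R (box T N) < +oo)%E.
Proof.
apply: (@le_lt_trans _ _ (leb2 R (box (Num.max 0 T) (Num.max 0 N)))).
  apply: le_measure; rewrite ?inE; try exact: measurable_box.
  move=> p /boxP[/andP[? ?] /andP[? ?]]; apply/boxP.
  by rewrite lerNl !le_max; split; apply/andP; split => //; apply/orP; right=> //;
   rewrite lerNl.
by rewrite leb2_box ?le_max ?lexx// ltry.
Qed.

(** Tonelli: this turns the one-dimensional estimates, uniform in t, into estimates on space-time
    boxes. *)
Lemma ge0_integral_box_le (f : plane -> \bar R) T N (c : R) : 0 <= T ->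
  measurable_fun setT f -> (forall p, 0 <= f p)%E ->
  (forall t : R, 0 <= t <= T ->
    (\int[mu]_(x in `[(- N)%R, N]) f (t, x) <= c%:E)%E) ->
  (\int[leb2 R]_(p in box T N) f p <= (T * c)%:E)%E.
Proof.
move=> T0 mf f0 fc.
have c0 : 0 <= c.
  rewrite -lee_fin; apply: le_trans (fc 0 _); last by rewrite lexx.
  exact: integral_ge0.
rewrite integral_mkcond (@fubini_tonelli1 _ _ _ _ _ mu mu)//=; last 2 first.
- by apply/(measurable_restrictT _ (measurable_box T N)); exact: measurable_funTS.
- by move=> p; exact: erestrict_ge0.
rewrite [leLHS](_ : _ = \int[mu]_(t in `[0%R, T]) \int[mu]_(x in `[(- N)%R, N]) f (t, x))%E; last first.
  rewrite [RHS]integral_mkcond; apply: eq_integral => t _.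
  rewrite /fubini_F !patchE; case: ifPn => tT.
    rewrite [RHS]integral_mkcond; apply: eq_integral => x _.
    by rewrite !patchE /box in_setX tT.
  apply: integral0_eq => x _; rewrite patchE /box in_setX.
  by rewrite (negbTE tT).
apply: (@le_trans _ _ (\int[mu]_(t in `[0%R, T]) (cst c%:E t))%E).
  apply: ge0_le_integral => //=.
  - by move=> t _; exact: integral_ge0.
  - apply: (@measurable_funTS _ _ _ _ _ (fun t => \int[mu]_(x in `[(- N)%R, N]) f (t, x))%E).
    rewrite [X in measurable_fun _ X](_ : _ = fubini_F mu (f \_ (setT `*` `[(- N)%R, N]))).
      apply: measurable_fun_fubini_tonelli_F.
      - have mS : measurable ([set: line] `*` (`[(- N), N]%classic : set line)).
          exact: measurableX.
        by apply/(measurable_restrictT _ mS); exact: measurable_funTS.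
      - by move=> p; exact: erestrict_ge0.
    apply/funext => t; rewrite integral_mkcond; apply: eq_integral => x _.
    by rewrite !patchE in_setX in_setT.
rewrite integral_cst//= lebesgue_measure_itv/= lte_fin.
rewrite le_eqVlt; apply/orP; left; apply/eqP.
case: ifPn => [|]; first by rewrite -EFinB subr0 -EFinM mulrC.
rewrite -leNgt => T0'; have -> : T = 0 by apply/eqP; rewrite eq_le T0 T0'.
by rewrite mule0 mul0r.
Qed.

End plane_measure.

(** * Cell indices, sampling on a grid, and measurability *)

Section grid.
Context (R : realType).
Local Notation mu := (@lebesgue_measure R).
Local Notation line := (measurableTypeR R).
Local Notation plane := (measurableTypeR R * measurableTypeR R)%type.

(** Every preimage under the composite is a union of fibres of [f], of which there are countably
    many. *)
Lemma measurable_countable_comp d (T : measurableType d) (I : countType)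
    (f : T -> I) : (forall i, measurable (f @^-1` [set i])) ->
  forall d' (U : measurableType d') (g : I -> U), measurable_fun setT (g \o f).
Proof.
move=> mf d' U g _ Y mY; rewrite setTI.
rewrite (_ : _ @^-1` _ = \bigcup_i (if g i \in Y then f @^-1` [set i] else set0)).
  apply: countable_bigcupT_measurable; first exact: countableP.
  by move=> i; case: ifP.
apply/seteqP; split => [x /= Yx|x [i _]/=].
  by exists (f x) => //; rewrite mem_set.
by case: ifPn => // /set_mem Yi /= ->.
Qed.

Definition floor2 (dt dx : R) (p : R * R) : int * int :=
  (Num.floor (p.1 / dt), Num.floor (p.2 / dx)).

Lemma floor_preimage (d : R) (j : int) : 0 < d ->
  (fun x : R => Num.floor (x / d)) @^-1` [set j] =
  `[j%:~R * d, (j + 1)%:~R * d[%classic.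
Proof.
move=> d0; apply/seteqP; split => x /=; rewrite in_itv/=.
  by move=> <-; rewrite -ler_pdivlMr// -ltr_pdivrMr// floor_itv.
by rewrite -ler_pdivlMr// -ltr_pdivrMr// => h; exact: floor_def.
Qed.

Lemma measurable_floor2_comp (dt dx : R) : 0 < dt -> 0 < dx ->
  forall d' (U : measurableType d') (g : int * int -> U),
  measurable_fun [set: plane] (g \o floor2 dt dx).
Proof.
move=> dt0 dx0; apply: (@measurable_countable_comp _ plane).
move=> [i j]; rewrite (_ : _ @^-1` _ =
  (((fun x : R => Num.floor (x / dt)) @^-1` [set i]) `*`
   ((fun x : R => Num.floor (x / dx)) @^-1` [set j]) : set plane)); last first.
  by apply/seteqP; split => [[t x] /= [-> ->]//|[t x] /= [<- <-]].
by rewrite !floor_preimage//; apply: measurableX.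
Qed.

Lemma measurable_floor_comp (dx : R) (g : int -> R) : 0 < dx ->
  measurable_fun [set: line] (fun x : line => g (Num.floor ((x : R) / dx))).
Proof.
move=> dx0; apply: (@measurable_countable_comp _ line _
  (fun x : line => Num.floor ((x : R) / dx))) => j.
by rewrite floor_preimage.
Qed.

(** Recovers [Num.truncn] from [Num.floor], negative indices being sent to 0, so that
    [piecewise_constant] factors through the countable index given by [floor2]. *)
Definition nat_of_int (i : int) : nat := if i is Posz n then n else 0%N.

Lemma piecewise_constant_floor2 (dt dx : R) w :
  piecewise_constant dt dx w =
  (fun k : int * int => w (nat_of_int k.1) k.2) \o floor2 dt dx.
Proof. by apply/funext => p; rewrite /piecewise_constant truncEfloor. Qed.

Lemma measurable_piecewise_constant (dt dx : R) w : 0 < dt -> 0 < dx ->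
  measurable_fun [set: plane] (piecewise_constant dt dx w : plane -> R).
Proof.
by move=> *; rewrite piecewise_constant_floor2; exact: measurable_floor2_comp.
Qed.

Definition grid (eta : R) (p : R * R) : R * R :=
  ((Num.truncn (p.1 / eta))%:R * eta, (Num.floor (p.2 / eta))%:~R * eta).

Lemma grid_t (eta t : R) : 0 < eta -> 0 <= t ->
  `|(Num.truncn (t / eta))%:R * eta - t| <= eta.
Proof.
move=> e0 t0; have /truncn_itv : 0 <= t / eta by rewrite divr_ge0// ltW.
rewrite ler_pdivlMr// ltr_pdivrMr// -natr1 mulrDl mul1r => /andP[h1 h2].
by rewrite ler0_norm; lra.
Qed.

Lemma grid_x (eta x : R) : 0 < eta ->
  `|(Num.floor (x / eta))%:~R * eta - x| <= eta.
Proof.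
move=> e0; have := floor_itv (x / eta).
rewrite ler_pdivlMr// ltr_pdivrMr// intrD mulrDl mul1r => /andP[h1 h2].
by rewrite ler0_norm; lra.
Qed.

Lemma measurable_grid eta : 0 < eta ->
  measurable_fun [set: plane] (grid eta : plane -> plane).
Proof.
move=> e0; rewrite (_ : grid eta = (fun k : int * int =>
  (((nat_of_int k.1)%:R * eta, k.2%:~R * eta) : plane)) \o floor2 eta eta).
  exact: measurable_floor2_comp.
by apply/funext => p; rewrite /grid truncEfloor.
Qed.

(** The sigma-algebra here is the product one. A continuous function is the pointwise limit of its
    samples at the nodes of mesh 1 / (n + 1), and each sample depends on a cell index only. *)
Lemma continuous_plane_measurable (f : R * R -> R) : continuous f ->
  measurable_fun [set: plane] (f : plane -> R).
Proof.
move=> cf.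
pose e n : R := n.+1%:R^-1.
have e0 n : 0 < e n by rewrite invr_gt0.
pose g n (p : R * R) : R * R :=
  ((Num.floor (p.1 / e n))%:~R * e n, (Num.floor (p.2 / e n))%:~R * e n).
apply: (@measurable_fun_cvg _ plane _ _ (fun n p => f (g n p))).
  move=> n; exact: (@measurable_floor2_comp (e n) (e n) (e0 n) (e0 n) _ R
    (fun k => f (k.1%:~R * e n, k.2%:~R * e n))).
move=> p _; apply: (@cvg_comp _ _ _ (g ^~ p) f \oo (nbhs p) (nbhs (f p)) _ (cf p)).
have h (x : R) : (Num.floor (x / e n))%:~R * e n @[n --> \oo] --> x.
  apply/cvgrPdist_le => eps eps0; near=> n; rewrite distrC.
  apply: (le_trans (grid_x x (e0 n))).
  by apply: ltW; near: n; exact: near_infty_natSinv_lt (PosNum eps0).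
case: p => t x; have := cvg_pair (h t) (h x); exact.
Unshelve. all: by end_near. Qed.

Lemma integral_indic_sum_le (D : set line) (f : line -> R) (m : nat)
    (c : nat -> R) (A : nat -> set line) (l : R) :
  measurable D -> measurable_fun setT f -> (forall x, 0 <= f x) ->
  (forall i, 0 <= c i) -> (forall i, measurable (A i)) ->
  (forall i, (mu (A i) <= l%:E)%E) ->
  (forall x, D x -> f x <= \sum_(i < m) c i * \1_(A i) x) ->
  (\int[mu]_(x in D) (f x)%:E <= (l * \sum_(i < m) c i)%:E)%E.
Proof.
move=> mD mf f0 c0 mA Al fle.
apply: (@le_trans _ _
   (\int[mu]_(x in D) \sum_(i < m) (c i * \1_(A i) x)%:E))%E.
  apply: ge0_le_integral => //=.
  - by move=> x _; rewrite lee_fin.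
  - by apply/measurable_EFinP; exact: measurable_funTS.
  - apply: (emeasurable_sum _ (h := fun (i : 'I_m) x => (c i * \1_(A i) x)%:E)).
    move=> i; apply/measurable_EFinP.
    by apply: measurable_funM => //; exact: measurable_indic.
  - by move=> x Dx; rewrite sumEFin lee_fin; exact: fle.
rewrite ge0_integral_sum//; last 2 first.
- move=> i; apply/measurable_EFinP.
  by apply: measurable_funM => //; exact: measurable_indic.
- by move=> i x _; rewrite lee_fin mulr_ge0.
rewrite mulr_sumr -sumEFin; apply: lee_sum => i _.
under eq_integral do rewrite EFinM.
rewrite ge0_integralZl_EFin//; last first.
  by apply/measurable_EFinP; exact: measurable_indic.
have Ail : (mu (A i `&` D) <= l%:E)%E.
  apply: le_trans (Al i); apply: le_measure; rewrite ?inE//.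
  exact: measurableI.
rewrite integral_indic// mulrC EFinM; apply: lee_pmul => //.
by rewrite lee_fin.
Qed.

Lemma lebesgue_measure_itvcc (a l : R) : 0 <= l ->
  mu `[a, a + l] = l%:E.
Proof.
move=> l0; rewrite lebesgue_measure_itv/= lte_fin ltrDl -EFinB addrC addKr.
by move: l0; rewrite le_eqVlt => /predU1P[<-|->//]; rewrite ltxx.
Qed.

End grid.

(** * Moving the argument of a piecewise constant function *)

Lemma dist_sum_increments (R : realType) (a : int -> R) (j : int) (n : nat) :
  `|a (j + n%:Z) - a j| <= \sum_(i < n) `|a (j + i%:Z + 1) - a (j + i%:Z)|.
Proof.
elim: n => [|n IH]; first by rewrite big_ord0 addr0 subrr normr0.
rewrite big_ord_recr/= addrC.
apply: le_trans (ler_distD (a (j + n%:Z)) _ _) _; apply: lerD => //.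
by rewrite -addn1 PoszD addrA.
Qed.

Section piecewise_constant_estimates.
Context (R : realType).
Local Notation mu := (@lebesgue_measure R).
Local Notation line := (measurableTypeR R).
Local Notation plane := (measurableTypeR R * measurableTypeR R)%type.

(* The jump of [a] between cells [k] and [k + 1] is located at [(k + 1) * d]; it
   separates [x] from [y] only if it is within distance [h] of [x]. *)
Lemma increment_le_jumps (a : int -> R) (d h x y : R) (b : int) (m : nat) :
  0 < d -> `|y - x| <= h ->
  b <= Num.floor (x / d) <= b + m%:Z -> b <= Num.floor (y / d) <= b + m%:Z ->
  `|a (Num.floor (x / d)) - a (Num.floor (y / d))| <=
  \sum_(i < m) `|a (b + i%:Z + 1) - a (b + i%:Z)| *
    \1_(`[(b + i%:Z + 1)%:~R * d - h, (b + i%:Z + 1)%:~R * d - h + 2 * h]) x.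
Proof.
move=> d0 yx hx hy.
pose F (k : int) : R := `|a (k + 1) - a k| *
    \1_(`[(k + 1)%:~R * d - h, (k + 1)%:~R * d - h + 2 * h]) x.
have F0 k : 0 <= F k by rewrite mulr_ge0.
(* This is the case of ordered cells: every jump between them lies between [x1] and [y1], hence
   within [h] of [x]. It serves for x left of y and, with the roles exchanged, for y left of x. *)
have key (j j' : int) (x1 y1 : R) : b <= j -> j' <= b + m%:Z -> j <= j' ->
   x1 < (j + 1)%:~R * d -> j'%:~R * d <= y1 -> x - h <= x1 -> y1 <= x + h ->
  `|a j' - a j| <= \sum_(i < m) F (b + i%:Z).
  move=> bj jm jj' x1j j'y1 xx1 y1x.
  have [n j'E] : exists n : nat, j' = j + n%:Z by exists `|j' - j|%N; lia.
  have [k jE] : exists k : nat, j = b + k%:Z by exists `|j - b|%N; lia.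
  rewrite j'E; apply: (le_trans (dist_sum_increments _ _ _)).
  apply: (@le_trans _ _ (\sum_(i < n) F (j + i%:Z))); last first.
    by rewrite jE; apply: sum_subrange_le => //; lia.
  apply: ler_sum => i _; rewrite /F indicE mem_set ?mulr1//= in_itv/=.
  have e1 : (j + 1)%:~R * d <= (j + i%:Z + 1)%:~R * d.
    by apply: ler_wpM2r; [exact: ltW|rewrite ler_int; lia].
  have e2 : (j + i%:Z + 1)%:~R * d <= j'%:~R * d.
    by apply: ler_wpM2r; [exact: ltW|rewrite ler_int j'E; have := ltn_ord i; lia].
  by apply/andP; split; lra.
move: yx; rewrite ler_norml => /andP[yx1 yx2].
have := floor_itv (x / d); rewrite ler_pdivlMr// ltr_pdivrMr// => /andP[fx1 fx2].
have := floor_itv (y / d); rewrite ler_pdivlMr// ltr_pdivrMr// => /andP[fy1 fy2].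
case/andP: hx => hx1 hx2; case/andP: hy => hy1 hy2.
have h0 : 0 <= h by lra.
have [jj'|/ltW jj'] := leP (Num.floor (x / d)) (Num.floor (y / d)).
  by rewrite distrC; apply: (key _ _ x y) => //; lra.
by apply: (key _ _ y x) => //; lra.
Qed.

(** A given jump is crossed only by points x in an interval of length 2 h, whence 2 h V with no
    error of order d. The map [sg] will be either a translation or the projection to a grid. *)
Lemma space_increment_integral (a : int -> R) (V d h N : R) (sg : R -> R) :
  0 < d -> 0 <= N ->
  bounded_sums (fun j => `|a (j + 1) - a j|) V ->
  measurable_fun [set: line] (sg : line -> line) ->
  (forall x, `|sg x - x| <= h) ->
  (\int[mu]_(x in `[(- N)%R, N])
     `|a (Num.floor (x / d)) - a (Num.floor (sg x / d))|%:E
   <= (2 * h * V)%:E)%E.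
Proof.
move=> d0 N0 aV msg sgh.
have h0 : 0 <= h by apply: le_trans (sgh 0).
pose b := Num.floor ((- N - h) / d); pose e := Num.floor ((N + h) / d).
have be : b <= e by apply: le_floor; rewrite ler_pM2r ?invr_gt0//; lra.
have ebm : e = b + `|e - b|%N%:Z by lia.
have fl z : - N - h <= z <= N + h -> b <= Num.floor (z / d) <= b + `|e - b|%N%:Z.
  by move=> /andP[z1 z2]; rewrite -ebm; apply/andP; split; apply: le_floor;
    rewrite ler_pM2r ?invr_gt0.
pose c i := `|a (b + i%:Z + 1) - a (b + i%:Z)|.
apply: (@le_trans _ _ (2 * h * \sum_(i < `|e - b|%N) c i)%:E); last first.
  by rewrite lee_fin; apply: ler_wpM2l; [exact: mulr_ge0|exact: aV].
apply: (@integral_indic_sum_le R _ _ _ c (fun i =>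
  `[(b + i%:Z + 1)%:~R * d - h, (b + i%:Z + 1)%:~R * d - h + 2 * h]%classic)) => //.
- apply: measurableT_comp => //; apply: measurable_funB.
    exact: measurable_floor_comp.
  apply: (@measurableT_comp _ _ _ line line R (fun x => a (Num.floor (x / d)))) => //.
  exact: measurable_floor_comp.
- by move=> i; exact: normr_ge0.
- by move=> i; rewrite lebesgue_measure_itvcc// mulr_ge0.
- move=> x /=; rewrite in_itv/= => /andP[x1 x2]; apply: increment_le_jumps => //.
    by apply: fl; apply/andP; split; lra.
  by have := sgh x; rewrite ler_norml => /andP[? ?]; apply: fl; apply/andP; split; lra.
Qed.

Lemma cell_sum_integral (c : int -> R) (S d N : R) : 0 < d -> 0 <= N ->
  bounded_sums (fun j => `|c j|) S ->
  (\int[mu]_(x in `[(- N)%R, N]) `|c (Num.floor (x / d))|%:E <= (d * S)%:E)%E.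
Proof.
move=> d0 N0 cS.
pose b := Num.floor ((- N) / d); pose e := Num.floor (N / d).
have be : b <= e by apply: le_floor; rewrite ler_pM2r ?invr_gt0//; lra.
pose F i := `|c (b + i%:Z)|.
apply: (@le_trans _ _ (d * \sum_(i < `|e - b|.+1%N) F i)%:E); last first.
  by rewrite lee_fin; apply: ler_wpM2l; [exact: ltW|exact: cS].
apply: (@integral_indic_sum_le R _ _ _ F (fun i =>
  `[(b + i%:Z)%:~R * d, (b + i%:Z)%:~R * d + d]%classic)) => //.
- by apply: measurableT_comp => //; exact: measurable_floor_comp.
- by move=> i; exact: normr_ge0.
- by move=> i; rewrite lebesgue_measure_itvcc// ltW.
- move=> x /=; rewrite in_itv/= => /andP[x1 x2].
  pose G (k : int) := `|c k| * \1_(`[k%:~R * d, k%:~R * d + d]) x : R.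
  set j := Num.floor (x / d).
  have bj : b <= j by apply: le_floor; rewrite ler_pM2r ?invr_gt0.
  have je : j <= e by apply: le_floor; rewrite ler_pM2r ?invr_gt0.
  have jE : j = b + `|j - b|%N%:Z by lia.
  have := @sum_subrange_le R G b `|j - b|%N `|e - b|.+1 1.
  rewrite big_ord1 addr0 -jE => H; apply: le_trans (H _ _) => //; last by lia.
    rewrite /G indicE mem_set ?mulr1//= in_itv/=.
    have := floor_itv (x / d); rewrite ler_pdivlMr// ltr_pdivrMr// -/j.
    by rewrite intrD mulrDl mul1r => /andP[-> /ltW].
  by move=> k; rewrite mulr_ge0.
Qed.

(** Times at distance h may be h / dt + 1 steps apart; the extra step is the origin of the O(dx)
    term in the modulus. *)
Lemma truncn_dist (dt t t' h : R) : 0 < dt -> 0 <= t -> 0 <= t' ->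
  `|t' - t| <= h -> (Num.truncn (t / dt) <= Num.truncn (t' / dt))%N ->
  (Num.truncn (t' / dt) - Num.truncn (t / dt))%N%:R * dt <= h + dt.
Proof.
move=> dt0 t0 t'0; rewrite ler_norml => /andP[h1 h2] le.
have /truncn_itv : 0 <= t / dt by rewrite divr_ge0// ltW.
have /truncn_itv : 0 <= t' / dt by rewrite divr_ge0// ltW.
rewrite !ler_pdivlMr// !ltr_pdivrMr// -!natr1 !mulrDl !mul1r.
by move=> /andP[? ?] /andP[? ?]; rewrite natrB// mulrBl; lra.
Qed.

Section one_family.
Context (a : nat -> int -> R) (V lambda dx : R).
Hypotheses (lambda_gt0 : 0 < lambda) (dx_gt0 : 0 < dx).
Hypothesis aspace : forall n, bounded_sums (fun j => `|a n (j + 1) - a n j|) V.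
Hypothesis atime : forall n k,
  bounded_sums (fun j => `|a (n + k)%N j - a n j|) (k%:R * V).

Let dt := dx / lambda.
Let dt_gt0 : 0 < dt. Proof. exact: divr_gt0. Qed.
Let V_ge0 : 0 <= V. Proof. exact: bounded_sums_ge0 (aspace 0%N). Qed.

(** With k time steps between the two instants, the integral is at most k dx V, and k dx = lambda k
    dt <= lambda (h + dt) = lambda h + dx. *)
Lemma time_increment_integral (t t' h N : R) : 0 <= N -> 0 <= t -> 0 <= t' ->
  `|t' - t| <= h ->
  (\int[mu]_(x in `[(- N)%R, N])
     `|a (Num.truncn (t / dt)) (Num.floor (x / dx)) -
       a (Num.truncn (t' / dt)) (Num.floor (x / dx))|%:E
   <= (V * (lambda * h + dx))%:E)%E.
Proof.
move=> N0; wlog le : t t' / (Num.truncn (t / dt) <= Num.truncn (t' / dt))%N.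
  move=> H t0 t'0 tt'.
  have [le|/ltnW le] := leqP (Num.truncn (t / dt)) (Num.truncn (t' / dt)).
    exact: H.
  under eq_integral do rewrite distrC.
  by apply: H => //; rewrite distrC.
move=> t0 t'0 tt'.
set n := Num.truncn (t / dt) in le *; set n' := Num.truncn (t' / dt) in le *.
have hs := atime n (n' - n); rewrite subnKC// in hs.
have := @cell_sum_integral (fun j => a n' j - a n j) _ dx N dx_gt0 N0 hs.
under eq_integral do rewrite distrC.
move/le_trans; apply; rewrite lee_fin.
rewrite mulrCA mulrA (mulrC V) ler_wpM2r// mulrC.
have := truncn_dist dt_gt0 t0 t'0 tt' le; rewrite -/n -/n'.
move=> /(ler_wpM2l (ltW lambda_gt0)).
have ldt : lambda * dt = dx by rewrite /dt; field; rewrite lt0r_neq0.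
by rewrite mulrDr mulrCA ldt [dx * _]mulrC.
Qed.

(** [s1] and [s2] are arbitrary displacements of size at most h, so that one estimate covers both
    translations and sampling on a grid. [s1] must keep times nonnegative, where
    [time_increment_integral] applies. The constant is lambda h + dx for time plus 2 h for space. *)
Lemma translation_estimate (T N h : R) (s1 s2 : R -> R) :
  0 <= T -> 0 <= N ->
  measurable_fun [set: line] (s1 : line -> line) ->
  measurable_fun [set: line] (s2 : line -> line) ->
  (forall t, 0 <= t -> 0 <= s1 t /\ `|s1 t - t| <= h) ->
  (forall x, `|s2 x - x| <= h) ->
  (\int[leb2 R]_(p in box T N)
    `|piecewise_constant dt dx a p -
      piecewise_constant dt dx a (s1 (p : R * R).1, s2 (p : R * R).2)|%:E
   <= (T * (V * ((lambda + 2) * h + dx)))%:E)%E.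
Proof.
move=> T0 N0 ms1 ms2 hs1 hs2.
apply: ge0_integral_box_le => //.
- apply/measurable_EFinP; apply: measurableT_comp => //.
  apply: measurable_funB; first exact: measurable_piecewise_constant.
  apply: (@measurableT_comp _ _ _ plane plane R (piecewise_constant dt dx a)
    _ (fun p : plane => (s1 p.1, s2 p.2) : plane)).
    exact: measurable_piecewise_constant.
  apply/measurable_fun_pairP; split.
    exact: (@measurableT_comp _ _ _ plane line line s1 _ fst).
  exact: (@measurableT_comp _ _ _ plane line line s2 _ snd).
move=> t /andP[t0 tT]; rewrite /piecewise_constant/=.
have [s10 s1t] := hs1 t t0.
set n := Num.truncn (t / dt); set n' := Num.truncn (s1 t / dt).
have mn k : measurable_fun [set: line] (fun x : line => a k (Num.floor ((x : R) / dx))).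
  exact: measurable_floor_comp.
have mns k : measurable_fun [set: line] (fun x : line => a k (Num.floor (s2 (x : R) / dx))).
  exact: (@measurableT_comp _ _ _ line line R (fun x => a k (Num.floor (x / dx)))).
(* The intermediate function is moved in time but not yet in space. *)
apply: (@le_trans _ _ (\int[mu]_(x in `[(- N)%R, N])
   (`|a n (Num.floor (x / dx)) - a n' (Num.floor (x / dx))|%:E +
    `|a n' (Num.floor (x / dx)) - a n' (Num.floor (s2 x / dx))|%:E)))%E.
  apply: ge0_le_integral => //=.
  - apply/measurable_EFinP; apply: measurable_funTS; apply: measurableT_comp => //.
    exact: measurable_funB.
  - apply: emeasurable_funD; apply/measurable_EFinP; apply: measurable_funTS;
      by apply: measurableT_comp => //; exact: measurable_funB.
  - by move=> x _; rewrite -EFinD lee_fin; exact: ler_distD.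
rewrite ge0_integralD//; last 2 first.
- apply/measurable_EFinP; apply: measurable_funTS; apply: measurableT_comp => //.
  exact: measurable_funB.
- apply/measurable_EFinP; apply: measurable_funTS; apply: measurableT_comp => //.
  exact: measurable_funB.
rewrite (_ : V * _ = V * (lambda * h + dx) + 2 * h * V); last by ring.
rewrite EFinD; apply: leeD; first exact: time_increment_integral.
exact: space_increment_integral.
Qed.

End one_family.

Lemma defect_estimate (c : nat -> int -> R) (S dt dx T N : R) :
  0 < dt -> 0 < dx -> 0 <= T -> 0 <= N ->
  (forall n, bounded_sums (fun j => `|c n j|) S) ->
  (\int[leb2 R]_(p in box T N) `|piecewise_constant dt dx c p|%:E
   <= (T * (dx * S))%:E)%E.
Proof.
move=> dt0 dx0 T0 N0 cS; apply: ge0_integral_box_le => //.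
  apply/measurable_EFinP; apply: measurableT_comp => //.
  exact: measurable_piecewise_constant.
move=> t _; rewrite /piecewise_constant/=.
by apply: (@cell_sum_integral (c (Num.truncn (t / dt)))).
Qed.

End piecewise_constant_estimates.

(** * Compactness in L^1_loc *)

Lemma limn_sup_bounds (R : realType) (u : R^nat) (m : nat) (l r : R) :
  bounded_fun u -> (forall n, (m <= n)%N -> l <= u n <= r) ->
  l <= limn_sup u <= r.
Proof.
move=> bu lur; rewrite limn_supE//; apply/andP; split.
  apply: lb_le_inf; first by exists (sups u 0%N); exists 0%N.
  move=> _ [n _ <-].
  have [+ _] := andP (lur (maxn n m) (leq_maxr _ _)); move/le_trans; apply.
  apply: ub_le_sup; last by exists (maxn n m) => //=; exact: leq_maxl.
  exact/has_ubound_sdrop/bounded_fun_has_ubound.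
apply: (@le_trans _ _ (sups u m)).
  by apply: ge_inf; [exact: bounded_fun_has_lbound_sups|exists m].
apply: ge_sup; first by exists (u m) => /=; exists m => /=.
by move=> _ [n /= mn <-]; have /andP[] := lur n mn.
Qed.

(** If a set of a finer proper filter had its preimage outside [F], the complement would belong to
    the image filter, and the finer filter would contain two disjoint sets. *)
Lemma ultra_fmap (T U : Type) (f : T -> U) (F : set_system T) :
  UltraFilter F -> UltraFilter (f @ F).
Proof.
move=> FU; apply: Build_UltraFilter => G PG FG; apply/seteqP; split => // A GA.
have [//|FnA] := @in_ultra_setVsetC _ F (f @^-1` A) FU.
exfalso; have GnA : G (~` A) by exact: FG.
by have := filterI GA GnA; rewrite setICr => h; case: (filter_not_empty G (h _)).
Qed.

(** Filters are stable under finite intersections; this is what makes convergence uniform over the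
    finitely many nodes of a box. *)
Lemma near_forall_lt (T : Type) (F : set_system T) {FF : Filter F}
    (P : nat -> T -> Prop) (n : nat) :
  (forall i, \forall x \near F, P i x) ->
  \forall x \near F, forall i, (i < n)%N -> P i x.
Proof.
move=> FP; elim: n => [|n IH]; first by apply: filterE.
apply: filterS2 IH (FP n) => x h Pn i.
by rewrite ltnS leq_eqVlt => /predU1P[->//|]; exact: h.
Qed.

Section L1_tools.
Context d (T : measurableType d) (R : realType).
Variable mu : {measure set T -> \bar R}.

Lemma L1_triangle (D : set T) (f g h : T -> R) : measurable D ->
  measurable_fun D f -> measurable_fun D g -> measurable_fun D h ->
  (\int[mu]_(x in D) `|f x - h x|%:E <=
   \int[mu]_(x in D) `|f x - g x|%:E + \int[mu]_(x in D) `|g x - h x|%:E)%E.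
Proof.
move=> mD mf mg mh.
have m1 (f1 f2 : T -> R) : measurable_fun D f1 -> measurable_fun D f2 ->
    measurable_fun D (fun x => `|f1 x - f2 x|%:E).
  move=> *; apply/measurable_EFinP; apply: measurableT_comp => //.
  exact: measurable_funB.
rewrite -ge0_integralD//; [|exact: m1|exact: m1].
apply: ge0_le_integral => //; [exact: m1| |].
  by apply: emeasurable_funD; exact: m1.
by move=> x _; rewrite -EFinD lee_fin; exact: ler_distD.
Qed.

Lemma integral_dist_sym (D : set T) (f g : T -> R) :
  (\int[mu]_(x in D) `|f x - g x|%:E = \int[mu]_(x in D) `|g x - f x|%:E)%E.
Proof. by apply: eq_integral => x _; rewrite distrC. Qed.

Lemma integral_le_bound_cst (D : set T) (f : T -> R) (c l : R) : measurable D ->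
  measurable_fun D f -> 0 <= c -> (mu D <= l%:E)%E ->
  (forall x, D x -> 0 <= f x <= c) ->
  (\int[mu]_(x in D) (f x)%:E <= (c * l)%:E)%E.
Proof.
move=> mD mf c0 mul fc.
apply: (@le_trans _ _ (\int[mu]_(x in D) (cst c%:E x))%E).
  apply: ge0_le_integral => //.
  - by move=> x Dx; rewrite lee_fin; have /andP[] := fc x Dx.
  - exact/measurable_EFinP.
  - by move=> x Dx; rewrite lee_fin; have /andP[] := fc x Dx.
by rewrite integral_cst// EFinM lee_pmul// lee_fin.
Qed.

End L1_tools.

(** * Extraction of a limit from a modulus of continuity under sampling *)

Section L1_compactness.
Context (R : realType).
Local Notation plane := (measurableTypeR R * measurableTypeR R)%type.
Context (g : nat -> R * R -> R) (alpha beta C : R) (eps : nat -> R).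
Hypothesis mg : forall k, measurable_fun [set: plane] (g k : plane -> R).
Hypothesis g_bd : forall k p, alpha <= g k p <= beta.
Hypothesis C_ge0 : 0 <= C.
Hypothesis eps_ge0 : forall k, 0 <= eps k.
Hypothesis eps_cvg0 : eps @ \oo --> (0 : R).
Hypothesis g_grid : forall k T N eta, 0 <= T -> 0 <= N -> 0 < eta ->
  (\int[leb2 R]_(p in box T N) `|g k p - g k (grid eta p)|%:E
   <= (T * (C * (eta + eps k)))%:E)%E.

(** Dyadic meshes make the distances between successive samples summable. *)
Let e (m : nat) : R := 2^-1 ^+ m.
Let e_gt0 m : 0 < e m. Proof. exact: exprn_gt0. Qed.

Section with_ultrafilter.
Context (G : set_system nat) (GU : UltraFilter G) (Goo : \oo `<=` G).

Let PG : ProperFilter G. Proof. exact: ultra_proper. Qed.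

(** All values lie in a compact segment, where an ultrafilter converges: the limit exists at every
    point at once, without a diagonal argument. *)
Let limit_ex : {L : R * R -> R & forall p,
  alpha <= L p <= beta /\ g ^~ p @ G --> L p}.
Proof.
apply: (@choice (R * R)%type R (fun p l => alpha <= l <= beta /\ g ^~ p @ G --> l)).
move=> p; have := @segment_compact R alpha beta; rewrite compact_ultra.
move=> /(_ (g ^~ p @ G) (ultra_fmap _ GU)) [].
  apply: (@filterE _ G _ (g ^~ p @^-1` [set` `[alpha, beta]])) => k.
  by have := g_bd k p; rewrite /= in_itv/=.
by move=> l [/=]; rewrite in_itv/= => lab cl; exists l.
Qed.

Let L := projT1 limit_ex.
Let L_bd p : alpha <= L p <= beta. Proof. exact: (projT2 limit_ex p).1. Qed.
Let L_cvg p : g ^~ p @ G --> L p. Proof. exact: (projT2 limit_ex p).2. Qed.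

(** [L] is an ultrafilter limit and may fail to be measurable; [S m] reads it at countably many
    nodes and is a step function. *)
Let S (m : nat) (p : R * R) : R := L (grid (e m) p).

Let mS m : measurable_fun [set: plane] (S m : plane -> R).
Proof.
rewrite (_ : S m = piecewise_constant (e m) (e m)
  (fun n j => L (n%:R * e m, j%:~R * e m)))//.
exact: measurable_piecewise_constant.
Qed.

Let mgg k m : measurable_fun [set: plane] (fun p : plane => g k (grid (e m) p)).
Proof.
exact: (@measurableT_comp _ _ _ plane plane R (g k) _ (grid (e m)) (mg k)
  (measurable_grid (e_gt0 m))).
Qed.

(** The box meets finitely many cells, indexed by [i] and by [j] counted from [b], so pointwise
    convergence at their nodes is uniform. *)
Let grid_uniform m (N : R) (dl : R) : 0 < dl ->
  \forall k \near G, forall p, box N N p ->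
    `|g k (grid (e m) p) - S m p| <= dl.
Proof.
move=> dl0.
pose b := Num.floor (- N / e m); pose t := Num.floor (N / e m).
have h (i j : nat) : \forall k \near G,
    `|g k (i%:R * e m, (b + j%:Z)%:~R * e m) -
      L (i%:R * e m, (b + j%:Z)%:~R * e m)| <= dl.
  have /cvgrPdist_le/(_ _ dl0) := @L_cvg (i%:R * e m, (b + j%:Z)%:~R * e m).
  by apply: filterS => k; rewrite distrC.
have h1 i : \forall k \near G, forall j, (j < `|t - b|%N.+1)%N ->
    `|g k (i%:R * e m, (b + j%:Z)%:~R * e m) -
      L (i%:R * e m, (b + j%:Z)%:~R * e m)| <= dl by exact: near_forall_lt.
have h2 : \forall k \near G, forall i, (i < (Num.truncn (N / e m)).+1)%N ->
  forall j, (j < `|t - b|%N.+1)%N ->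
    `|g k (i%:R * e m, (b + j%:Z)%:~R * e m) -
      L (i%:R * e m, (b + j%:Z)%:~R * e m)| <= dl by exact: near_forall_lt.
apply: filterS h2 => k {h h1} h [t0 x0] /boxP[/= /andP[p1 p2] /andP[p3 p4]].
have b1 : b <= Num.floor (x0 / e m) by apply: le_floor; rewrite ler_pM2r ?invr_gt0.
have b2 : Num.floor (x0 / e m) <= t by apply: le_floor; rewrite ler_pM2r ?invr_gt0.
have := h (Num.truncn (t0 / e m)) _ `|Num.floor (x0 / e m) - b|%N _.
rewrite (_ : b + _ = Num.floor (x0 / e m)); last by lia.
apply; last by lia.
by rewrite ltnS le_truncn// ler_pM2r ?invr_gt0.
Qed.

Let S_near m (N dl : R) : 0 <= N -> 0 < dl ->
  \forall k \near G, (\int[leb2 R]_(p in box N N) `|g k (grid (e m) p) - S m p|%:E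
     <= dl%:E)%E.
Proof.
move=> N0 dl0.
(* N (2 N) is the area of the box; adding 1 keeps the divisor positive when N = 0. *)
have M0 : 0 < N * (2 * N) + 1 by rewrite ltr_wpDl// !mulr_ge0.
have := @grid_uniform m N (dl / (N * (2 * N) + 1)) (divr_gt0 dl0 M0).
apply: filterS => k hk.
rewrite (_ : dl = dl / (N * (2 * N) + 1) * (N * (2 * N) + 1)); last first.
  by field; rewrite lt0r_neq0.
apply: integral_le_bound_cst.
- exact: measurable_box.
- apply: measurable_funTS; apply: measurableT_comp => //.
  by apply: measurable_funB; [exact: mgg|exact: mS].
- by rewrite divr_ge0 ?ltW.
- by rewrite leb2_box// lee_fin lerDl.
- by move=> p Bp; rewrite normr_ge0/= hk.
Qed.

(** The triangle inequality passes through the samples of [g k]. The term C e m comes from [g_grid]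
    and stays; the mesh error [eps k] is absorbed in [dl], because the ultrafilter contains the
    tails. *)
Let g_S_near m (N dl : R) : 0 <= N -> 0 < dl ->
  \forall k \near G, (\int[leb2 R]_(p in box N N) `|g k p - S m p|%:E
     <= (N * (C * e m) + dl)%:E)%E.
Proof.
move=> N0 dl0.
have NC0 : 0 < N * C + 1 by rewrite ltr_wpDl// mulr_ge0.
have dl20 : 0 < dl / 2 by rewrite divr_gt0.
have dl2N : 0 < dl / 2 / (N * C + 1) by rewrite divr_gt0.
have H1 := @S_near m N (dl / 2) N0 dl20.
have H2 : \forall k \near G, eps k <= dl / 2 / (N * C + 1).
  apply: Goo; move/cvgrPdist_le : eps_cvg0 => /(_ _ dl2N).
  by apply: filterS => k; rewrite sub0r normrN ger0_norm.
near=> k.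
have h1 : (\int[leb2 R]_(p in box N N) `|g k (grid (e m) p) - S m p|%:E
  <= (dl / 2)%:E)%E by near: k.
have h2 : eps k <= dl / 2 / (N * C + 1) by near: k.
apply: (le_trans (@L1_triangle _ _ R (leb2 R) (box N N) (g k)
  (fun p => g k (grid (e m) p)) (S m) (measurable_box N N) _ _ _)).
- exact: measurable_funTS.
- exact: measurable_funTS.
- exact: measurable_funTS.
apply: (le_trans (leeD (g_grid k N0 N0 (e_gt0 m)) h1)).
rewrite -EFinD lee_fin.
have h3 : N * C * eps k <= dl / 2.
  apply: (@le_trans _ _ ((N * C + 1) * eps k)).
    by rewrite mulrDl mul1r lerDl.
  by move: h2; rewrite ler_pdivlMr// mulrC.
rewrite (_ : N * (C * (e m + eps k)) = N * (C * e m) + N * C * eps k); last by ring.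
by rewrite (splitr dl) addrA; lra.
Unshelve. all: by end_near. Qed.

(** Two sets of the ultrafilter intersect, so both samples are close to one and the same [g k]; the
    error [dl] is arbitrary. *)
Let S_cauchy m m' (N : R) : 0 <= N ->
  (\int[leb2 R]_(p in box N N) `|S m p - S m' p|%:E
     <= (N * (C * (e m + e m')))%:E)%E.
Proof.
move=> N0; apply/lee_addgt0Pr => dl dl0.
have dl20 : 0 < dl / 2 by rewrite divr_gt0.
have H1 := @g_S_near m N (dl / 2) N0 dl20.
have H2 := @g_S_near m' N (dl / 2) N0 dl20.
have [k [h1 h2]] : exists k,
   (\int[leb2 R]_(p in box N N) `|g k p - S m p|%:E
     <= (N * (C * e m) + dl / 2)%:E)%E /\
   (\int[leb2 R]_(p in box N N) `|g k p - S m' p|%:E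
     <= (N * (C * e m') + dl / 2)%:E)%E.
  by apply: (@filter_ex _ G); apply: filterI.
apply: (le_trans (@L1_triangle _ _ R (leb2 R) (box N N) (S m)
  (g k) (S m') (measurable_box N N) _ _ _)).
- exact: measurable_funTS.
- exact: measurable_funTS.
- exact: measurable_funTS.
rewrite integral_dist_sym; apply: (le_trans (leeD h1 h2)).
by rewrite -!EFinD lee_fin; lra.
Qed.

(** The upper limit is defined at every point, measurable and with values in [alpha, beta]; no
    exceptional null set has to be handled. *)
Let u (p : R * R) : R := limn_sup (S ^~ p).

Let S_bounded p : bounded_fun (S ^~ p).
Proof.
exists (`|alpha| + `|beta|); split => // M hM n _.
apply: le_trans (ltW hM); rewrite ler_norml.
have /andP[h1 h2] := L_bd (grid (e n) p).
have := ler_norm beta; have := ler_norm (- alpha); rewrite normrN.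
have := normr_ge0 beta; have := normr_ge0 alpha.
by rewrite /S => *; apply/andP; split; lra.
Qed.

Let u_bd p : alpha <= u p <= beta.
Proof. by apply: (@limn_sup_bounds _ _ 0%N) => // n _; exact: L_bd. Qed.

Let mu_ : measurable_fun [set: plane] (u : plane -> R).
Proof.
apply: (@measurable_fun_limn_sup _ plane _ _ S) => // p _.
  exact/bounded_fun_has_ubound.
exact/bounded_fun_has_lbound.
Qed.

(** Telescoping keeps every later sample within the sum of the series from [S m p], hence also the
    upper limit. Where the series diverges the bound is infinite and nothing is claimed. *)
Let S_u_le m p : (`|S m p - u p|%:E <=
  \sum_(0 <= n <oo) `|S (m + n).+1 p - S (m + n)%N p|%:E)%E.
Proof.
set s := (X in (_ <= X)%E).
have part l : (`|S (m + l)%N p - S m p|%:E <= s)%E.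
  apply: (@le_trans _ _ (\sum_(0 <= n < l) `|S (m + n).+1 p - S (m + n)%N p|%:E)%E).
    rewrite sumEFin lee_fin; elim: l => [|l IH].
      by rewrite addn0 subrr normr0 big_geq.
    rewrite big_nat_recr//= addrC addnS.
    by apply: le_trans (ler_distD (S (m + l)%N p) _ _) _; rewrite lerD2l.
  exact: nneseries_lim_ge.
case E : s => [r| |]; last 2 first.
- by rewrite leey.
- by have := part 0%N; rewrite E.
rewrite lee_fin ler_distlC -/u.
apply: (@limn_sup_bounds _ _ m) => // n mn.
have := part (n - m)%N; rewrite E lee_fin subnKC// ler_norml.
by move=> /andP[? ?]; apply/andP; split; lra.
Qed.

Let eS m : e m.+1 = e m / 2. Proof. by rewrite /e exprSr. Qed.

(** Integrating the series term by term with [S_cauchy], the sum of e (m + n + 1) + e (m + n) over n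
    is e m + 2 e m. *)
Let S_u m (N : R) : 0 <= N ->
  (\int[leb2 R]_(p in box N N) `|S m p - u p|%:E <= (N * (C * (3 * e m)))%:E)%E.
Proof.
move=> N0.
have mdS n : measurable_fun (box N N : set plane)
   (fun p : plane => `|S (m + n).+1 p - S (m + n)%N p|%:E).
  apply: measurable_funTS; apply/measurable_EFinP; apply: measurableT_comp => //.
  exact: measurable_funB.
apply: (@le_trans _ _ (\int[leb2 R]_(p in box N N)
  \sum_(0 <= n <oo) `|S (m + n).+1 p - S (m + n)%N p|%:E)%E).
  apply: ge0_le_integral => //.
  - exact: measurable_box.
  - apply: measurable_funTS; apply/measurable_EFinP; apply: measurableT_comp => //.
    exact: measurable_funB.
  - by apply: ge0_emeasurable_sum => // n _; exact: mdS.
rewrite integral_nneseries//; last exact: measurable_box.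
apply: lime_le; first by apply: is_cvg_nneseries => n _ _; exact: integral_ge0.
have sumE K : \sum_(0 <= n < K) (N * (C * (e (m + n).+1 + e (m + n)%N))) =
    N * (C * (3 * e m - 3 * e (m + K)%N)).
  elim: K => [|K IH]; first by rewrite big_geq// addn0 subrr !mulr0.
  by rewrite big_nat_recr//= IH addnS eS; field.
apply: nearW => K.
apply: (@le_trans _ _ (\sum_(0 <= n < K) (N * (C * (e (m + n).+1 + e (m + n)%N)))%:E)%E).
  by apply: lee_sum => n _; exact: S_cauchy.
rewrite sumEFin lee_fin sumE; apply: ler_wpM2l => //; apply: ler_wpM2l => //.
by rewrite gerBl mulr_ge0// ltW.
Qed.

Let g_u_near (N dl : R) : 0 <= N -> 0 < dl ->
  \forall k \near G, (\int[leb2 R]_(p in box N N) `|g k p - u p|%:E <= dl%:E)%E.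
Proof.
move=> N0 dl0.
have dl20 : 0 < dl / 2 by rewrite divr_gt0.
have K0 : 0 < N * C * 4 + 1 by rewrite ltr_wpDl// !mulr_ge0.
(* The factor 4 is one [e m] from g to its limiting samples plus three from these to [u]. *)
have [m hm] : exists m, N * (C * (4 * e m)) <= dl / 2.
  have : e @ \oo --> (0 : R).
    by apply: cvg_expr; rewrite ger0_norm ?invf_lt1 ?ltr1n.
  move/cvgrPdist_le => /(_ _ (divr_gt0 dl20 K0)) [m _ /(_ m (leqnn _))].
  rewrite /= sub0r normrN gtr0_norm// ler_pdivlMr// => h.
  exists m; apply: le_trans h.
  by rewrite mulrDr mulr1 (_ : N * _ = e m * (N * C * 4)) ?lerDl ?ltW//; ring.
have := @g_S_near m N (dl / 2) N0 dl20; apply: filterS => k hk.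
apply: (le_trans (@L1_triangle _ _ R (leb2 R) (box N N) (g k)
  (S m) u (measurable_box N N) _ _ _)).
- exact: measurable_funTS.
- exact: measurable_funTS.
- exact: measurable_funTS.
apply: (le_trans (leeD hk (S_u m N0))).
by rewrite -EFinD lee_fin; lra.
Qed.

(** The ultrafilter contains the tails, so each of its sets contains arbitrarily large indices; this
    is the form from which a subsequence can be picked. *)
Lemma L1_cluster : exists u : R * R -> R,
  [/\ measurable_fun [set: plane] (u : plane -> R),
      forall p, alpha <= u p <= beta &
      forall (n j : nat), exists2 k, (j < k)%N &
        (\int[leb2 R]_(p in box n%:R n%:R) `|g k p - u p|%:E <= (n.+1%:R^-1)%:E)%E].
Proof.
exists u; split => // n j.
have H : \forall k \near G, (j < k)%N by apply: Goo; exists j.+1.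
have H2 := @g_u_near n%:R n.+1%:R^-1 (ler0n _ _) _.
have [k [? ?]] : exists k, (j < k)%N /\
  (\int[leb2 R]_(p in box n%:R n%:R) `|g k p - u p|%:E <= (n.+1%:R^-1)%:E)%E.
  by apply: (@filter_ex _ G); apply: filterI => //; apply: H2; rewrite invr_gt0.
by exists k.
Qed.

End with_ultrafilter.

Theorem L1_compactness : exists (sigma : nat -> nat) (u : R * R -> R),
  [/\ {homo sigma : m n / (m < n)%N},
      measurable_fun [set: plane] (u : plane -> R),
      forall p, alpha <= u p <= beta &
      forall n k : nat, (n <= k)%N ->
        (\int[leb2 R]_(p in box n%:R n%:R) `|g (sigma k) p - u p|%:E
         <= (k.+1%:R^-1)%:E)%E].
Proof.
have [G [GU Goo]] := @ultraFilterLemma nat \oo _.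
have [u [mu ubd hu]] := L1_cluster GU Goo.
have [h hP] : {h : nat * nat -> nat & forall nj, (nj.2 < h nj)%N /\
  (\int[leb2 R]_(p in box nj.1%:R nj.1%:R) `|g (h nj) p - u p|%:E
   <= (nj.1.+1%:R^-1)%:E)%E}.
  apply: (@choice (nat * nat)%type nat (fun nj k => (nj.2 < k)%N /\
    (\int[leb2 R]_(p in box nj.1%:R nj.1%:R) `|g k p - u p|%:E
     <= (nj.1.+1%:R^-1)%:E)%E)).
  by move=> [n j]; have [k jk hk] := hu n j; exists k.
(* The index of rank n is chosen beyond the preceding one and is good on the box of size n up to 1 /
   (n + 1). Since the boxes increase, one sequence serves all of them. *)
pose sigma := fix s n := if n is n'.+1 then h (n, s n') else h (0%N, 0%N).
have sE n : exists j, sigma n = h (n, j).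
  by case: n => [|n]; [exists 0%N|exists (sigma n)].
exists sigma, u; split => //.
  by apply: homo_ltn; [exact: ltn_trans|move=> n; exact: (hP (n.+1, sigma n)).1].
move=> n k nk; have [j ->] := sE k.
apply: le_trans (hP (k, j)).2 => /=.
apply: ge0_subset_integral; [exact: measurable_box|exact: measurable_box| | |].
- apply: measurable_funTS; apply/measurable_EFinP; apply: measurableT_comp => //.
  exact: measurable_funB.
- by move=> p _; rewrite lee_fin.
move=> p /boxP[/andP[p1 p2] /andP[p3 p4]]; apply/boxP.
have nk' : n%:R <= k%:R :> R by rewrite ler_nat.
by split; apply/andP; split; lra.
Qed.

End L1_compactness.

(** * Variation of the cell averages *)

Section integrable_tools.
Context d (T : measurableType d) (R : realType).
Variable mu : {measure set T -> \bar R}.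

Lemma integrable_bounded_support (A : set T) (f : T -> R) (c : R) :
  measurable A -> (mu A < +oo)%E -> measurable_fun setT f ->
  (forall x, `|f x| <= c * \1_A x) -> mu.-integrable setT (EFin \o f).
Proof.
move=> mA muA mf fc.
have fE : EFin \o f = (EFin \o f) \_ A.
  apply/funext => x; rewrite patchE; case: ifPn => // xA.
  have := fc x; rewrite indicE (negbTE xA) mulr0 normr_le0 => /eqP fx0.
  by rewrite /= fx0.
rewrite fE; apply/(integrable_mkcond (EFin \o f) mA).
apply: measurable_bounded_integrable => //; first exact: measurable_funTS.
exists c; split; first exact: num_real.
move=> M cM x /= Ax; have := fc x; rewrite indicE mem_set// mulr1 => /le_trans.
by apply; exact: ltW.
Qed.

Lemma Rintegral_sum (D : set T) (m : nat) (f : 'I_m -> T -> R) : measurable D ->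
  (forall i, mu.-integrable D (EFin \o f i)) ->
  \int[mu]_(x in D) (\sum_(i < m) f i x) = \sum_(i < m) \int[mu]_(x in D) f i x.
Proof.
move=> mD fi; rewrite /Rintegral; under eq_integral do rewrite -sumEFin.
rewrite (@integral_sum _ _ _ mu D mD _ (fun i => EFin \o f i))//.
by rewrite -sum_fine// => i _; exact: integrable_fin_num.
Qed.

End integrable_tools.

Lemma compactly_supported_itv (R : realType) (a b : R) (f : R -> R) :
  (forall x, ~~ (a <= x <= b) -> f x = 0) -> compactly_supported setT f.
Proof.
move=> f0; split => //; apply: (@subclosed_compact _ _ `[a, b]%classic).
- exact: closed_closure.
- exact: segment_compact.
- rewrite closureE => x; apply; split; first exact: interval_closed.
  move=> y /=; apply: contraNP => yab; apply/eqP; apply: f0.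
  by apply/negP; move: yab; rewrite in_itv.
Qed.

(** * Functions with Lipschitz derivative *)

Section quadratic_remainder.
Context (R : realType).

(* A derivative [f'] with a quadratic remainder: unlike [C1], stable under sums,
   multiples and translations without any computation of derivatives. *)
Definition C11 (f f' : R -> R) (K : R) : Prop := 0 <= K /\
  forall x y, `|f y - f x - (y - x) * f' x| <= K * (y - x) ^+ 2 /\
    `|f' y - f' x| <= K * `|y - x|.

Lemma C11D f f' K g g' K' : C11 f f' K -> C11 g g' K' ->
  C11 (fun x => f x + g x) (fun x => f' x + g' x) (K + K').
Proof.
move=> [K0 hf] [K'0 hg]; split=> [|x y]; first exact: addr_ge0.
have [f1 f2] := hf x y; have [g1 g2] := hg x y; rewrite !mulrDl; split.
  rewrite (_ : _ - _ = (f y - f x - (y - x) * f' x) + (g y - g x - (y - x) * g' x)).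
    exact: le_trans (ler_normD _ _) (lerD f1 g1).
  by ring.
rewrite (_ : _ - _ = (f' y - f' x) + (g' y - g' x)); last by ring.
exact: le_trans (ler_normD _ _) (lerD f2 g2).
Qed.

Lemma C11Z c f f' K : C11 f f' K ->
  C11 (fun x => c * f x) (fun x => c * f' x) (`|c| * K).
Proof.
move=> [K0 hf]; split=> [|x y]; first exact: mulr_ge0.
have [f1 f2] := hf x y; rewrite -!mulrA; split.
  rewrite (_ : _ - _ = c * (f y - f x - (y - x) * f' x)); last by ring.
  by rewrite normrM ler_wpM2l.
by rewrite -mulrBr normrM ler_wpM2l.
Qed.

Lemma C11_shift a f f' K : C11 f f' K ->
  C11 (fun x => f (x - a)) (fun x => f' (x - a)) K.
Proof.
move=> [K0 hf]; split=> // x y; have := hf (x - a) (y - a).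
by rewrite (_ : y - a - (x - a) = y - x)//; ring.
Qed.

Lemma C11_sum m (f f' : nat -> R -> R) : (forall i, exists K, C11 (f i) (f' i) K) ->
  exists K, C11 (fun x => \sum_(i < m) f i x) (fun x => \sum_(i < m) f' i x) K.
Proof.
move=> h; elim: m => [|m [K IH]].
  exists 0; split => // x y; rewrite !big_ord0 !subrr mulr0 !mul0r subrr normr0.
  by [].
have [K' hm] := h m; exists (K + K'); have := C11D IH hm.
rewrite (_ : (fun x => _ + _) = (fun x => \sum_(i < m.+1) f i x)); last first.
  by apply/funext => x; rewrite big_ord_recr.
rewrite (_ : (fun x => _ + _) = (fun x => \sum_(i < m.+1) f' i x))//.
by apply/funext => x; rewrite big_ord_recr.
Qed.

Lemma C11_is_derive f f' K (x : R) : C11 f f' K -> is_derive x 1 f (f' x).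
Proof.
move=> [K0 hf].
have H : h^-1 *: (f (h *: 1 + x) - f x) @[h --> 0^'] --> f' x.
  apply/cvgrPdist_le => eps eps0; near=> h.
  have h0 : h != 0 by near: h; exact: nbhs_dnbhs_neq.
  have [+ _] := hf x (h *: 1 + x).
  have -> : h *: 1 + x - x = h :> R by rewrite addrK /GRing.scale/= mulr1.
  set z := f _ => hx.
  rewrite (_ : _ - _ = - (h^-1 * (z - f x - h * f' x))); last first.
    by rewrite /GRing.scale/=; field.
  rewrite normrN normrM normfV ler_pdivrMl ?normr_gt0//.
  apply: le_trans hx _; rewrite -real_normK ?num_real// expr2 mulrA mulrC.
  rewrite ler_wpM2l//.
  have hh : `|h| <= eps / (K + 1).
    by near: h; apply: dnbhs0_le; rewrite divr_gt0// ltr_wpDl.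
  apply: (@le_trans _ _ ((K + 1) * `|h|)); first by rewrite mulrDl mul1r lerDl.
  by move: hh; rewrite ler_pdivlMr ?ltr_wpDl// mulrC.
split; first by apply/cvg_ex; exists (f' x).
by apply/cvg_lim.
Unshelve. all: by end_near. Qed.

Lemma C11_continuous f f' K : C11 f f' K -> continuous f.
Proof.
move=> hf x; have hd := C11_is_derive x hf.
by apply: differentiable_continuous; apply/derivable1_diffP.
Qed.

Lemma C11_MVT f f' K a b : C11 f f' K -> a < b ->
  exists2 c, a < c < b & f b - f a = f' c * (b - a).
Proof.
move=> hf ab; have [] := @MVT R f f' a b ab.
- by move=> x _; exact: C11_is_derive hf.
- by apply: continuous_subspaceT; exact: C11_continuous hf.
by move=> c; rewrite in_itv/= => cab E; exists c.
Qed.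

Lemma C11_derive1 f f' K : C11 f f' K -> derive1 f = f'.
Proof.
move=> hf; apply/funext => x; rewrite derive1E.
by have /@derive_val := C11_is_derive x hf.
Qed.

Lemma C11_C1 f f' K : C11 f f' K -> C1 f.
Proof.
move=> hf; split=> [x|]; first by have [] := C11_is_derive x hf.
rewrite (C11_derive1 hf) => x; case: hf => K0 hf.
apply/cvgrPdist_le => eps eps0.
have K1 : 0 < K + 1 by rewrite ltr_wpDl.
have xn : \forall y \near x, `|x - y| <= eps / (K + 1).
  have /cvgrPdist_le := @cvg_id _ (nbhs x).
  by apply; exact: divr_gt0.
near=> y; apply: (le_trans (hf y x).2).
have hh : `|x - y| <= eps / (K + 1) by near: y.
apply: (@le_trans _ _ ((K + 1) * `|x - y|)); first by rewrite mulrDl mul1r lerDl.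
by move: hh; rewrite ler_pdivlMr// mulrC.
Unshelve. all: by end_near. Qed.

End quadratic_remainder.

(** * From the variation tested by C^1 functions to the increments of cell averages *)

Section cell_averages.
Context (R : realType).
Local Notation mu := (@lebesgue_measure R).
Local Notation line := (measurableTypeR R).

(** [q] is a primitive of the positive part [r], which is Lipschitz; every test function of this
    section is a combination of translates of [q]. *)
Let r (x : R) : R := Num.max x 0.
Let q (x : R) : R := r x ^+ 2 / 2.

Let C11_q : C11 q r 1.
Proof.
split=> // x y; rewrite !mul1r; split.
  have s1 := sqr_ge0 (y - x); have s2 := sqr_ge0 x; have s3 := sqr_ge0 y.
  rewrite /q /r ler_norml.
  case: (leP x 0) => hx; case: (leP y 0) => hy; apply/andP.
  - by split; nra.
  - by have := mulr_le0_ge0 hx (ltW hy); split; nra.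
  - by have := mulr_ge0_le0 (ltW hx) hy; split; nra.
  - by split; nra.
rewrite /r; case: (leP x 0) => hx; case: (leP y 0) => hy.
- by rewrite subrr normr0.
- by rewrite subr0 !gtr0_norm; lra.
- by rewrite sub0r normrN gtr0_norm// ltr0_norm; lra.
- by [].
Qed.

Section ramp.
Context (dl : R) (dl_gt0 : 0 < dl).

(* [theta] rises from [0] to [1] on [[- dl, 0]]; [ramp] is its primitive. *)
Let theta (x : R) : R := (r (x + dl) - r x) / dl.
Let ramp (x : R) : R := (q (x + dl) - q x) / dl.

Let C11_ramp : exists K, C11 ramp theta K.
Proof.
have h := C11Z dl^-1 (C11D (C11_shift (- dl) C11_q) (C11Z (-1) C11_q)).
have Er : ramp = fun x => dl^-1 * (q (x - - dl) + -1 * q x).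
  by apply/funext => x; rewrite /ramp opprK; ring.
have Et : theta = fun x => dl^-1 * (r (x - - dl) + -1 * r x).
  by apply/funext => x; rewrite /theta opprK; ring.
by rewrite Er Et; eexists; exact: h.
Qed.

Let theta_nd x y : x <= y -> theta x <= theta y.
Proof.
move=> xy; rewrite /theta ler_pM2r ?invr_gt0// /r.
have dl0 := dl_gt0.
by case: (leP x 0) => ?; case: (leP y 0) => ?; case: (leP (x + dl) 0) => ?;
  case: (leP (y + dl) 0) => ?; lra.
Qed.

Let theta0 x : x <= - dl -> theta x = 0.
Proof.
have dl0 := dl_gt0.
move=> xd; rewrite /theta /r.
by rewrite !max_r ?subrr ?mul0r//; lra.
Qed.

Let theta1 x : 0 <= x -> theta x = 1.
Proof.
have dl0 := dl_gt0.
move=> x0; rewrite /theta /r !max_l ?(addr_ge0 _ (ltW dl_gt0))//.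
by rewrite addrC addKr divff// lt0r_neq0.
Qed.

Let theta_bd x : 0 <= theta x <= 1.
Proof.
have dl0 := dl_gt0.
apply/andP; split.
  have [h|h] := leP x (- dl); first by rewrite theta0.
  by rewrite -(theta0 (lexx (- dl))) theta_nd// ltW.
have [h|h] := leP 0 x; first by rewrite theta1.
by rewrite -(theta1 (lexx 0)) theta_nd// ltW.
Qed.

Let ramp0 x : x <= - dl -> ramp x = 0.
Proof.
have dl0 := dl_gt0.
move=> xd; rewrite /ramp /q /r.
by rewrite !max_r ?subrr ?mul0r//; lra.
Qed.

Let ramp1 x : 0 <= x -> ramp x = x + dl / 2.
Proof.
have dl0 := dl_gt0.
move=> x0; rewrite /ramp /q /r !max_l ?(addr_ge0 _ (ltW dl_gt0))//.
by field; rewrite lt0r_neq0.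
Qed.

(** Writing increments as values of [theta] lets the bounds and the monotonicity of the [rho k]
    follow from those of [theta], with no case analysis. *)
Let ramp_increment d x : 0 < d ->
  exists2 c, x - d < c < x & ramp x - ramp (x - d) = theta c * d.
Proof.
move=> d0; have [K hK] := C11_ramp.
have [|c cx E] := @C11_MVT R _ _ _ (x - d) x hK; first lra.
by exists c => //; rewrite E; congr (_ * _); ring.
Qed.

Context (d : R) (d_gt0 : 0 < d) (a : int) (m : nat).

Let y (k : nat) : R := (a + k%:Z)%:~R * d.
Let yS k : y k.+1 = y k + d.
Proof. by rewrite /y -addn1 PoszD addrA (intrD _ (a + _) 1) mulrDl mul1r. Qed.
Let y_nd k l : (k <= l)%N -> y k <= y l.
Proof. by move=> kl; apply: ler_wpM2r; [exact: ltW|rewrite ler_int; lia]. Qed.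

(** A C^1 step that rises from 0, left of [y k - dl], to 1, right of [y k.+1]. Its derivative is
    [w k / d], and [rho k - rho k.+1] is a smoothed hat function. *)
Let rho (k : nat) (x : R) : R := (ramp (x - y k) - ramp (x - y k.+1)) / d.

Let rho_bd k x : 0 <= rho k x <= 1.
Proof.
have dl0 := dl_gt0; have d0 := d_gt0.
rewrite /rho yS opprD addrA; have [c _ ->] := ramp_increment (x - y k) d_gt0.
by rewrite mulfK ?lt0r_neq0.
Qed.

Let rho_dec k x : rho k.+1 x <= rho k x.
Proof.
have dl0 := dl_gt0; have d0 := d_gt0.
rewrite /rho !yS ler_pM2r ?invr_gt0// !opprD !addrA.
have [c /andP[c1 c2] ->] := ramp_increment (x - y k) d_gt0.
have [c' /andP[c1' c2'] ->] := ramp_increment (x - y k - d) d_gt0.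
by rewrite ler_pM2r//; apply: theta_nd; lra.
Qed.

(* [w k] is a continuous approximation of the indicator of the cell
   [[y k, y k.+1]]. *)
Let w (k : nat) (x : R) : R := theta (x - y k) - theta (x - y k.+1).

(** The two functions differ by at most 1, and only on the two intervals of length [dl] where one of
    the translates of [theta] is rising. *)
Let w_indic k x : `|w k x - \1_(`[y k, y k.+1]) x| <=
  \1_(`[y k - dl, y k - dl + dl]) x + \1_(`[y k.+1 - dl, y k.+1 - dl + dl]) x.
Proof.
have dl0 := dl_gt0; have d0 := d_gt0.
rewrite !subrK; have yy : y k <= y k.+1 by exact: y_nd.
have /andP[t1 t2] := theta_bd (x - y k).
have /andP[t3 t4] := theta_bd (x - y k.+1).
have t5 : theta (x - y k.+1) <= theta (x - y k) by apply: theta_nd; lra.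
have i0 (A : set R) : 0 <= (\1_A x : R) by [].
have i1 (A : set R) : (\1_A x : R) <= 1 by rewrite indicE; case: (_ \in _).
have [h1|h1] := pselect (`[y k - dl, y k]%classic x).
  rewrite [X in _ <= X + _](_ : _ = 1); last by rewrite indicE mem_set.
  apply: (@le_trans _ _ 1); last by rewrite lerDl.
  have := i0 `[y k, y k.+1]%classic; have := i1 `[y k, y k.+1]%classic.
  by rewrite /w => *; rewrite ler_norml; apply/andP; split; lra.
have [h2|h2] := pselect (`[y k.+1 - dl, y k.+1]%classic x).
  rewrite [X in _ <= _ + X](_ : _ = 1); last by rewrite indicE mem_set.
  apply: (@le_trans _ _ 1); last by rewrite lerDr.
  have := i0 `[y k, y k.+1]%classic; have := i1 `[y k, y k.+1]%classic.
  by rewrite /w => *; rewrite ler_norml; apply/andP; split; lra.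
rewrite (_ : w k x = \1_(`[y k, y k.+1]) x); first by rewrite subrr normr0 addr_ge0.
rewrite indicE /w; have [h3|h3] := boolP (x \in `[y k, y k.+1]%classic).
  move: h3; rewrite inE/= in_itv/= => /andP[h3 h4].
  have h5 : x < y k.+1 - dl.
    by rewrite ltNge; apply/negP => h5; apply: h2; rewrite /= in_itv/= h5.
  by rewrite theta1 ?theta0 ?subr0//; lra.
have [h4|h4] := leP x (y k).
  have h5 : x < y k - dl.
    by rewrite ltNge; apply/negP => h5; apply: h1; rewrite /= in_itv/= h5.
  by rewrite !theta0 ?subrr//; lra.
have h5 : y k.+1 < x.
  rewrite ltNge; apply/negP => h5; move: h3; rewrite notin_setE/= in_itv/= h5.
  by rewrite (ltW h4).
by rewrite !theta1 ?subrr//; lra.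
Qed.

Let w_support k x : `|w k x| <= 1 * \1_(`[y k - dl, y k.+1]) x.
Proof.
have dl0 := dl_gt0; have d0 := d_gt0.
have /andP[t1 t2] := theta_bd (x - y k).
have /andP[t3 t4] := theta_bd (x - y k.+1).
rewrite mul1r indicE; have [_|] := boolP (x \in `[y k - dl, y k.+1]%classic).
  by rewrite mulr1n /w ler_norml; apply/andP; split; lra.
have yy : y k <= y k.+1 by exact: y_nd.
rewrite notin_setE/= in_itv/= => /negP; rewrite negb_and -!ltNge /w.
case/orP => h; first by rewrite !theta0 ?subrr ?normr0//; lra.
by rewrite !theta1 ?subrr ?normr0//; lra.
Qed.

Let measurable_w k : measurable_fun [set: line] (w k : line -> R).
Proof.
have dl0 := dl_gt0; have d0 := d_gt0.
have mt : measurable_fun [set: line] (theta : line -> R).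
  apply: continuous_measurable_fun.
  have [K hK] := C11_ramp; have [_] := C11_C1 hK.
  by rewrite (C11_derive1 hK).
apply: measurable_funB.
  by apply: (@measurableT_comp _ _ _ line line R theta) => //; exact: measurable_funB.
by apply: (@measurableT_comp _ _ _ line line R theta) => //; exact: measurable_funB.
Qed.

Context (u0 : R -> R) (B V : R).
Hypothesis mu0 : measurable_fun [set: line] (u0 : line -> R).
Hypothesis u0B : forall x, `|u0 x| <= B.
Hypothesis u0V : forall psi : R -> R, C1 psi -> compactly_supported setT psi ->
  (forall x, `|psi x| <= 1) -> \int[mu]_x (u0 x * derive1 psi x) <= V.

Let B_ge0 : 0 <= B. Proof. exact: le_trans (u0B 0). Qed.

Let itv_lty (b c : R) : (mu `[b, c]%classic < +oo)%E.
Proof. by rewrite lebesgue_measure_itv/=; case: ifPn => // _; rewrite -EFinB ltry. Qed.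

Let int_w k : mu.-integrable setT (EFin \o (fun x => u0 x * w k x)).
Proof.
apply: (@integrable_bounded_support _ _ _ mu `[y k - dl, y k.+1]%classic _ B) => //.
- exact: itv_lty.
- by apply: measurable_funM => //; exact: measurable_w.
- move=> x; rewrite normrM ler_pM//; have := w_support k x; rewrite mul1r; exact.
Qed.

Let int_cell k : mu.-integrable setT (EFin \o (fun x => u0 x * \1_(`[y k, y k.+1]) x)).
Proof.
apply: (@integrable_bounded_support _ _ _ mu `[y k, y k.+1]%classic _ B) => //.
- exact: itv_lty.
- by apply: measurable_funM => //; exact: measurable_indic.
- by move=> x; rewrite normrM ler_pM// ger0_norm.
Qed.

Let I k : R := \int[mu]_x (u0 x * w k x).
Let A k : R := \int[mu]_(x in `[y k, y k.+1]) u0 x.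

Let AE k : A k = \int[mu]_x (u0 x * \1_(`[y k, y k.+1]) x).
Proof.
rewrite /A Rintegral_mkcond; apply: eq_Rintegral => x _.
by rewrite patchE indicE; case: (x \in _); rewrite ?mulr1 ?mulr0.
Qed.

Let I_A k : `|I k - A k| <= dl * (B + B).
Proof.
rewrite AE /I -RintegralB//.
have intB : mu.-integrable setT (EFin \o
    (fun x => u0 x * w k x - u0 x * \1_(`[y k, y k.+1]) x)).
  by have := integrableB measurableT (int_w k) (int_cell k).
apply: (le_trans (le_normr_Rintegral measurableT intB)).
rewrite -lee_fin /Rintegral fineK; last first.
  apply: (integrable_fin_num measurableT).
  exact: (integrable_norm intB).
pose y' i := (if i == 0%N then y k else y k.+1) - dl.
have := @integral_indic_sum_le R setT
  (fun x => `|u0 x * w k x - u0 x * \1_(`[y k, y k.+1]) x|) 2 (fun=> B)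
  (fun i => `[y' i, y' i + dl]%classic) dl.
rewrite big_ord_recr/= big_ord_recr/= big_ord0 add0r; apply => //.
- apply: measurableT_comp => //; apply: measurable_funB.
    by apply: measurable_funM => //; exact: measurable_w.
  by apply: measurable_funM => //; exact: measurable_indic.
- by move=> i; rewrite lebesgue_measure_itvcc// ltW.
- move=> x _; rewrite -mulrBr normrM big_ord_recr/= big_ord_recr/= big_ord0 add0r.
  rewrite /y'/= -mulrDr; apply: ler_pM => //; exact: w_indic.
Qed.

(** The test function is minus the sum of the hats weighted by [eps i]; its derivative involves (w i
    - w i.+1) / d, so that testing gives the left-hand side divided by d. The hats are nonnegative
    and telescope to rho 0 - rho m <= 1, so the test function is bounded by 1. *)
Let sum_sg_le (eps : nat -> R) : (forall i, `|eps i| <= 1) ->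
  \sum_(i < m) eps i * (I i.+1 - I i) <= d * V.
Proof.
have dl0 := dl_gt0; have d0 := d_gt0; move=> eps1.
pose hat (i : nat) x := rho i x - rho i.+1 x.
pose psi x := \sum_(i < m) - eps i * hat i x.
pose psi' x := \sum_(i < m) - eps i * ((w i x - w i.+1 x) / d).
have hK : exists K, C11 psi psi' K.
  apply: (@C11_sum R m (fun i x => - eps i * hat i x)
    (fun i x => - eps i * ((w i x - w i.+1 x) / d))) => i.
  have [K hK] := C11_ramp; eexists.
  apply: C11Z.
  have := C11Z d^-1 (C11D (C11D (C11_shift (y i) hK)
     (C11Z (- 2) (C11_shift (y i.+1) hK))) (C11_shift (y i.+2) hK)).
  rewrite (_ : (fun x => _ * _) = hat i); last first.
    by apply/funext => x; rewrite /hat /rho; field; rewrite lt0r_neq0.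
  rewrite (_ : (fun x => _ * _) = (fun x => (w i x - w i.+1 x) / d)); first exact.
  by apply/funext => x; rewrite /w; field; rewrite lt0r_neq0.
have hat_ge0 i x : 0 <= hat i x by rewrite subr_ge0.
have psi1 x : `|psi x| <= 1.
  apply: (le_trans (ler_norm_sum _ _ _)).
  apply: (@le_trans _ _ (\sum_(i < m) hat i x)).
    apply: ler_sum => i _; rewrite normrM normrN ger0_norm//.
    by rewrite -{2}[hat i x]mul1r ler_wpM2r.
  have -> : \sum_(i < m) hat i x = rho 0%N x - rho m x.
    rewrite -(big_mkord xpredT (fun i => rho i x - rho i.+1 x)).
    rewrite (@telescope_sumr_eq _ 0 m (fun i => - rho i x))// => [|i _]; by ring.
  have /andP[_ ?] := rho_bd 0 x; have /andP[? _] := rho_bd m x; lra.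
have psiS : compactly_supported setT psi.
  apply: (@compactly_supported_itv _ (y 0%N - dl) (y m.+2)) => x hx.
  apply: big1 => i _; rewrite (_ : hat i x = 0) ?mulr0// /hat /rho.
  have yi : y 0%N <= y i by exact: y_nd.
  have yi1 : y i <= y i.+1 by exact: y_nd.
  have yi2 : y i.+1 <= y i.+2 by exact: y_nd.
  have yi3 : y i.+2 <= y m.+2 by apply: y_nd; have := ltn_ord i; lia.
  move: hx; rewrite negb_and -!ltNge => /orP[hx|hx].
    by rewrite !ramp0 ?subrr//; lra.
  by rewrite !ramp1; [rewrite !yS; ring|lra..].
case: hK => K hK; have := u0V (C11_C1 hK) psiS psi1.
rewrite (C11_derive1 hK) /psi'.
under eq_Rintegral do rewrite mulr_sumr.
have intd i : mu.-integrable setT (EFin \o (fun x => u0 x * w i x - u0 x * w i.+1 x)).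
  by have := integrableB measurableT (int_w i) (int_w i.+1).
rewrite Rintegral_sum//; last first.
  move=> i; have := integrableZl measurableT (- eps i / d) (intd i).
  congr (_.-integrable _ _); apply/funext => x /=; rewrite -EFinM; congr EFin.
  by field; rewrite lt0r_neq0.
rewrite -(ler_pM2l d_gt0); apply: le_trans.
rewrite le_eqVlt; apply/orP; left; apply/eqP; rewrite mulr_sumr.
apply: eq_bigr => i _.
have -> : \int[mu]_x (u0 x * (- eps i * ((w i x - w i.+1 x) / d))) =
   (- eps i / d) * (I i - I i.+1).
  rewrite /I -RintegralB// -RintegralZl//.
  by apply: eq_Rintegral => x _; field; rewrite lt0r_neq0.
by field; rewrite lt0r_neq0.
Qed.

(** The weights are the signs of the increments of the averages. Replacing A by I costs at most 2 B
    dl for each of the two cells of an increment. *)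
Lemma ramp_variation : \sum_(i < m) `|A i.+1 - A i| <= d * V + m%:R * (4 * B * dl).
Proof.
have dl0 := dl_gt0; have d0 := d_gt0; have := @sum_sg_le (fun i => Num.sg (A i.+1 - A i)) _.
have sg1 i : `|Num.sg (A i.+1 - A i)| <= 1.
  by rewrite normr_sg; case: (_ != _).
move=> /(_ sg1) h; apply: (@le_trans _ _ (\sum_(i < m)
   (Num.sg (A i.+1 - A i) * (I i.+1 - I i) + 4 * B * dl))).
  apply: ler_sum => i _; rewrite normrEsg.
  have := I_A i; have := I_A i.+1; have := sg1 i.
  set e := Num.sg _; rewrite !ler_norml => /andP[? ?] /andP[? ?] /andP[? ?].
  have dB : 0 <= dl * B by rewrite mulr_ge0// ltW.
  have : `|e * ((A i.+1 - I i.+1) - (A i - I i))| <= 1 * (4 * B * dl).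
    rewrite normrM ler_pM// ?sg1// ler_norml; apply/andP; split; lra.
  rewrite mul1r ler_norml => /andP[_]; rewrite mulrBr; lra.
rewrite big_split/= lerD// sumr_const card_ord -[X in X <= _]mulr_natl.
by [].
Qed.

End ramp.

(** For a fixed window and mesh the ramp width [dl] is free; letting it tend to 0 removes the error
    and leaves exactly V. *)
Theorem cell_average_variation (u0 : R -> R) (B V d : R) : 0 < d ->
  measurable_fun [set: line] (u0 : line -> R) ->
  (forall x, `|u0 x| <= B) ->
  (forall psi : R -> R, C1 psi -> compactly_supported setT psi ->
    (forall x, `|psi x| <= 1) -> \int[mu]_x (u0 x * derive1 psi x) <= V) ->
  bounded_sums (fun j : int => `|
    d^-1 * \int[mu]_(x in `[(j + 1)%:~R * d, (j + 1 + 1)%:~R * d]) u0 x -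
    d^-1 * \int[mu]_(x in `[j%:~R * d, (j + 1)%:~R * d]) u0 x|) V.
Proof.
move=> d0 mu0 u0B u0V a m.
have B0 : 0 <= B by exact: le_trans (u0B 0).
apply/ler_addgt0Pr => e e0.
(* Coefficient of the ramp width once [ramp_variation] is divided by d; the width e / (Y + 1) makes
   the error at most e. *)
pose Y := m%:R * (4 * B) / d; have Y0 : 0 <= Y.
  by rewrite /Y divr_ge0 ?mulr_ge0// ltW.
have K0 : 0 < Y + 1 by rewrite ltr_wpDl.
have := @ramp_variation (e / (Y + 1)) (divr_gt0 e0 K0) d d0 a m
  u0 B V mu0 u0B u0V.
rewrite -(ler_pM2l (_ : 0 < d^-1)) ?invr_gt0// => h.
apply: (le_trans (le_trans _ h)).
  rewrite mulr_sumr; apply: ler_sum => i _.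
  rewrite -mulrBr normrM gtr0_norm ?invr_gt0//.
  have E n : a + n.+1%:Z = a + n%:Z + 1 by rewrite -addn1 PoszD addrA.
  by rewrite !E.
rewrite mulrDr mulKf ?lt0r_neq0// lerD2l.
rewrite [X in X <= _](_ : _ = Y * e / (Y + 1)); last first.
  by set Z := (Y + 1)^-1; rewrite /Y; ring.
rewrite ler_pdivrMr// mulrC; apply: ler_wpM2l; first exact: ltW.
by rewrite lerDl.
Qed.

End cell_averages.

(** * Increments and difference quotients of C^1 test functions of two variables *)

Section plane_test_functions.
Context (R : realType).
Implicit Types (f : R * R -> R) (p q : R * R).

(** The end points come in any order, since displacements of both signs occur; the intermediate
    point is only located by its distance to [a]. *)
Lemma MVT_sym (g g' : R -> R) (a b : R) : (forall x : R, is_derive x 1 g (g' x)) ->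
  exists2 c, `|c - a| <= `|b - a| & g b - g a = (b - a) * g' c.
Proof.
move=> dg; have cg : continuous g.
  by move=> x; apply: differentiable_continuous; apply/derivable1_diffP.
have key (x y : R) : x <= y -> exists2 c, x <= c <= y & g y - g x = (y - x) * g' c.
  move=> xy; have [|c cI ->] := @MVT_segment R g g' x y xy (fun z _ => dg z).
    exact: continuous_subspaceT.
  by exists c; [rewrite in_itv/= in cI|rewrite mulrC].
have [ab|/ltW ba] := leP a b.
  have [c /andP[c1 c2] E] := key _ _ ab; exists c => //.
  by rewrite !ger0_norm; lra.
have [c /andP[c1 c2] E] := key _ _ ba; exists c.
  by rewrite !ler0_norm; lra.
by rewrite -opprB E; ring.
Qed.

Lemma is_derive_t f : (forall p, derivable f p ((1, 0) : R * R)) ->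
  forall t x : R, is_derive t 1 (fun s => f (s, x)) (d_t f (t, x)).
Proof.
move=> df t x; have := df (t, x); rewrite /d_t.
have E : (fun h : R => h^-1 *: ((f \o shift (t, x)) (h *: ((1, 0) : R * R)) - f (t, x)))
  = (fun h : R => h^-1 *: (((fun s => f (s, x)) \o shift t) (h *: 1) - f (t, x))).
  apply/funext => h /=; congr (_ *: (f _ - _)).
  by congr pair; rewrite /= /GRing.scale/= ?mulr0 ?add0r.
by rewrite /derivable /derive E => dt; split.
Qed.

Lemma is_derive_x f : (forall p, derivable f p ((0, 1) : R * R)) ->
  forall t x : R, is_derive x 1 (fun s => f (t, s)) (d_x f (t, x)).
Proof.
move=> df t x; have := df (t, x); rewrite /d_x.
have E : (fun h : R => h^-1 *: ((f \o shift (t, x)) (h *: ((0, 1) : R * R)) - f (t, x)))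
  = (fun h : R => h^-1 *: (((fun s => f (t, s)) \o shift x) (h *: 1) - f (t, x))).
  apply/funext => h /=; congr (_ *: (f _ - _)).
  by congr pair; rewrite /= /GRing.scale/= ?mulr0 ?add0r.
by rewrite /derivable /derive E => dt; split.
Qed.

Lemma derive_outside_support f (v p : R * R) :
  ~ closure [set q | f q != 0] p -> 'D_v f p = 0.
Proof.
move=> np; apply/cvg_lim => //.
have op : \forall q \near p, f q = 0.
  have : open (~` closure [set q | f q != 0]).
    by apply: closed_openC; exact: closed_closure.
  rewrite openE => /(_ p np); apply: filterS => q /= nq.
  by apply: contrapT => /eqP fq; apply: nq; exact: subset_closure.
have fp : f p = 0 := nbhs_singleton op.
apply: cvg_near_cst; rewrite fp.
have cs : h *: v + p @[h --> (0 : R)] --> p.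
  have : h *: v + p @[h --> (0 : R)] --> 0 *: v + p.
    by apply: cvgD; [apply: cvgZ; [exact: cvg_id|exact: cvg_cst]|exact: cvg_cst].
  by rewrite scale0r add0r.
have := cs _ op => /nbhs_dnbhs.
by apply: filterS => h /= ->; rewrite subrr scaler0.
Qed.

(** What the limit arguments retain of a test function: [K] carries it and its first derivatives,
    [D] bounds all three, [N] bounds [K]. Partial derivatives are restated along coordinate lines,
    ready for the one-variable mean value theorem. *)
Record plane_test f (K : set (R * R)) (D N : R) : Prop := PlaneTest {
  pt_cont : continuous f;
  pt_cont_t : continuous (d_t f);
  pt_cont_x : continuous (d_x f);
  pt_der_t : forall t x : R, is_derive t 1 (fun s => f (s, x)) (d_t f (t, x));
  pt_der_x : forall t x : R, is_derive x 1 (fun s => f (t, s)) (d_x f (t, x));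
  pt_D_ge0 : 0 <= D;
  pt_D_t : forall p, `|d_t f p| <= D;
  pt_D_x : forall p, `|d_x f p| <= D;
  pt_f_D : forall p, `|f p| <= D;
  pt_N_ge0 : 0 <= N;
  pt_out : forall p, ~ K p -> [/\ f p = 0, d_t f p = 0 & d_x f p = 0];
  pt_box : forall p, K p -> `|p.1| <= N /\ `|p.2| <= N }.

Lemma continuous_support_bounded f (K : set (R * R)) : compact K -> continuous f ->
  (forall p, ~ K p -> f p = 0) -> exists2 D, 0 <= D & forall p, `|f p| <= D.
Proof.
move=> cK cf f0.
have /compact_bounded[M [Mr hM]] : compact (f @` K).
  by apply: continuous_compact => //; exact: continuous_subspaceT.
exists (`|M| + 1); first by rewrite addr_ge0.
move=> p; have [Kp|nKp] := pselect (K p); last by rewrite f0// normr0 addr_ge0.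
by apply: hM; [rewrite ltr_pwDr// ler_norm|exists p].
Qed.

Lemma Ck2_plane_test f (Omega : set (R * R)) : Ck2 1 f ->
  compactly_supported Omega f ->
  exists (K : set (R * R)) (D N : R), K `<=` Omega /\ plane_test f K D N.
Proof.
move=> [cf dt dx ct cx] [cK KO].
set K := closure _ in cK KO.
have out p : ~ K p -> [/\ f p = 0, d_t f p = 0 & d_x f p = 0].
  move=> nK; split; [|exact: derive_outside_support|exact: derive_outside_support].
  by apply: contrapT => /eqP fp; apply: nK; exact: subset_closure.
have [D1 D10 hD1] : exists2 D, 0 <= D & forall p, `|d_t f p| <= D.
  by apply: (@continuous_support_bounded _ K) => // p /out[].
have [D2 D20 hD2] : exists2 D, 0 <= D & forall p, `|d_x f p| <= D.
  by apply: (@continuous_support_bounded _ K) => // p /out[].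
have [D3 D30 hD3] : exists2 D, 0 <= D & forall p, `|f p| <= D.
  by apply: (@continuous_support_bounded _ K) => // p /out[].
have [M [Mr hM]] := compact_bounded cK.
exists K, (D1 + D2 + D3), (`|M| + 1); split; first exact: KO.
have N0 : 0 <= `|M| + 1 by rewrite addr_ge0.
have D0 : 0 <= D1 + D2 + D3 by rewrite !addr_ge0.
refine (PlaneTest cf ct cx (is_derive_t dt) (is_derive_x dx) D0 _ _ _ N0 out _).
- by move=> p; rewrite (le_trans (hD1 p))// -addrA lerDl addr_ge0.
- by move=> p; rewrite (le_trans (hD2 p))// addrAC lerDr addr_ge0.
- by move=> p; rewrite (le_trans (hD3 p))// lerDr addr_ge0.
move=> p Kp; have h : M < `|M| + 1 by rewrite ltr_pwDr// ler_norm.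
have : Num.max `|p.1| `|p.2| <= `|M| + 1 := hM (`|M| + 1) h p Kp.
by rewrite ge_max => /andP[].
Qed.

Section increments.
Context f K D N (hf : plane_test f K D N).

(** Moving first in x and then in t, one mean value theorem per segment, avoids any appeal to joint
    differentiability. *)
Lemma increment_points p (v : R * R) : exists q1 q2 : R * R,
  [/\ `|q1.1 - p.1| <= `|v.1|, `|q1.2 - p.2| <= `|v.2|,
      `|q2.1 - p.1| <= `|v.1|, `|q2.2 - p.2| <= `|v.2| &
      f (translate v p) - f p = v.1 * d_t f q1 + v.2 * d_x f q2].
Proof.
case: p v => t x [a b]; rewrite /translate/=.
have [c1 h1 E1] := MVT_sym t (t + a) (fun s => pt_der_t hf s (x + b)).
have [c2 h2 E2] := MVT_sym x (x + b) (pt_der_x hf t).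
exists (c1, x + b), (t, c2); split => /=.
- by rewrite (_ : t + a - t = a) in h1; last by ring.
- by rewrite (_ : x + b - x = b)//; ring.
- by rewrite subrr normr0.
- by rewrite (_ : x + b - x = b) in h2; last by ring.
rewrite (_ : _ - _ = (f (t + a, x + b) - f (t, x + b)) + (f (t, x + b) - f (t, x))).
  by rewrite E1 E2; congr (_ * _ + _ * _); ring.
by ring.
Qed.

Lemma increment_bound p v : `|f (translate v p) - f p| <= (`|v.1| + `|v.2|) * D.
Proof.
have [q1 [q2 [_ _ _ _ ->]]] := increment_points p v.
rewrite mulrDl; apply: le_trans (ler_normD _ _) _; rewrite !normrM.
apply: lerD; apply: ler_pM => //.
  exact: (pt_D_t hf).
exact: (pt_D_x hf).
Qed.

(** The points of [increment_points] tend to p and the partial derivatives are continuous there. The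
    steps [h k] may have either sign, and negative ones are used below. *)
Lemma increment_cvg p (v : R * R) (h : nat -> R) : (forall k, h k != 0) ->
  h @ \oo --> (0 : R) ->
  (f (translate (h k * v.1, h k * v.2) p) - f p) / h k @[k --> \oo] -->
    v.1 * d_t f p + v.2 * d_x f p.
Proof.
move=> hn0 h0; apply/cvgrPdist_le => eps eps0.
pose W := `|v.1| + `|v.2| + 1.
have W0 : 0 < W by rewrite ltr_wpDl// addr_ge0.
have e0 : 0 < eps / W by exact: divr_gt0.
have /cvgrPdist_le/(_ _ e0) := @pt_cont_t _ _ _ _ hf p.
move=> /nbhs_normP[d1 d10 hd1].
have /cvgrPdist_le/(_ _ e0) := @pt_cont_x _ _ _ _ hf p.
move=> /nbhs_normP[d2 d20 hd2].
have h1 : \forall k \near \oo, `|h k| * W < d1.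
  have : 0 < d1 / W by exact: divr_gt0.
  move/cvgrPdist_lt : h0 => /[apply]; apply: filterS => k.
  by rewrite sub0r normrN ltr_pdivlMr.
have h2 : \forall k \near \oo, `|h k| * W < d2.
  have : 0 < d2 / W by exact: divr_gt0.
  move/cvgrPdist_lt : h0 => /[apply]; apply: filterS => k.
  by rewrite sub0r normrN ltr_pdivlMr.
near=> k.
have k1 : `|h k| * W < d1 by near: k.
have k2 : `|h k| * W < d2 by near: k.
have [q1 [q2 [/= a1 a2 a3 a4 ->]]] := increment_points p (h k * v.1, h k * v.2).
rewrite /= in a1 a2 a3 a4 *.
have hv1 : `|h k * v.1| <= `|h k| * W.
  by rewrite normrM ler_wpM2l// /W -addrA lerDl addr_ge0.
have hv2 : `|h k * v.2| <= `|h k| * W.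
  by rewrite normrM ler_wpM2l// /W addrAC lerDr addr_ge0.
have b1 : `|d_t f p - d_t f q1| <= eps / W.
  apply: hd1; suff: Num.max `|p.1 - q1.1| `|p.2 - q1.2| < d1 by [].
  rewrite gt_max distrC (distrC p.2).
  by apply/andP; split; apply: le_lt_trans k1; [exact: le_trans a1 _|exact: le_trans a2 _].
have b2 : `|d_x f p - d_x f q2| <= eps / W.
  apply: hd2; suff: Num.max `|p.1 - q2.1| `|p.2 - q2.2| < d2 by [].
  rewrite gt_max distrC (distrC p.2).
  by apply/andP; split; apply: le_lt_trans k2; [exact: le_trans a3 _|exact: le_trans a4 _].
rewrite (_ : _ - _ = v.1 * (d_t f p - d_t f q1) + v.2 * (d_x f p - d_x f q2)).
  apply: le_trans (ler_normD _ _) _; rewrite !normrM.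
  apply: (@le_trans _ _ (`|v.1| * (eps / W) + `|v.2| * (eps / W))).
    by apply: lerD; apply: ler_wpM2l.
  rewrite -mulrDl mulrA ler_pdivrMr// mulrC; apply: ler_wpM2l; first exact: ltW.
  by rewrite /W lerDl.
by field; exact: hn0.
Unshelve. all: by end_near. Qed.

End increments.
End plane_test_functions.

(** * Bounded variation from translations *)

Section dominated.
Context d (T : measurableType d) (R : realType).
Variable mu : {measure set T -> \bar R}.

Lemma Rintegral_dominated_cvg (A : set T) (c : R) (F : nat -> T -> R) (G : T -> R) :
  measurable A -> (mu A < +oo)%E -> (forall k, measurable_fun setT (F k)) ->
  measurable_fun setT G -> (forall k x, `|F k x| <= c * \1_A x) ->
  (forall x, F k x @[k --> \oo] --> G x) ->
  \int[mu]_x F k x @[k --> \oo] --> \int[mu]_x G x.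
Proof.
move=> mA muA mF mG FA FG.
have mFE k : measurable_fun setT (EFin \o F k) by exact/measurable_EFinP.
have mGE : measurable_fun setT (EFin \o G) by exact/measurable_EFinP.
have FGE : {ae mu, forall x, setT x -> (EFin \o F k) x @[k --> \oo] --> (EFin \o G) x}.
  apply: aeW => x _; apply/fine_cvgP; split; first exact: nearW.
  exact: FG.
have intA : mu.-integrable setT (fun x => (c * \1_A x)%:E).
  apply: (@integrable_bounded_support _ _ _ mu A (fun x => c * \1_A x) `|c|) => //.
    by apply: measurable_funM => //; exact: measurable_indic.
  by move=> x; rewrite normrM ler_wpM2l// ger0_norm.
have FAE : {ae mu, forall x k, setT x -> (`|(EFin \o F k) x| <= (c * \1_A x)%:E)%E}.
  by apply: aeW => x k _; rewrite lee_fin; exact: FA.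
have [iG _] := dominated_convergence measurableT mFE mGE FGE intA FAE.
move=> h; apply: fine_cvg; rewrite fineK//.
exact: integrable_fin_num.
Qed.

Lemma Rintegral_norm_le (A : set T) (f : T -> R) (M : R) : measurable A ->
  mu.-integrable setT (EFin \o f) -> (forall x, ~ A x -> f x = 0) ->
  (\int[mu]_(x in A) `|f x|%:E <= M%:E)%E -> `|\int[mu]_x f x| <= M.
Proof.
move=> mA intf f0 fM.
apply: (le_trans (le_normr_Rintegral measurableT intf)).
rewrite -lee_fin /Rintegral fineK; last first.
  exact: (integrable_fin_num measurableT (integrable_norm intf)).
apply: le_trans fM; rewrite [leRHS]integral_mkcond.
rewrite le_eqVlt; apply/orP; left; apply/eqP; apply: eq_integral => x _.
by rewrite patchE; case: ifPn => //; rewrite notin_setE => /f0 ->; rewrite normr0.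
Qed.

End dominated.

Section BV_from_translations.
Context (R : realType).
Local Notation mu := (@lebesgue_measure R).
Local Notation line := (measurableTypeR R).
Local Notation plane := (measurableTypeR R * measurableTypeR R)%type.

Definition square (N : R) : set (R * R) := `[- N, N] `*` `[- N, N].

Lemma squareP N (p : R * R) : square N p <-> `|p.1| <= N /\ `|p.2| <= N.
Proof. by rewrite /square /= !in_itv/= !ler_norml. Qed.

Lemma measurable_square N : measurable (square N : set plane).
Proof. exact: measurableX. Qed.

Lemma leb2_square_lty N : (leb2 R (square N) < +oo)%E.
Proof.
rewrite leb2X// lebesgue_measure_itv/=.
by case: ifPn => _; rewrite ?mule0// -EFinB -EFinM ltry.
Qed.

(** An open set is the union, over all n, of the cells of mesh 1 / (n + 1) contained in it; those of
    one mesh form a measurable set, being selected by their index. *)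
Lemma open_plane_measurable (U : set (R * R)) : open U -> measurable (U : set plane).
Proof.
move=> oU; pose e n : R := n.+1%:R^-1.
have e0 n : 0 < e n by rewrite invr_gt0.
pose good n (k : int * int) :=
  `[< forall q, floor2 (e n) (e n) q = k -> U q >].
have -> : U = \bigcup_n ((good n \o floor2 (e n) (e n)) @^-1` [set true]).
  apply/seteqP; split => [p Up|p [n _ /= /asboolP]]; last exact.
  have /nbhs_normP[d d0 hd] : nbhs p U by move: oU; rewrite openE; exact.
  have : \forall n \near \oo, e n < d by exact: near_infty_natSinv_lt (PosNum d0).
  move=> [n _ /(_ n (leqnn _)) /= end_]; exists n => //=; apply/asboolP => q.
  move=> [q1 q2]; apply: hd; suff: Num.max `|p.1 - q.1| `|p.2 - q.2| < d by [].
  have key (x y : R) : Num.floor (x / e n) = Num.floor (y / e n) -> `|y - x| < d.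
    move=> xy; apply: le_lt_trans end_.
    have := floor_itv (x / e n); have := floor_itv (y / e n); rewrite xy.
    rewrite !ler_pdivlMr// !ltr_pdivrMr// intrD mulrDl mul1r.
    by move=> /andP[? ?] /andP[? ?]; rewrite ler_norml; apply/andP; split; lra.
  by rewrite gt_max !key.
apply: bigcup_measurable => n _.
have := @measurable_floor2_comp R (e n) (e n) (e0 n) (e0 n) _ bool (good n) measurableT [set true] I.
by rewrite setTI.
Qed.

Lemma compact_plane_measurable (K : set (R * R)) : compact K ->
  measurable (K : set plane).
Proof.
move=> cK; rewrite -(setCK K); apply: measurableC; apply: open_plane_measurable.
by apply: closed_openC; apply: compact_closed => //; exact: norm_hausdorff.
Qed.

Lemma bounded_L1loc2 (D : set (R * R)) (u : R * R -> R) (B : R) :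
  measurable_fun [set: plane] (u : plane -> R) -> (forall p, `|u p| <= B) ->
  L1loc2 D u.
Proof.
move=> mu_ uB; split; first exact: measurable_funTS.
move=> K cK _; have mK := compact_plane_measurable cK.
have [M [Mr hM]] := compact_bounded cK.
have KM : K `<=` square (`|M| + 1).
  move=> p Kp; apply/squareP.
  have h : M < `|M| + 1 by rewrite ltr_pwDr// ler_norm.
  have : Num.max `|p.1| `|p.2| <= `|M| + 1 := hM (`|M| + 1) h p Kp.
  by rewrite ge_max => /andP[].
have mn : measurable_fun [set: plane] (fun p : plane => `|u p|%:E).
  by apply/measurable_EFinP; apply: measurableT_comp.
apply: (@le_lt_trans _ _ (\int[leb2 R]_(p in square (`|M| + 1)) `|u p|%:E)%E).
  apply: ge0_subset_integral => //; first exact: measurable_square.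
  exact: measurable_funTS.
have B0 : 0 <= B := le_trans (normr_ge0 _) (uB (0, 0)).
apply: le_lt_trans (integral_le_bound_cst (measurable_square _) _ B0
  (l := fine (leb2 R (square (`|M| + 1)))) _ _) _.
- by apply: measurable_funTS; apply: measurableT_comp.
- by rewrite fineK// ge0_fin_numE// leb2_square_lty.
- by move=> p _; rewrite normr_ge0 uB.
- by rewrite ltry.
Qed.

Lemma translateK (a p : R * R) : translate a (translate (- a.1, - a.2) p) = p.
Proof. by case: p => t x; rewrite /translate/= !subrK. Qed.

Section one_function.
Context (u : R * R -> R) (B : R).
Hypothesis mu_ : measurable_fun [set: plane] (u : plane -> R).
Hypothesis uB : forall p, `|u p| <= B.

Let B_ge0 : 0 <= B. Proof. exact: le_trans (uB (0, 0)). Qed.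

Lemma measurable_comp_translate (f : R * R -> R) a :
  measurable_fun [set: plane] (f : plane -> R) ->
  measurable_fun [set: plane] ((fun p => f (translate a p)) : plane -> R).
Proof.
move=> mf.
exact: (@measurableT_comp _ _ _ plane plane R f _ _ mf (measurable_translate a)).
Qed.

Lemma translate_support f K D N (a p : R * R) W : plane_test f K D N ->
  `|a.1| <= W -> `|a.2| <= W -> ~ square (N + W) p ->
  f (translate a p) = 0 /\ f p = 0.
Proof.
move=> hf a1 a2 np.
have W0 : 0 <= W := le_trans (normr_ge0 _) a1.
have out q : ~ K q -> f q = 0 by move=> /(pt_out hf)[].
split; apply: out => /(pt_box hf) [h1 h2]; apply: np; apply/squareP.
  rewrite /translate/= in h1 h2; split.
    by rewrite -[p.1](addrK a.1) (le_trans (ler_normB _ _))// lerD.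
  by rewrite -[p.2](addrK a.2) (le_trans (ler_normB _ _))// lerD.
by split; [apply: le_trans h1 _|apply: le_trans h2 _]; rewrite lerDl.
Qed.

(** Discrete integration by parts: the derivative of f is the limit of difference quotients, and
    translating the integral moves the difference onto u. There f, bounded by 1 and carried by the
    box, leaves only the assumed estimate on that box. *)
Lemma directional_derivative_bound (C : R) (e : R * R) (T N : R) f K D N' :
  plane_test f K D N' -> K `<=` box T N -> (forall p, `|f p| <= 1) ->
  (forall h, 0 < h -> (\int[leb2 R]_(p in box T N)
     `|u p - u (translate (h * e.1, h * e.2) p)|%:E <= (h * C)%:E)%E) ->
  \int[leb2 R]_p (u p * (e.1 * d_t f p + e.2 * d_x f p)) <= C.
Proof.
move=> hf KTN f1 uC.
have mf : measurable_fun [set: plane] (f : plane -> R).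
  exact: continuous_plane_measurable (pt_cont hf).
have mft := continuous_plane_measurable (pt_cont_t hf).
have mfx := continuous_plane_measurable (pt_cont_x hf).
pose W := `|e.1| + `|e.2|; pose A := square (N' + W).
have W0 : 0 <= W by rewrite addr_ge0.
pose h k : R := k.+1%:R^-1.
have h0 k : 0 < h k by rewrite invr_gt0.
have h1 k : h k <= 1 by rewrite invf_le1// ler1n.
(* The quotient is taken backwards so that u ends up translated by + h e, the only direction in
   which the hypothesis controls it. *)
pose Q k p := (f (translate (- h k * e.1, - h k * e.2) p) - f p) / (- h k).
have he k : `|- h k * e.1| <= W /\ `|- h k * e.2| <= W.
  rewrite !normrM normrN (gtr0_norm (h0 k)) /W; split.
    by apply: (@le_trans _ _ `|e.1|); rewrite ?ler_piMl ?lerDl.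
  by apply: (@le_trans _ _ `|e.2|); rewrite ?ler_piMl ?lerDr.
have tsup k p : ~ A p -> f (translate (- h k * e.1, - h k * e.2) p) = 0 /\ f p = 0.
  exact: (@translate_support f K D N' (- h k * e.1, - h k * e.2) p W hf
    (he k).1 (he k).2).
have mfk k : measurable_fun [set: plane]
   ((fun p => f (translate (- h k * e.1, - h k * e.2) p)) : plane -> R).
  exact: measurable_comp_translate.
have mQ k : measurable_fun [set: plane] (Q k : plane -> R).
  by apply: measurable_funM => //; apply: measurable_funB.
have cvgQ : \int[leb2 R]_p (u p * Q k p) @[k --> \oo] -->
    \int[leb2 R]_p (u p * (e.1 * d_t f p + e.2 * d_x f p)).
  apply: (@Rintegral_dominated_cvg _ plane R (leb2 R) A (B * (W * D))
    (fun k p => u p * Q k p) (fun p => u p * (e.1 * d_t f p + e.2 * d_x f p))).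
  - exact: measurable_square.
  - exact: leb2_square_lty.
  - by move=> k; exact: measurable_funM.
  - apply: measurable_funM => //; apply: measurable_funD; exact: measurable_funM.
  - move=> k p; rewrite indicE; have [Ap|] := boolP (p \in A).
      rewrite mulr1 normrM; apply: ler_pM => //.
      rewrite /Q normrM normfV normrN (gtr0_norm (h0 k)) ler_pdivrMr//.
      apply: le_trans (increment_bound hf p _) _ => /=.
      rewrite !normrM normrN (gtr0_norm (h0 k)) -mulrDr.
      by rewrite le_eqVlt; apply/orP; left; apply/eqP; rewrite /W; ring.
    rewrite notin_setE => /(tsup k) [E1 E2].
    by rewrite /Q E1 E2 subrr mul0r mulr0 normr0 mulr0.
  move=> p; apply: cvgM; first exact: cvg_cst.
  have hn k : - h k != 0 by rewrite oppr_eq0 lt0r_neq0.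
  have hc : (fun k => - h k) @ \oo --> (0 : R).
    by rewrite -[X in _ --> X]oppr0; apply: cvgN; exact: cvg_harmonic.
  exact: (@increment_cvg R f K D N' hf p e _ hn hc).
rewrite -(cvg_lim _ cvgQ)//; apply: limr_le; first by apply/cvg_ex; eexists; exact: cvgQ.
apply: nearW => k.
have int1 : (leb2 R).-integrable setT (EFin \o (fun p : plane => u p * f p)).
  apply: (@integrable_bounded_support _ plane R (leb2 R) A _ (B * 1)).
  - exact: measurable_square.
  - exact: leb2_square_lty.
  - exact: measurable_funM.
  - move=> p; rewrite indicE; have [Ap|] := boolP (p \in A).
      by rewrite mulr1 normrM ler_pM.
    rewrite notin_setE => /(tsup k) [E1 E2].
    by rewrite E2 mulr0 normr0 mulr0.
pose a : R * R := (h k * e.1, h k * e.2).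
have aE : (- a.1, - a.2) = (- h k * e.1, - h k * e.2) by rewrite /a/= !mulNr.
have mut : measurable_fun [set: plane] ((fun p => u (translate a p)) : plane -> R).
  exact: measurable_comp_translate.
have int2 : (leb2 R).-integrable setT
    (EFin \o (fun p : plane => u (translate a p) * f p)).
  apply: (@integrable_bounded_support _ plane R (leb2 R) A _ (B * 1)).
  - exact: measurable_square.
  - exact: leb2_square_lty.
  - exact: measurable_funM.
  - move=> p; rewrite indicE; have [Ap|] := boolP (p \in A).
      by rewrite mulr1 normrM ler_pM.
    rewrite notin_setE => /(tsup k) [E1 E2].
    by rewrite E2 mulr0 normr0 mulr0.
have int3 : (leb2 R).-integrable setT
    (EFin \o (fun p : plane => u p * f (translate (- a.1, - a.2) p))).
  apply: (@integrable_bounded_support _ plane R (leb2 R) A _ (B * 1)).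
  - exact: measurable_square.
  - exact: leb2_square_lty.
  - by apply: measurable_funM => //; rewrite aE.
  - move=> p; rewrite indicE; have [Ap|] := boolP (p \in A).
      by rewrite mulr1 normrM ler_pM.
    rewrite notin_setE => /(tsup k) [E1 E2].
    by rewrite aE E1 mulr0 normr0 mulr0.
have E : \int[leb2 R]_p (u p * Q k p) =
    (h k)^-1 * \int[leb2 R]_p ((u p - u (translate a p)) * f p).
  have -> : \int[leb2 R]_p ((u p - u (translate a p)) * f p) =
      \int[leb2 R]_p (u p * f p) - \int[leb2 R]_p (u p * f (translate (- a.1, - a.2) p)).
    under eq_Rintegral do rewrite mulrBl.
    rewrite RintegralB//; congr (_ - _).
    rewrite -(Rintegral_translate (- a.1, - a.2) (f := fun p => u (translate a p) * f p))//.
      by apply: eq_Rintegral => p _; rewrite translateK.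
    exact: measurable_funM.
  rewrite -RintegralB// -RintegralZl//; last first.
    by have := integrableB measurableT int1 int3.
  by apply: eq_Rintegral => p _; rewrite /Q aE; field; rewrite lt0r_neq0.
rewrite E ler_pdivrMl//; apply: le_trans (ler_norm _) _.
apply: (@Rintegral_norm_le _ plane R (leb2 R) (box T N)).
- exact: measurable_box.
- have := integrableB measurableT int1 int2.
  by congr (_.-integrable _ _); apply/funext => p /=; rewrite mulrBl.
- move=> p np; rewrite (_ : f p = 0) ?mulr0//.
  by have [] := pt_out hf (fun Kp => np (KTN _ Kp)).
apply: le_trans (uC _ (h0 k)).
have mdu : measurable_fun [set: plane] ((fun p => u p - u (translate a p)) : plane -> R).
  exact: measurable_funB.
apply: ge0_le_integral => //.
- exact: measurable_box.
- apply: measurable_funTS; apply/measurable_EFinP; apply: measurableT_comp => //.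
  exact: measurable_funM.
- by apply: measurable_funTS; apply/measurable_EFinP; exact: measurableT_comp.
- by move=> p _; rewrite lee_fin normrM ler_piMr.
Qed.

(** The divergence splits into its two terms, each component of the field being bounded by 1; their
    supports, compact in the open strip, lie in a box with times in [0, T]. *)
Lemma BV2_of_translations (T C1 C2 : R) :
  (forall N h, 0 <= N -> 0 < h -> (\int[leb2 R]_(p in box T N)
     `|u p - u (translate (h, 0) p)|%:E <= (h * C1)%:E)%E) ->
  (forall N h, 0 <= N -> 0 < h -> (\int[leb2 R]_(p in box T N)
     `|u p - u (translate (0, h) p)|%:E <= (h * C2)%:E)%E) ->
  BV2 (strip T) u.
Proof.
move=> hC1 hC2; split; first exact: bounded_L1loc2 mu_ uB.
apply: (@le_lt_trans _ _ (C1 + C2)%:E); last exact: ltry.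
apply: ge_ereal_sup => _ [[f1 f2] /= [[c1 c2] [s1 s2] f12] <-]; rewrite lee_fin.
have [K1 [D1 [N1 [K1s hf1]]]] := Ck2_plane_test c1 s1.
have [K2 [D2 [N2 [K2s hf2]]]] := Ck2_plane_test c2 s2.
have sb (N' : R) (K : set (R * R)) : K `<=` strip T ->
    (forall p, K p -> `|p.1| <= N' /\ `|p.2| <= N') -> K `<=` box T N'.
  move=> Ks KN p Kp; apply/boxP; have [_] := KN p Kp; rewrite ler_norml => ->.
  by have := Ks p Kp; rewrite /strip/= in_itv/= => -[/andP[/ltW -> /ltW ->]].
have b1 p : `|f1 p| <= 1.
  apply: le_trans (f12 p); rewrite -sqrtr_sqr ler_wsqrtr// lerDl sqr_ge0.
  by [].
have b2 p : `|f2 p| <= 1.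
  apply: le_trans (f12 p); rewrite -sqrtr_sqr ler_wsqrtr// lerDr sqr_ge0.
  by [].
have B1 := @directional_derivative_bound C1 (1, 0) T N1 f1 K1 D1 N1 hf1
  (sb _ _ K1s (pt_box hf1)) b1 _.
have B2 := @directional_derivative_bound C2 (0, 1) T N2 f2 K2 D2 N2 hf2
  (sb _ _ K2s (pt_box hf2)) b2 _.
have i1 : (leb2 R).-integrable setT (EFin \o (fun p : plane => u p * d_t f1 p)).
  apply: (@integrable_bounded_support _ plane R (leb2 R) (square N1) _ (B * D1)).
  - exact: measurable_square.
  - exact: leb2_square_lty.
  - by apply: measurable_funM => //; exact: continuous_plane_measurable (pt_cont_t hf1).
  - move=> p; rewrite indicE; have [Ap|] := boolP (p \in square N1).
      by rewrite mulr1 normrM ler_pM//; exact: (pt_D_t hf1).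
    rewrite notin_setE => np; have [|_ -> _] := pt_out hf1 (p := p).
      by move=> /(pt_box hf1) ?; apply: np; exact/squareP.
    by rewrite mulr0 normr0 mulr0.
have i2 : (leb2 R).-integrable setT (EFin \o (fun p : plane => u p * d_x f2 p)).
  apply: (@integrable_bounded_support _ plane R (leb2 R) (square N2) _ (B * D2)).
  - exact: measurable_square.
  - exact: leb2_square_lty.
  - by apply: measurable_funM => //; exact: continuous_plane_measurable (pt_cont_x hf2).
  - move=> p; rewrite indicE; have [Ap|] := boolP (p \in square N2).
      by rewrite mulr1 normrM ler_pM//; exact: (pt_D_x hf2).
    rewrite notin_setE => np; have [|_ _ ->] := pt_out hf2 (p := p).
      by move=> /(pt_box hf2) ?; apply: np; exact/squareP.
    by rewrite mulr0 normr0 mulr0.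
rewrite (_ : \int[leb2 R]_(p in strip T) _ =
   \int[leb2 R]_p (u p * d_t f1 p) + \int[leb2 R]_p (u p * d_x f2 p)); last first.
  rewrite -RintegralD// Rintegral_mkcond; apply: eq_Rintegral => p _.
  rewrite patchE; case: ifPn; first by rewrite mulrDr.
  rewrite notin_setE => np.
  have [|_ -> _] := pt_out hf1 (p := p); first by move=> /K1s.
  have [|_ _ ->] := pt_out hf2 (p := p); first by move=> /K2s.
  by rewrite !mulr0 addr0.
apply: lerD.
- apply: le_trans (B1 _).
    by rewrite le_eqVlt; apply/orP; left; apply/eqP; apply: eq_Rintegral => p _;
      rewrite /= mul1r mul0r addr0.
  by move=> h h0; rewrite /= mulr1 mulr0; apply: hC1 => //; exact: (pt_N_ge0 hf1).
- apply: le_trans (B2 _).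
    by rewrite le_eqVlt; apply/orP; left; apply/eqP; apply: eq_Rintegral => p _;
      rewrite /= mul1r mul0r add0r.
  by move=> h h0; rewrite /= mulr1 mulr0; apply: hC2 => //; exact: (pt_N_ge0 hf2).
Qed.

End one_function.
End BV_from_translations.

(** * Passage to the limit in the scheme *)

Section initial_layer.
Context (R : realType).
Local Notation mu := (@lebesgue_measure R).
Local Notation line := (measurableTypeR R).
Local Notation plane := (measurableTypeR R * measurableTypeR R)%type.

Lemma lebesgue_measure_segment_lty (a b : R) : (mu `[a, b]%classic < +oo)%E.
Proof. by rewrite lebesgue_measure_itv/=; case: ifPn => // _; rewrite -EFinB ltry. Qed.

Context (u0 : R -> R) (B : R).
Hypothesis mu0 : measurable_fun [set: line] (u0 : line -> R).
Hypothesis u0B : forall x, `|u0 x| <= B.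

Let B_ge0 : 0 <= B. Proof. exact: le_trans (u0B 0). Qed.

Definition cell_average (dx : R) (j : int) : R :=
  dx^-1 * \int[mu]_(x in `[j%:~R * dx, (j + 1)%:~R * dx]) u0 x.

Lemma integrable_itv_bounded (a b : R) (f : R -> R) (M : R) :
  measurable_fun [set: line] (f : line -> R) -> (forall x, `|f x| <= M) ->
  mu.-integrable `[a, b] (EFin \o f).
Proof.
move=> mf fM; apply: measurable_bounded_integrable => //.
- exact: lebesgue_measure_segment_lty.
- exact: measurable_funTS.
exists M; split; first exact: num_real.
by move=> y My x _; exact: le_trans (fM x) (ltW My).
Qed.

Lemma cell_integral (dx : R) (j : int) : 0 < dx ->
  \int[mu]_(x in `[j%:~R * dx, (j + 1)%:~R * dx[) (cell_average dx j - u0 x) = 0.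
Proof.
move=> dx0.
have iK : mu.-integrable `[j%:~R * dx, (j + 1)%:~R * dx]
    (EFin \o (fun x => cell_average dx j - u0 x)).
  apply: (@integrable_itv_bounded _ _ _ (`|cell_average dx j| + B)).
    exact: measurable_funB.
  by move=> x; rewrite (le_trans (ler_normB _ _))// lerD.
rewrite Rintegral_itv_bndo_bndc//; last first.
  by apply: integrableS iK => //; apply: subset_itvl; rewrite bnd_simp.
rewrite RintegralB//; last 2 first.
- exact: (@integrable_itv_bounded _ _ (fun=> cell_average dx j)
    `|cell_average dx j|).
- exact: (@integrable_itv_bounded _ _ u0 B).
rewrite Rintegral_cst//= lebesgue_measure_itv/= lte_fin ltr_pM2r// ltr_int.
rewrite ltrDl ltr01 -EFinB/=.
have -> : (j + 1)%:~R * dx - j%:~R * dx = dx by rewrite intrD; ring.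
by rewrite /cell_average mulrAC mulVf ?mul1r ?subrr// lt0r_neq0.
Qed.

Lemma cell_average_bound (dx : R) (j : int) : 0 < dx -> `|cell_average dx j| <= B.
Proof.
move=> dx0; have i0 := @integrable_itv_bounded (j%:~R * dx) ((j + 1)%:~R * dx) u0 B mu0 u0B.
rewrite /cell_average normrM gtr0_norm ?invr_gt0// ler_pdivrMl//.
apply: le_trans.
  by apply: le_normr_Rintegral => //; exact: i0.
rewrite -lee_fin /Rintegral fineK; last first.
  by apply: integrable_fin_num => //; exact: integrable_norm i0.
rewrite [dx * B]mulrC; apply: integral_le_bound_cst => //.
- by apply: measurable_funTS; exact: measurableT_comp.
- rewrite /= lebesgue_measure_itv/= lte_fin ltr_pM2r// ltr_int ltrDl ltr01 -EFinB/=.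
  have -> // : (j + 1)%:~R * dx - j%:~R * dx = dx by rewrite intrD; ring.
- by move=> x _; rewrite normr_ge0 u0B.
Qed.

Section one_mesh.
Context (eta : R -> R) (D N dx : R).
Hypothesis dx_gt0 : 0 < dx.
Hypothesis eta_lip : forall x y, `|eta y - eta x| <= D * `|y - x|.
Hypothesis eta_out : forall x, N < `|x| -> eta x = 0.
Hypothesis D_ge0 : 0 <= D.
Hypothesis N_ge0 : 0 <= N.

Let avg (x : R) : R := cell_average dx (Num.floor (x / dx)).
Let etad (x : R) : R := eta ((Num.floor (x / dx))%:~R * dx).

Let m_avg : measurable_fun [set: line] (avg : line -> R).
Proof. exact: measurable_floor_comp. Qed.

Let m_etad : measurable_fun [set: line] (etad : line -> R).
Proof. exact: (@measurable_floor_comp R dx (fun j => eta (j%:~R * dx)) dx_gt0). Qed.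

Lemma lipschitz_measurable : measurable_fun [set: line] (eta : line -> R).
Proof.
apply: continuous_measurable_fun => x; apply/cvgrPdist_le => eps eps0.
have D1 : 0 < D + 1 by rewrite ltr_wpDl.
have xn : \forall y \near x, `|x - y| <= eps / (D + 1).
  have /cvgrPdist_le := @cvg_id _ (nbhs x).
  by apply; exact: divr_gt0.
apply: filterS xn => y; rewrite ler_pdivlMr// => h.
apply: le_trans (eta_lip y x) _; apply: le_trans h.
by rewrite mulrC ler_wpM2l// lerDl.
Qed.

(** On each cell the step function is constant and [avg - u0] has mean zero. Only the cells from [b]
    to the floor of N / dx count: the other left end points lie outside [-N, N], where [eta]
    vanishes. *)
Let step_orthogonal : \int[mu]_x ((avg x - u0 x) * etad x) = 0.
Proof.
pose b := Num.floor (- N / dx); pose m := `|Num.floor (N / dx) - b|%N.+1.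
pose cell (i : 'I_m) := `[(b + i%:Z)%:~R * dx, (b + i%:Z + 1)%:~R * dx[%classic : set R.
pose F (i : 'I_m) (x : R) := eta ((b + i%:Z)%:~R * dx) *
  ((cell_average dx (b + i%:Z) - u0 x) * \1_(cell i) x).
have cellE (i : 'I_m) x : (x \in cell i) = (Num.floor (x / dx) == b + i%:Z).
  apply/idP/eqP => [|E].
    rewrite inE /cell/= in_itv/= => /andP[h1 h2]; apply: floor_def.
    by rewrite ler_pdivlMr// ltr_pdivrMr// h1.
  rewrite inE /cell/= in_itv/= -E; have := floor_itv (x / dx).
  by rewrite ler_pdivlMr// ltr_pdivrMr.
have -> : (fun x => (avg x - u0 x) * etad x) = (fun x => \sum_(i < m) F i x).
  apply/funext => x; set j := Num.floor (x / dx).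
  have [jI|jI] := boolP (b <= j <= Num.floor (N / dx)).
    have im : (`|j - b| < m)%N by rewrite /m; case/andP: jI => *; lia.
    have jE : b + (Ordinal im)%:Z = j by rewrite /=; case/andP: jI => *; lia.
    rewrite (bigD1 (Ordinal im))//= big1 ?addr0; last first.
      move=> i ii; rewrite /F indicE cellE (_ : (_ == _) = false) ?mulr0//.
      apply/negP => /eqP; rewrite -/j => ji; move/negP: ii; apply; apply/eqP.
      by apply: val_inj => /=; rewrite ji; lia.
    rewrite /F indicE cellE -/j jE eqxx mulr1 /avg /etad -/j.
    by rewrite mulrC.
  rewrite big1; last first.
    move=> i _; rewrite /F indicE cellE -/j (_ : (_ == _) = false) ?mulr0//.
    apply/negP => /eqP ji; move/negP: jI; apply; rewrite ji.
    have bN : b <= Num.floor (N / dx).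
      by apply: le_floor; rewrite ler_pM2r ?invr_gt0//; have := N_ge0; lra.
    by have := ltn_ord i; rewrite {2}/m => h; apply/andP; split; lia.
  rewrite /etad -/j eta_out ?mulr0// ltNge; apply/negP; rewrite ler_norml => /andP[h1 h2].
  move/negP: jI; apply; apply/andP; split; last by rewrite floor_ge_int ler_pdivlMr.
  rewrite -(@ler_int R); apply: le_trans (floor_le _) _.
  by rewrite ler_pdivrMr.
have intF i : mu.-integrable setT (EFin \o F i).
  apply: (@integrable_bounded_support _ line R mu
    `[(b + i%:Z)%:~R * dx, (b + i%:Z + 1)%:~R * dx]%classic _
    (`|eta ((b + i%:Z)%:~R * dx)| * (`|cell_average dx (b + i%:Z)| + B))) => //.
  - exact: lebesgue_measure_segment_lty.
  - apply: measurable_funM => //; apply: measurable_funM.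
      exact: measurable_funB.
    by apply: measurable_indic; exact: measurable_itv.
  - move=> x; rewrite /F; move: (cell_average dx (b + i%:Z)) => ca.
    rewrite !normrM -mulrA; apply: ler_wpM2l => //.
    apply: ler_pM => //; first by rewrite (le_trans (ler_normB _ _))// lerD.
    rewrite !indicE; have [xc|] := boolP (x \in cell i); last by rewrite normr0.
    rewrite mem_set ?normr1//=; move: xc; rewrite inE /cell/= !in_itv/=.
    by move=> /andP[-> /ltW ->].
rewrite Rintegral_sum//; apply: big1 => i _.
rewrite /F RintegralZl//; last first.
  apply: (@integrable_bounded_support _ line R mu
    `[(b + i%:Z)%:~R * dx, (b + i%:Z + 1)%:~R * dx]%classic _
    (`|cell_average dx (b + i%:Z)| + B)) => //.
  - exact: lebesgue_measure_segment_lty.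
  - apply: measurable_funM; first exact: measurable_funB.
    by apply: measurable_indic; exact: measurable_itv.
  - move=> x; move: (cell_average dx (b + i%:Z)) => ca; rewrite normrM; apply: ler_pM => //.
      by rewrite (le_trans (ler_normB _ _))// lerD.
    rewrite !indicE; have [xc|] := boolP (x \in cell i); last by rewrite normr0.
    rewrite mem_set ?normr1//=; move: xc; rewrite inE /cell/= !in_itv/=.
    by move=> /andP[-> /ltW ->].
rewrite (_ : \int[mu]_x _ = 0) ?mulr0//.
rewrite -(cell_integral (b + i%:Z) dx_gt0) [RHS]Rintegral_mkcond.
apply: eq_Rintegral => x _; rewrite patchE indicE.
by case: (x \in _); rewrite ?mulr1 ?mulr0.
Qed.

(* Averaging is symmetric, so the averages may be tested against the step
   function [etad] at no cost. *)
Lemma cell_average_weak : `|\int[mu]_x (avg x * eta x) - \int[mu]_x (u0 x * eta x)|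
  <= 2 * B * (D * dx) * (2 * (N + dx)).
Proof.
have m_eta := lipschitz_measurable.
have eta_etad x : `|eta x - etad x| <= D * dx.
  apply: le_trans (eta_lip _ _) _; apply: ler_wpM2l => //.
  by rewrite distrC; exact: grid_x.
(* [etad] reads [eta] at a node up to dx away, so its support may exceed [-N, N] by dx. *)
pose I := `[(- (N + dx)), N + dx]%classic : set R.
have ND : 0 <= N + dx by rewrite addr_ge0// ltW.
have out x : x \notin I -> eta x = 0 /\ etad x = 0.
  rewrite notin_setE /I/= in_itv/= => /negP; rewrite -ler_norml -ltNge => h.
  split; apply: eta_out; first by apply: le_lt_trans h; rewrite lerDl ltW.
  have := grid_x x dx_gt0; set y := _ * dx => yx.
  by have := ler_distD y x 0; rewrite !subr0 (distrC x); lra.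
have int_of (f g : R -> R) (M M' : R) : measurable_fun [set: line] (f : line -> R) ->
   measurable_fun [set: line] (g : line -> R) -> (forall x, `|f x| <= M) ->
   (forall x, `|g x| <= M' * \1_I x) ->
   mu.-integrable setT (EFin \o (fun x => f x * g x)).
  move=> mf mg fM gM.
  have M0 : 0 <= M := le_trans (normr_ge0 _) (fM 0).
  apply: (@integrable_bounded_support _ line R mu I _ (M * M')) => //.
  - exact: measurable_itv.
  - exact: lebesgue_measure_segment_lty.
  - exact: measurable_funM.
  - by move=> x; rewrite normrM -mulrA; apply: ler_pM.
have avgB x : `|avg x| <= B by exact: cell_average_bound.
have diffB x : `|avg x - u0 x| <= 2 * B.
  by apply: le_trans (ler_normB _ _) _; rewrite mulr_natl mulr2n lerD.
have m_diff : measurable_fun [set: line] ((fun x => avg x - u0 x) : line -> R).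
  exact: measurable_funB.
have etaI x : `|eta x| <= (D * (N + dx) + `|eta 0|) * \1_I x.
  rewrite indicE; have [xI|] := boolP (x \in I); last by move=> /out[-> _]; rewrite normr0 mulr0.
  rewrite mulr1; have := eta_lip 0 x; rewrite subr0.
  have : D * `|x| <= D * (N + dx).
    by apply: ler_wpM2l => //; move: xI; rewrite inE /I/= in_itv/= -ler_norml.
  by have := ler_distD 0 (eta x) (eta 0); have := ler_normD (eta x - eta 0) (eta 0);
    rewrite subrK; lra.
have difI x : `|eta x - etad x| <= D * dx * \1_I x.
  rewrite indicE; have [xI|] := boolP (x \in I); first by rewrite mulr1.
  by move=> /out[-> ->]; rewrite subrr normr0 mulr0.
have etadI x : `|etad x| <= (D * (N + dx) + `|eta 0| + D * dx) * \1_I x.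
  rewrite mulrDl; apply: le_trans (lerD (etaI x) (difI x)).
  by rewrite -[X in `|X| <= _](subKr (eta x)); apply: ler_normB.
rewrite -RintegralB//; [|exact: int_of avgB etaI|exact: int_of u0B etaI].
have i1 := int_of _ _ _ _ m_diff m_etad diffB etadI.
have i2 := int_of _ _ _ _ m_diff (measurable_funB m_eta m_etad) diffB difI.
rewrite (_ : \int[mu]_x _ = \int[mu]_x ((avg x - u0 x) * etad x) +
   \int[mu]_x ((avg x - u0 x) * (eta x - etad x))); last first.
  by rewrite -RintegralD//; apply: eq_Rintegral => x _; ring.
rewrite step_orthogonal add0r.
apply: (@Rintegral_norm_le _ line R mu I); [exact: measurable_itv|exact: i2| |].
  by move=> x /= nx; have [|-> ->] := out x; [rewrite notin_setE|rewrite subrr mulr0].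
apply: integral_le_bound_cst; first exact: measurable_itv.
- by apply: measurable_funTS; apply: measurableT_comp => //; apply: measurable_funM => //;
    exact: measurable_funB.
- by rewrite !mulr_ge0// ltW.
- rewrite /I/= lebesgue_measure_itv/= lte_fin; case: ifPn => _.
    by rewrite -EFinB lee_fin opprK; lra.
  by rewrite lee_fin mulr_ge0.
- by move=> x _; rewrite normr_ge0/= normrM; apply: ler_pM.
Qed.

End one_mesh.
End initial_layer.

(** * Discrete integration by parts along the two transport directions *)

Section transport_identity.
Context (R : realType).
Local Notation mu := (@lebesgue_measure R).
Local Notation line := (measurableTypeR R).
Local Notation plane := (measurableTypeR R * measurableTypeR R)%type.

(** The restriction to t >= 0 is kept as a real factor of the integrand, so that integrals run over
    the whole plane and can be translated. *)
Definition future (p : R * R) : R := (0 <= p.1)%R%:R.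

Lemma futureE p : future p = \1_(half_plane R) p.
Proof.
rewrite /future indicE; congr (nat_of_bool _)%:R.
apply/idP/idP => [h|]; first by rewrite inE /half_plane/= in_itv/= h.
by rewrite inE /half_plane/= in_itv/= andbT => -[].
Qed.

Lemma measurable_future : measurable_fun [set: plane] (future : plane -> R).
Proof.
rewrite (_ : future = \1_(half_plane R)); last by apply/funext => p; exact: futureE.
by apply: measurable_indic; exact: measurableX.
Qed.

Lemma future_bound p : `|future p| <= 1.
Proof. by rewrite /future; case: (0 <= _); rewrite ?normr1 ?normr0. Qed.

Section with_test.
Context (psi : R * R -> R) (K : set (R * R)) (D N : R).
Hypothesis hpsi : plane_test psi K D N.

Lemma translate0 p : translate (0, 0) p = p :> R * R.
Proof. by case: p => t x; rewrite /translate/= !addr0. Qed.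

Lemma integrable_against_test (g : R * R -> R) (B : R) (a : R * R) :
  measurable_fun [set: plane] (g : plane -> R) -> (forall p, `|g p| <= B) ->
  (leb2 R).-integrable setT (EFin \o (fun p : plane => g p * psi (translate a p))).
Proof.
move=> mg gB; pose A := square (N + (`|a.1| + `|a.2|)).
have B0 : 0 <= B := le_trans (normr_ge0 _) (gB (0, 0)).
apply: (@integrable_bounded_support _ plane R (leb2 R) A _ (B * D)).
- exact: measurable_square.
- exact: leb2_square_lty.
- apply: measurable_funM => //; apply: measurable_comp_translate.
  exact: continuous_plane_measurable (pt_cont hpsi).
move=> p; rewrite indicE; have [Ap|] := boolP (p \in A).
  by rewrite mulr1 normrM; apply: ler_pM => //; exact: (pt_f_D hpsi).
rewrite notin_setE => np.
have [|| -> _] := @translate_support R psi K D N a p (`|a.1| + `|a.2|) hpsi _ _ np.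
- by rewrite lerDl.
- by rewrite lerDr.
by rewrite !mulr0 normr0.
Qed.

Lemma integrable_against_test0 (g : R * R -> R) (B : R) :
  measurable_fun [set: plane] (g : plane -> R) -> (forall p, `|g p| <= B) ->
  (leb2 R).-integrable setT (EFin \o (fun p : plane => g p * psi p)).
Proof.
move=> mg gB; have := @integrable_against_test g B (0, 0) mg gB.
by congr (_.-integrable _ _); apply/funext => p /=; rewrite translate0.
Qed.

Section one_step.
Context (U Fp Fm : R * R -> R) (B dt dx : R).
Hypothesis mU : measurable_fun [set: plane] (U : plane -> R).
Hypothesis mFp : measurable_fun [set: plane] (Fp : plane -> R).
Hypothesis mFm : measurable_fun [set: plane] (Fm : plane -> R).
Hypothesis UB : forall p, `|U p| <= B.
Hypothesis FpB : forall p, `|Fp p| <= B.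
Hypothesis FmB : forall p, `|Fm p| <= B.
Hypothesis dt_gt0 : 0 < dt.
Hypothesis U_split : forall p, U p = Fp p + Fm p.
Hypothesis U_transport : forall p, 0 <= p.1 ->
  U (translate (dt, 0) p) = Fp (translate (0, - dx) p) + Fm (translate (0, dx) p).

(** Boundary layer of the summation by parts: the difference of [future] and its translate by one
    time step. *)
Definition first_step (p : R * R) : R := (0 <= p.1 < dt)%R%:R.

Let first_stepE p : first_step p = future p - future (translate (- dt, 0) p).
Proof.
rewrite /first_step /future /translate/= subr_ge0.
have [h1|h1] := leP 0 p.1; have [h2|h2] := leP dt p.1; rewrite /= ?subrr ?subr0//.
by have := lt_le_trans dt_gt0 h2; rewrite ltNge ltW.
Qed.

Let mulB (f g : R * R -> R) (b : R) : (forall p, `|f p| <= 1) ->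
  (forall p, `|g p| <= b) -> forall p, `|f p * g p| <= b.
Proof. by move=> f1 gb p; rewrite normrM -[b]mul1r; apply: ler_pM. Qed.

Let m_fut_t : measurable_fun [set: plane] ((fun p => future (translate (- dt, 0) p)) : plane -> R).
Proof. apply: measurable_comp_translate; exact: measurable_future. Qed.

Lemma measurable_first_step : measurable_fun [set: plane] (first_step : plane -> R).
Proof.
rewrite (_ : first_step = fun p => future p - future (translate (- dt, 0) p)).
  by apply: measurable_funB => //; exact: measurable_future.
by apply/funext => p; exact: first_stepE.
Qed.

(** The layer term is the integral of [future U psi] minus that with [future] delayed by dt. The
    first is split by [U_split]; the second is advanced by dt, replaced through [U_transport], and
    its shifts by -dx and dx are moved onto psi. Everything then cancels exactly. *)
Lemma transport_identity :
  \int[leb2 R]_p (future p * Fp p * (psi (translate (dt, dx) p) - psi p)) +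
  \int[leb2 R]_p (future p * Fm p * (psi (translate (dt, - dx) p) - psi p)) +
  \int[leb2 R]_p (first_step p * U p * psi p) = 0.
Proof.
have mfp : measurable_fun [set: plane] ((fun p => future p * Fp p) : plane -> R).
  by apply: measurable_funM => //; exact: measurable_future.
have mfm : measurable_fun [set: plane] ((fun p => future p * Fm p) : plane -> R).
  by apply: measurable_funM => //; exact: measurable_future.
have mfu : measurable_fun [set: plane] ((fun p => future p * U p) : plane -> R).
  by apply: measurable_funM => //; exact: measurable_future.
have mftu : measurable_fun [set: plane]
   ((fun p => future (translate (- dt, 0) p) * U p) : plane -> R).
  exact: measurable_funM.
have fpB := mulB future_bound FpB; have fmB := mulB future_bound FmB.
have fuB := mulB future_bound UB.
have ftuB := mulB (fun p => future_bound (translate (- dt, 0) p)) UB.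
have ip := integrable_against_test0 mfp fpB.
have im := integrable_against_test0 mfm fmB.
have iu := integrable_against_test0 mfu fuB.
have itu := integrable_against_test0 mftu ftuB.
have ips := integrable_against_test (dt, dx) mfp fpB.
have ims := integrable_against_test (dt, - dx) mfm fmB.
have mpsi : measurable_fun [set: plane] (psi : plane -> R).
  exact: continuous_plane_measurable (pt_cont hpsi).
have mpsia a : measurable_fun [set: plane] ((fun p => psi (translate a p)) : plane -> R).
  exact: measurable_comp_translate.
under eq_Rintegral do rewrite mulrBr.
rewrite RintegralB//.
under [X in _ + X + _]eq_Rintegral do rewrite mulrBr.
rewrite RintegralB//.
have -> : \int[leb2 R]_p (first_step p * U p * psi p) =
    \int[leb2 R]_p (future p * U p * psi p) -
    \int[leb2 R]_p (future (translate (- dt, 0) p) * U p * psi p).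
  by rewrite -RintegralB//; apply: eq_Rintegral => p _; rewrite first_stepE; ring.
have -> : \int[leb2 R]_p (future p * U p * psi p) =
    \int[leb2 R]_p (future p * Fp p * psi p) + \int[leb2 R]_p (future p * Fm p * psi p).
  by rewrite -RintegralD//; apply: eq_Rintegral => p _; rewrite U_split; ring.
have tr (b c : R) (p : R * R) : translate (dt, c) (translate (0, - c) p) = translate (dt, 0) p.
  by case: p => t x; rewrite /translate/= addr0 addr0 subrK.
(* After translation by (dt, 0) the delayed indicator becomes [future], which restricts to the times
   where [U_transport] holds. *)
have -> : \int[leb2 R]_p (future (translate (- dt, 0) p) * U p * psi p) =
    \int[leb2 R]_p (future p * Fp p * psi (translate (dt, dx) p)) +
    \int[leb2 R]_p (future p * Fm p * psi (translate (dt, - dx) p)).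
  rewrite -(Rintegral_translate (dt, 0)
    (f := fun p => future (translate (- dt, 0) p) * U p * psi p))//; last first.
    exact: measurable_funM.
  rewrite -(Rintegral_translate (0, - dx)
    (f := fun p => future p * Fp p * psi (translate (dt, dx) p)))//; last first.
    exact: measurable_funM.
  rewrite -(Rintegral_translate (0, - - dx)
    (f := fun p => future p * Fm p * psi (translate (dt, - dx) p)))//; last first.
    exact: measurable_funM.
  have i1 : (leb2 R).-integrable setT (EFin \o (fun p : plane =>
      future p * Fp (translate (0, - dx) p) * psi (translate (dt, 0) p))).
    apply: (@integrable_against_test (fun p => future p * Fp (translate (0, - dx) p)) B).
      by apply: measurable_funM; [exact: measurable_future|exact: measurable_comp_translate].
    exact: (mulB future_bound (fun p => FpB (translate (0, - dx) p))).
  have i2 : (leb2 R).-integrable setT (EFin \o (fun p : plane =>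
      future p * Fm (translate (0, dx) p) * psi (translate (dt, 0) p))).
    apply: (@integrable_against_test (fun p => future p * Fm (translate (0, dx) p)) B).
      by apply: measurable_funM; [exact: measurable_future|exact: measurable_comp_translate].
    exact: (mulB future_bound (fun p => FmB (translate (0, dx) p))).
  transitivity (\int[leb2 R]_p
     (future p * Fp (translate (0, - dx) p) * psi (translate (dt, 0) p)) +
     \int[leb2 R]_p
     (future p * Fm (translate (0, dx) p) * psi (translate (dt, 0) p))).
    rewrite -RintegralD//; apply: eq_Rintegral => -[t x] _.
    have -> : translate (- dt, 0) (translate (dt, 0) (t, x)) = (t, x).
      by rewrite /translate/= !addr0 addrK.
    rewrite /future/=; have [t0|t0] := leP 0 t; last by rewrite !mul0r addr0.
    by rewrite !mul1r U_transport//= mulrDl.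
  congr (_ + _); apply: eq_Rintegral => p _.
    by rewrite tr// /future/= addr0.
  by rewrite tr// opprK /future/= addr0.
by ring.
Qed.

End one_step.

Section flux_limit.
Context (G_ : nat -> R * R -> R) (G : R * R -> R) (B c : R) (h : nat -> R) (v : R * R).
Hypothesis mG_ : forall k, measurable_fun [set: plane] (G_ k : plane -> R).
Hypothesis mG : measurable_fun [set: plane] (G : plane -> R).
Hypothesis G_B : forall k p, `|G_ k p| <= B.
Hypothesis GB : forall p, `|G p| <= B.
Hypothesis h_gt0 : forall k, 0 < h k.
Hypothesis h_le : forall k, h k <= c.
Hypothesis h_cvg0 : h @ \oo --> (0 : R).
Hypothesis G_cvg : forall (n : nat) (e : R), 0 < e -> \forall k \near \oo,
  (\int[leb2 R]_(p in box n%:R n%:R) `|G_ k p - G p|%:E <= e%:E)%E.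

Let Q k p := (psi (translate (h k * v.1, h k * v.2) p) - psi p) / h k.

(** The quotients Q k are uniformly bounded with a common compact support and converge pointwise.
    Hence they pass to the limit against the fixed G by domination, and G_k may be replaced by G at
    the price of its L^1 distance on a box. *)
Lemma flux_limit : \int[leb2 R]_p (future p * G_ k p * Q k p) @[k --> \oo] -->
  \int[leb2 R]_p (future p * G p * (v.1 * d_t psi p + v.2 * d_x psi p)).
Proof.
have mpsi : measurable_fun [set: plane] (psi : plane -> R).
  exact: continuous_plane_measurable (pt_cont hpsi).
have mQ k : measurable_fun [set: plane] (Q k : plane -> R).
  apply: measurable_funM => //; apply: measurable_funB => //.
  exact: measurable_comp_translate.
have mfut := measurable_future.
have B0 : 0 <= B := le_trans (normr_ge0 _) (GB (0, 0)).
have c0 : 0 <= c := le_trans (ltW (h_gt0 0%N)) (h_le 0%N).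
pose w := `|v.1| + `|v.2|; have w0 : 0 <= w by rewrite addr_ge0.
(* Contains the supports of all Q k, because the displacements are at most c w in each
   coordinate. *)
pose A := square (N + c * w).
have tsup k p : ~ A p -> Q k p = 0.
  move=> np; have [|| E1 E2] := @translate_support R psi K D N
    (h k * v.1, h k * v.2) p (c * w) hpsi _ _ np; last by rewrite /Q E1 E2 subrr mul0r.
  - by rewrite /= normrM (gtr0_norm (h_gt0 k)); apply: ler_pM => //; [exact: ltW|rewrite lerDl].
  - by rewrite /= normrM (gtr0_norm (h_gt0 k)); apply: ler_pM => //; [exact: ltW|rewrite lerDr].
have QD k p : `|Q k p| <= w * D.
  rewrite /Q normrM normfV (gtr0_norm (h_gt0 k)) ler_pdivrMr//.
  apply: le_trans (increment_bound hpsi p _) _ => /=.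
  rewrite !normrM (gtr0_norm (h_gt0 k)) -mulrDr.
  by rewrite le_eqVlt; apply/orP; left; apply/eqP; rewrite /w; ring.
have D0 := pt_D_ge0 hpsi.
have wD0 : 0 <= w * D by exact: mulr_ge0.
have lim1 : \int[leb2 R]_p (future p * G p * Q k p) @[k --> \oo] -->
  \int[leb2 R]_p (future p * G p * (v.1 * d_t psi p + v.2 * d_x psi p)).
  apply: (@Rintegral_dominated_cvg _ plane R (leb2 R) A (B * (w * D))
    (fun k p => future p * G p * Q k p)
    (fun p => future p * G p * (v.1 * d_t psi p + v.2 * d_x psi p))).
  - exact: measurable_square.
  - exact: leb2_square_lty.
  - by move=> k; apply: measurable_funM => //; exact: measurable_funM.
  - apply: measurable_funM; first exact: measurable_funM.
    apply: measurable_funD; apply: measurable_funM => //.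
      exact: continuous_plane_measurable (pt_cont_t hpsi).
    exact: continuous_plane_measurable (pt_cont_x hpsi).
  - move=> k p; rewrite indicE; have [Ap|] := boolP (p \in A).
      rewrite mulr1 normrM; apply: ler_pM => //.
      by rewrite normrM -[B]mul1r; apply: ler_pM => //; exact: future_bound.
    by rewrite notin_setE => /(tsup k) ->; rewrite !mulr0 normr0.
  move=> p; apply: cvgM; first exact: cvg_cst.
  apply: (@increment_cvg R psi K D N hpsi p v h) => // k.
  by rewrite lt0r_neq0.
have intG g k : measurable_fun [set: plane] (g : plane -> R) -> (forall p, `|g p| <= B) ->
    (leb2 R).-integrable setT (EFin \o (fun p : plane => future p * g p * Q k p)).
  move=> mg gB; apply: (@integrable_bounded_support _ plane R (leb2 R) A _ (B * (w * D))).
  - exact: measurable_square.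
  - exact: leb2_square_lty.
  - by apply: measurable_funM => //; exact: measurable_funM.
  - move=> p; rewrite indicE; have [Ap|] := boolP (p \in A).
      rewrite mulr1 normrM; apply: ler_pM => //.
      by rewrite normrM -[B]mul1r; apply: ler_pM => //; exact: future_bound.
    by rewrite notin_setE => /(tsup k) ->; rewrite !mulr0 normr0.
pose n := (Num.truncn (N + c * w)).+1.
have nN : N + c * w <= n%:R by exact: ltW (truncnS_gt _).
have lim2 : \int[leb2 R]_p (future p * G_ k p * Q k p) -
    \int[leb2 R]_p (future p * G p * Q k p) @[k --> \oo] --> (0 : R).
  apply/cvgrPdist_le => e e0.
  have wD1 : 0 < w * D + 1 by rewrite ltr_wpDl.
  have ew : 0 < e / (w * D + 1) by exact: divr_gt0.
  have := G_cvg n ew.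
  apply: filterS => k hk; rewrite sub0r normrN -RintegralB//; [|exact: intG|exact: intG].
  apply: (@Rintegral_norm_le _ plane R (leb2 R) (box n%:R n%:R)).
  - exact: measurable_box.
  - by have := integrableB measurableT (intG _ k (mG_ k) (G_B k)) (intG _ k mG GB).
  - move=> p np; have [Ap|nA] := pselect (A p); last by rewrite (tsup k p nA) !mulr0 subrr.
    rewrite /future; case: (leP 0 p.1) => [p0|_]; last by rewrite !mul0r subrr.
    exfalso; apply: np; apply/boxP; move/squareP : Ap => [h1 h2].
    move: h1 h2; rewrite !ler_norml => /andP[_ h1] /andP[h2 h3].
    by rewrite p0; split; apply/andP; split => //; lra.
  apply: (@le_trans _ _ ((w * D)%:E * \int[leb2 R]_(p in box n%:R n%:R) `|G_ k p - G p|%:E)%E).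
    have mdG : measurable_fun [set: plane] ((fun p => `|G_ k p - G p|) : plane -> R).
      by apply: measurableT_comp => //; exact: measurable_funB.
    rewrite -ge0_integralZl_EFin//; last 2 first.
    - exact: measurable_box.
    - by apply: measurable_funTS; exact/measurable_EFinP.
    apply: ge0_le_integral => //.
    - exact: measurable_box.
    - apply: measurable_funTS; apply/measurable_EFinP; apply: measurableT_comp => //.
      apply: measurable_funB; apply: measurable_funM => //; exact: measurable_funM.
    - apply: measurable_funTS; apply/measurable_EFinP; exact: measurable_funM.
    - move=> p _; rewrite -EFinM lee_fin.
      rewrite (_ : _ - _ = future p * (G_ k p - G p) * Q k p); last by ring.
      rewrite normrM mulrC; apply: ler_pM => //; rewrite normrM.
      by rewrite -[X in _ <= X]mul1r; apply: ler_wpM2r => //; exact: future_bound.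
  apply: (@le_trans _ _ ((w * D)%:E * (e / (w * D + 1))%:E)%E).
    by apply: lee_wpmul2l; [rewrite lee_fin|].
  rewrite -EFinM lee_fin mulrA ler_pdivrMr// mulrC; apply: ler_wpM2l; first exact: ltW.
  by rewrite lerDl.
have -> : (fun k => \int[leb2 R]_p (future p * G_ k p * Q k p)) =
  (fun k => (\int[leb2 R]_p (future p * G_ k p * Q k p)
    - \int[leb2 R]_p (future p * G p * Q k p)) +
   \int[leb2 R]_p (future p * G p * Q k p)).
  by apply/funext => k; rewrite subrK.
rewrite -[X in _ --> X]add0r; exact: cvgD lim2 lim1.
Qed.

End flux_limit.
End with_test.
End transport_identity.

Lemma cvg_to_eq0 (R : realType) (f : nat -> R) (l : R) :
  f @ \oo --> l -> (forall k, f k = 0) -> l = 0.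
Proof.
move=> fl f0; rewrite -(cvg_lim (@Rhausdorff R) fl).
by apply: cvg_lim => //; apply: cvg_near_cst; exact: nearW.
Qed.

(** * The initial layer and the limit of the weak formulation *)

Section weak_limit.
Context (R : realType).
Local Notation mu := (@lebesgue_measure R).
Local Notation line := (measurableTypeR R).
Local Notation plane := (measurableTypeR R * measurableTypeR R)%type.

Lemma Rintegral_prod_itv (a : R) (g : R -> R) : 0 <= a ->
  (leb2 R).-integrable setT
    (EFin \o (fun p : plane => (0 <= (p : R * R).1 < a)%R%:R * g p.2)) ->
  mu.-integrable setT (EFin \o g) ->
  \int[leb2 R]_p ((0 <= (p : R * R).1 < a)%R%:R * g p.2) = a * \int[mu]_x g x.
Proof.
move=> a0 intf intg; rewrite /Rintegral.
have /= <- := @integral12_prod_meas1 _ _ line line R mu mu _ intf.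
have gE : (\int[mu]_x (g x)%:E = (\int[mu]_x g x)%:E)%E.
  by rewrite fineK//; exact: integrable_fin_num.
have -> : fubini_F mu (EFin \o (fun p : plane => (0 <= (p : R * R).1 < a)%R%:R * g p.2)) =
   (fun t : line => (\int[mu]_x g x)%:E * (\1_(`[0, a[) (t : R))%:E)%E.
  apply/funext => t; rewrite /fubini_F/=.
  under eq_integral do rewrite EFinM.
  rewrite (integralZl measurableT intg).
  rewrite gE muleC indicE; congr (_ * (_%:R)%:E)%E.
  by congr nat_of_bool; apply/idP/idP; rewrite inE/= in_itv.
rewrite integralZl//; last first.
  apply: (@integrable_bounded_support _ line R mu `[0, a[%classic _ 1).
  - exact: measurable_itv.
  - by rewrite /= lebesgue_measure_itv/=; case: ifPn => // _; rewrite -EFinB ltry.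
  - by apply: measurable_indic; exact: measurable_itv.
  - by move=> x; rewrite mul1r ger0_norm.
rewrite integral_indic// setIT/= lebesgue_measure_itv/= lte_fin -EFinB subr0.
move: a0; rewrite le_eqVlt => /predU1P[<-|->]; last by rewrite gE/= mulrC.
by rewrite ltxx mule0 mul0r.
Qed.

Section with_test.
Context (psi : R * R -> R) (K : set (R * R)) (D N : R).
Hypothesis hpsi : plane_test psi K D N.
Context (u0 : R -> R) (B : R).
Hypothesis mu0 : measurable_fun [set: line] (u0 : line -> R).
Hypothesis u0B : forall x, `|u0 x| <= B.

Let B_ge0 : 0 <= B. Proof. exact: le_trans (u0B 0). Qed.

Let psi_out t x : N < `|x| -> psi (t, x) = 0.
Proof.
move=> Nx; have [|//] := pt_out hpsi (p := (t, x)).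
by move=> /(pt_box hpsi)[_ /=]; rewrite leNgt Nx.
Qed.

Let psi_lip x y : `|psi (0, y) - psi (0, x)| <= D * `|y - x|.
Proof.
have := increment_bound hpsi (0, x) (0, y - x).
by rewrite /translate/= addr0 (addrC x) subrK normr0 add0r mulrC.
Qed.

Let psi_lip_t t x : `|psi (t, x) - psi (0, x)| <= D * `|t|.
Proof.
have := increment_bound hpsi (0, x) (t, 0).
by rewrite /translate/= add0r addr0 normr0 addr0 mulrC.
Qed.

(** On the layer U is the cell average of u0. Freezing psi at t = 0 costs D dt over an area dt (2
    N), hence the first term after division by dt; the remaining integral is a product and is
    compared with u0 by [cell_average_weak]. *)
Lemma first_step_estimate (U : R * R -> R) (dt dx : R) : 0 < dt -> 0 < dx ->
  measurable_fun [set: plane] (U : plane -> R) -> (forall p, `|U p| <= B) ->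
  (forall p, 0 <= p.1 < dt -> U p = cell_average u0 dx (Num.floor (p.2 / dx))) ->
  `|dt^-1 * \int[leb2 R]_p (first_step dt p * U p * psi p) -
    \int[mu]_x (u0 x * psi (0, x))|
  <= B * (D * dt) * (2 * N) + 2 * B * (D * dx) * (2 * (N + dx)).
Proof.
move=> dt0 dx0 mU UB Uavg.
have N0 := pt_N_ge0 hpsi; have D0 := pt_D_ge0 hpsi.
have ndt : dt != 0 by rewrite lt0r_neq0.
pose avg (x : R) := cell_average u0 dx (Num.floor (x / dx)).
have avgB x : `|avg x| <= B by exact: cell_average_bound.
have m_avg : measurable_fun [set: line] (avg : line -> R) by exact: measurable_floor_comp.
have meta : measurable_fun [set: line] ((fun x => psi (0, x)) : line -> R).
  exact: (@lipschitz_measurable R (fun x => psi (0, x)) D psi_lip D0).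
have mfs := @measurable_first_step R dt dt0.
have fs1 p : `|first_step dt p| <= 1.
  by rewrite /first_step; case: (_ <= _ < _)%R; rewrite ?normr1 ?normr0.
have mavgeta : measurable_fun [set: line] ((fun x => avg x * psi (0, x)) : line -> R).
  exact: measurable_funM.
have int_g : mu.-integrable setT (EFin \o (fun x => avg x * psi (0, x))).
  apply: (@integrable_bounded_support _ line R mu `[(- N)%R, N]%classic _ (B * D)) => //.
    exact: lebesgue_measure_segment_lty.
  move=> x; rewrite indicE; have [xN|] := boolP (x \in `[(- N)%R, N]%classic).
    by rewrite mulr1 normrM; apply: ler_pM => //; exact: (pt_f_D hpsi).
  rewrite notin_setE/= in_itv/= => /negP; rewrite -ler_norml -ltNge => /psi_out ->.
  by rewrite !mulr0 normr0.
have mg : measurable_fun [set: plane] ((fun p => first_step dt p * (avg p.2 * psi (0, p.2))) : plane -> R).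
  apply: measurable_funM => //.
  exact: (@measurableT_comp _ _ _ plane line R (fun x => avg x * psi (0, x)) _ snd).
have int_fg : (leb2 R).-integrable setT (EFin \o (fun p : plane =>
    first_step dt p * (avg p.2 * psi (0, p.2)))).
  apply: (@integrable_bounded_support _ plane R (leb2 R) (box dt N) _ (B * D)) => //.
  - exact: measurable_box.
  - exact: leb2_box_lty.
  - move=> p; rewrite indicE; have [pB|] := boolP (p \in box dt N).
      rewrite mulr1 normrM -[B * D]mul1r; apply: ler_pM => //.
      by rewrite normrM; apply: ler_pM => //; exact: (pt_f_D hpsi).
    rewrite notin_setE => np; rewrite mulr0 normr_le0; apply/eqP.
    have [xN|Nx] := leP `|(p : R * R).2| N; last by rewrite psi_out// !mulr0.
    rewrite /first_step (_ : (_ <= _ < _)%R = false) ?mul0r//.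
    apply/negP => /andP[t0 tdt]; apply: np; apply/boxP.
    by rewrite t0 (ltW tdt); move: xN; rewrite ler_norml => ->.
have EI : \int[leb2 R]_p (first_step dt p * (avg p.2 * psi (0, p.2))) =
    dt * \int[mu]_x (avg x * psi (0, x)).
  exact: (@Rintegral_prod_itv dt (fun x => avg x * psi (0, x)) (ltW dt0) int_fg int_g).
have mfsU : measurable_fun [set: plane] ((fun p => first_step dt p * U p) : plane -> R).
  exact: measurable_funM.
have fsUB p : `|first_step dt p * U p| <= B.
  by rewrite normrM -[B]mul1r; apply: ler_pM.
have int_fU := integrable_against_test0 hpsi mfsU fsUB.
have H1 : `|\int[leb2 R]_p (first_step dt p * U p * psi p) -
    \int[leb2 R]_p (first_step dt p * (avg p.2 * psi (0, p.2)))|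
    <= B * (D * dt) * (dt * (2 * N)).
  rewrite -RintegralB//.
  apply: (@Rintegral_norm_le _ plane R (leb2 R) (box dt N)).
  - exact: measurable_box.
  - by have := integrableB measurableT int_fU int_fg.
  - move=> p np; have [xN|Nx] := leP `|(p : R * R).2| N; last first.
      by rewrite psi_out//; case: p np Nx => t x np /= Nx; rewrite psi_out// !mulr0 subrr.
    rewrite /first_step (_ : (_ <= _ < _)%R = false) ?mul0r ?subrr//.
    apply/negP => /andP[t0 tdt]; apply: np; apply/boxP.
    by rewrite t0 (ltW tdt); move: xN; rewrite ler_norml => ->.
  apply: integral_le_bound_cst.
  - exact: measurable_box.
  - apply: measurable_funTS; apply: measurableT_comp => //; apply: measurable_funB => //.
    by apply: measurable_funM => //; exact: continuous_plane_measurable (pt_cont hpsi).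
  - by rewrite !mulr_ge0// ltW.
  - by rewrite leb2_box// ltW.
  - move=> p _; rewrite normr_ge0/= /first_step.
    have [/andP[t0 tdt]|_] := boolP (0 <= (p : R * R).1 < dt)%R; last first.
      by rewrite !mul0r subrr normr0 !mulr_ge0// ltW.
    rewrite !mul1r Uavg ?t0//= -/(avg _) -mulrBr normrM; apply: ler_pM => //.
    have -> : p = (p.1, p.2) by case: p {t0 tdt}.
    apply: (le_trans (psi_lip_t _ _)); apply: ler_wpM2l => //=.
    by rewrite ger0_norm// ltW.
have H2 := @cell_average_weak R u0 B mu0 u0B (fun x => psi (0, x)) D N dx dx0 psi_lip
  (psi_out 0) D0 N0.
rewrite -/avg in H2.
have -> : dt^-1 * \int[leb2 R]_p (first_step dt p * U p * psi p) -
    \int[mu]_x (u0 x * psi (0, x)) =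
  dt^-1 * (\int[leb2 R]_p (first_step dt p * U p * psi p) -
    \int[leb2 R]_p (first_step dt p * (avg p.2 * psi (0, p.2)))) +
  (\int[mu]_x (avg x * psi (0, x)) - \int[mu]_x (u0 x * psi (0, x))).
  by rewrite EI; field.
apply: le_trans (ler_normD _ _) _; apply: lerD => //.
rewrite normrM gtr0_norm ?invr_gt0// ler_pdivrMl//.
by apply: le_trans H1 _; rewrite le_eqVlt; apply/orP; left; apply/eqP; ring.
Qed.

End with_test.

Section assembly.
Context (phi : R -> R) (lambda : R) (u0 : R -> R) (B : R) (dx : nat -> R).
Context (U_ Fp_ Fm_ : nat -> R * R -> R) (u Fp Fm : R * R -> R).
Hypothesis lambda_gt0 : 0 < lambda.
Hypothesis dx_gt0 : forall k, 0 < dx k.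
Hypothesis dx_cvg0 : dx @ \oo --> (0 : R).
Hypothesis mu0 : measurable_fun [set: line] (u0 : line -> R).
Hypothesis u0B : forall x, `|u0 x| <= B.
Hypothesis mU_ : forall k, measurable_fun [set: plane] (U_ k : plane -> R).
Hypothesis mFp_ : forall k, measurable_fun [set: plane] (Fp_ k : plane -> R).
Hypothesis mFm_ : forall k, measurable_fun [set: plane] (Fm_ k : plane -> R).
Hypothesis U_B : forall k p, `|U_ k p| <= B.
Hypothesis Fp_B : forall k p, `|Fp_ k p| <= B.
Hypothesis Fm_B : forall k p, `|Fm_ k p| <= B.
Hypothesis mFp : measurable_fun [set: plane] (Fp : plane -> R).
Hypothesis mFm : measurable_fun [set: plane] (Fm : plane -> R).
Hypothesis FpB : forall p, `|Fp p| <= B.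
Hypothesis FmB : forall p, `|Fm p| <= B.
Hypothesis FpE : forall p, Fp p = u p / 2 + phi (u p) / (2 * lambda).
Hypothesis FmE : forall p, Fm p = u p / 2 - phi (u p) / (2 * lambda).
Hypothesis U_split : forall k p, U_ k p = Fp_ k p + Fm_ k p.
Hypothesis U_transport : forall k p, 0 <= p.1 ->
  U_ k (translate (dx k / lambda, 0) p) =
  Fp_ k (translate (0, - dx k) p) + Fm_ k (translate (0, dx k) p).
Hypothesis U_init : forall k p, 0 <= p.1 < dx k / lambda ->
  U_ k p = cell_average u0 (dx k) (Num.floor (p.2 / dx k)).
Hypothesis Fp_cvg : forall (n : nat) (e : R), 0 < e -> \forall k \near \oo,
  (\int[leb2 R]_(p in box n%:R n%:R) `|Fp_ k p - Fp p|%:E <= e%:E)%E.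
Hypothesis Fm_cvg : forall (n : nat) (e : R), 0 < e -> \forall k \near \oo,
  (\int[leb2 R]_(p in box n%:R n%:R) `|Fm_ k p - Fm p|%:E <= e%:E)%E.

Lemma weak_solution_of_limit : weak_solution phi u0 u.
Proof.
move=> psi /(_ 1%N) cpsi spsi.
have [K [D [N [_ hpsi]]]] := Ck2_plane_test cpsi spsi.
have N0 := pt_N_ge0 hpsi; have D0 := pt_D_ge0 hpsi.
pose h k := dx k / lambda.
have h_gt0 k : 0 < h k by exact: divr_gt0.
have hlE k : h k * lambda = dx k by rewrite /h divfK// lt0r_neq0.
have h_cvg0 : h @ \oo --> (0 : R).
  rewrite -[X in _ --> X](mul0r lambda^-1); apply: cvgM => //; exact: cvg_cst.
have [c hc] : exists c, forall k, h k <= c.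
  have [M [Mr hM]] := cvg_seq_bounded (cvgP _ h_cvg0).
  exists (`|M| + 1) => k; apply: le_trans (ler_norm _) _.
  by apply: hM => //; rewrite ltr_pwDr// ler_norm.
have L1 := flux_limit hpsi mFp_ mFp Fp_B FpB h_gt0 hc h_cvg0 Fp_cvg (v := (1, lambda)).
have L2 := flux_limit hpsi mFm_ mFm Fm_B FmB h_gt0 hc h_cvg0 Fm_cvg (v := (1, - lambda)).
have L3 : (h k)^-1 * \int[leb2 R]_p (first_step (h k) p * U_ k p * psi p)
    @[k --> \oo] --> \int[mu]_x (u0 x * psi (0, x)).
  have bnd : B * (D * h k) * (2 * N) + 2 * B * (D * dx k) * (2 * (N + dx k))
      @[k --> \oo] --> (0 : R).
    rewrite (_ : 0 = B * (D * 0) * (2 * N) + 2 * B * (D * 0) * (2 * (N + 0))); last by ring.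
    by apply: cvgD; apply: cvgM; do ?[exact: cvg_cst|assumption|apply: cvgM|apply: cvgD].
  apply/cvgrPdist_le => e e0; move/cvgrPdist_le : bnd => /(_ e e0).
  apply: filterS => k; rewrite sub0r normrN => hk; rewrite distrC.
  have F := first_step_estimate hpsi mu0 u0B (h_gt0 k) (dx_gt0 k) (mU_ k)
    (U_B k) (@U_init k).
  by apply: (le_trans F); exact: le_trans (ler_norm _) hk.
have id0 k : \int[leb2 R]_p (future p * Fp_ k p *
      ((psi (translate (h k * 1, h k * lambda) p) - psi p) / h k)) +
    \int[leb2 R]_p (future p * Fm_ k p *
      ((psi (translate (h k * 1, h k * - lambda) p) - psi p) / h k)) +
    (h k)^-1 * \int[leb2 R]_p (first_step (h k) p * U_ k p * psi p) = 0.
  have := transport_identity hpsi (mU_ k) (mFp_ k) (mFm_ k) (U_B k) (Fp_B k)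
    (Fm_B k) (h_gt0 k) (U_split k) (@U_transport k).
  move=> /(congr1 (fun z => (h k)^-1 * z)); rewrite mulr0 => <-.
  have mfut := @measurable_future R.
  have intQ (G : R * R -> R) (a : R * R) : measurable_fun [set: plane] (G : plane -> R) ->
      (forall p, `|G p| <= B) -> (leb2 R).-integrable setT
      (EFin \o (fun p : plane => future p * G p * (psi (translate a p) - psi p))).
    move=> mG GB.
    have mfG : measurable_fun [set: plane] ((fun p => future p * G p) : plane -> R).
      exact: measurable_funM.
    have fGB p : `|future p * G p| <= B.
      by rewrite normrM -[B]mul1r; apply: ler_pM => //; exact: future_bound.
    have := integrableB measurableT (integrable_against_test hpsi a mfG fGB)
      (integrable_against_test0 hpsi mfG fGB).
    by congr (_.-integrable _ _); apply/funext => p /=; rewrite mulrBr.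
  rewrite 2!mulrDr mulr1 mulrN hlE; congr (_ + _ + _).
    rewrite -RintegralZl//; last exact: intQ.
    by apply: eq_Rintegral => p _; ring.
  rewrite -RintegralZl//; last exact: intQ.
  by apply: eq_Rintegral => p _; ring.
have E0 : \int[leb2 R]_p (future p * Fp p * (1 * d_t psi p + lambda * d_x psi p)) +
   \int[leb2 R]_p (future p * Fm p * (1 * d_t psi p + - lambda * d_x psi p)) +
   \int[mu]_x (u0 x * psi (0, x)) = 0.
  by apply: (cvg_to_eq0 (cvgD (cvgD L1 L2) L3)) => k; exact: id0.
rewrite -[RHS]E0; congr (_ + _).
have mt := continuous_plane_measurable (pt_cont_t hpsi).
have mx := continuous_plane_measurable (pt_cont_x hpsi).
have intL (G : R * R -> R) (l : R) : measurable_fun [set: plane] (G : plane -> R) ->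
   (forall p, `|G p| <= B) -> (leb2 R).-integrable setT
   (EFin \o (fun p : plane => future p * G p * (1 * d_t psi p + l * d_x psi p))).
  move=> mG GB.
  apply: (@integrable_bounded_support _ plane R (leb2 R) (square N) _ (B * ((1 + `|l|) * D))).
  - exact: measurable_square.
  - exact: leb2_square_lty.
  - apply: measurable_funM; first by apply: measurable_funM => //; exact: measurable_future.
    by apply: measurable_funD; exact: measurable_funM.
  move=> p; rewrite indicE; have [Ap|] := boolP (p \in square N).
    rewrite mulr1 normrM; apply: ler_pM => //.
      by rewrite normrM -[B]mul1r; apply: ler_pM => //; exact: future_bound.
    rewrite mulrDl; apply: le_trans (ler_normD _ _) _; rewrite !mul1r normrM.
    by apply: lerD; [exact: (pt_D_t hpsi)|apply: ler_wpM2l => //; exact: (pt_D_x hpsi)].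
  rewrite notin_setE => np; have [|_ -> ->] := pt_out hpsi (p := p).
    by move=> /(pt_box hpsi) ?; apply: np; exact/squareP.
  by rewrite !mulr0 addr0 mulr0 normr0.
rewrite -RintegralD//; [|exact: intL|exact: intL].
rewrite Rintegral_mkcond; apply: eq_Rintegral => p _.
rewrite patchE futureE indicE; case: (p \in half_plane R); last by rewrite !mul0r addr0.
by rewrite mulr1n FpE FmE; field; rewrite lt0r_neq0.
Qed.

End assembly.
End weak_limit.

(** * Convergence of the scheme *)

Lemma interval_bound (R : realType) (a b x : R) : a <= x <= b ->
  `|x| <= `|a| + `|b|.
Proof.
move=> /andP[ax xb]; rewrite ler_norml; apply/andP; split.
  rewrite lerNl; apply: (@le_trans _ _ (- a)); first by rewrite lerN2.
  by apply: le_trans (ler_norm _) _; rewrite normrN lerDl.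
by apply: le_trans xb _; apply: le_trans (ler_norm _) _; rewrite lerDr.
Qed.

Section kinetic_equilibria.
Context (R : realType) (phi : R -> R) (lambda alpha beta : R).
Hypothesis lambda_gt0 : 0 < lambda.
Hypothesis phi_diff : forall x, derivable phi x 1.
Hypothesis phi_slope : forall x, x \in `[alpha, beta] ->
  `|derive1 phi x| <= lambda.

Lemma flux_increment x y : x \in `[alpha, beta] -> y \in `[alpha, beta] ->
  x <= y -> `|phi y - phi x| <= lambda * (y - x).
Proof.
rewrite !in_itv/= => /andP[ax xb] /andP[ay yb]; rewrite le_eqVlt => /predU1P[<-|xy].
  by rewrite !subrr normr0 mulr0.
have [c cI ->] : exists2 c, c \in `]x, y[%R & phi y - phi x = derive1 phi c * (y - x).
  apply: (@MVT R phi (derive1 phi)) => //.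
    by move=> z _; rewrite derive1E; apply: DeriveDef.
  apply: derivable_within_continuous => z _; exact: phi_diff.
rewrite normrM (gtr0_norm (_ : 0 < y - x)) ?subr_gt0//.
apply: ler_wpM2r; first by rewrite subr_ge0 ltW.
apply: phi_slope; move: cI; rewrite !in_itv/= => /andP[xc cy].
by rewrite (le_trans ax (ltW xc)) (le_trans (ltW cy) yb).
Qed.

Lemma flux_increment_div x y : x \in `[alpha, beta] -> y \in `[alpha, beta] ->
  x <= y -> `|phi y / (2 * lambda) - phi x / (2 * lambda)| <= (y - x) / 2.
Proof.
move=> xI yI xy; rewrite -mulrBl normrM (gtr0_norm (_ : 0 < (2 * lambda)^-1));
  last by rewrite invr_gt0 mulr_gt0.
rewrite ler_pdivrMr ?mulr_gt0//.
apply: le_trans (flux_increment xI yI xy) _.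
by rewrite [leRHS](_ : _ = lambda * (y - x))//; field.
Qed.

Lemma eq_plus_nondecreasing :
  {in `[alpha, beta] &, {homo eq_plus phi lambda : x y / x <= y}}.
Proof.
move=> x y xI yI xy; have := flux_increment_div xI yI xy.
by rewrite ler_norml /eq_plus => /andP[h1 h2]; lra.
Qed.

Lemma eq_minus_nondecreasing :
  {in `[alpha, beta] &, {homo eq_minus phi lambda : x y / x <= y}}.
Proof.
move=> x y xI yI xy; have := flux_increment_div xI yI xy.
by rewrite ler_norml /eq_minus => /andP[h1 h2]; lra.
Qed.

End kinetic_equilibria.

Lemma cell_average_itv (R : realType) (u0 : R -> R) (alpha beta dx : R) (j : int) :
  measurable_fun [set: measurableTypeR R] (u0 : measurableTypeR R -> R) ->
  (forall x, alpha <= u0 x <= beta) -> 0 < dx ->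
  alpha <= cell_average u0 dx j <= beta.
Proof.
move=> mu0 u0I dx0.
have u0B x : `|u0 x| <= `|alpha| + `|beta| by exact: interval_bound.
have i0 := integrable_itv_bounded (j%:~R * dx) ((j + 1)%:~R * dx) mu0 u0B.
have ic c : (@lebesgue_measure R).-integrable
    `[j%:~R * dx, (j + 1)%:~R * dx] (EFin \o (fun=> c)).
  by apply: (@integrable_itv_bounded _ _ _ (fun=> c) `|c|).
have cE c : \int[@lebesgue_measure R]_(x in `[j%:~R * dx, (j + 1)%:~R * dx]) c = c * dx.
  rewrite Rintegral_cst//= lebesgue_measure_itv/= lte_fin ltr_pM2r// ltr_int ltrDl ltr01 -EFinB/=.
  by rewrite intrD; ring.
have lo : alpha * dx <= \int[@lebesgue_measure R]_(x in `[j%:~R * dx, (j + 1)%:~R * dx]) u0 x.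
  rewrite -cE; apply: le_Rintegral; [exact: measurable_itv|exact: ic|exact: i0|].
  by move=> x _; case/andP: (u0I x).
have hi : \int[@lebesgue_measure R]_(x in `[j%:~R * dx, (j + 1)%:~R * dx]) u0 x <= beta * dx.
  rewrite -cE; apply: le_Rintegral; [exact: measurable_itv|exact: i0|exact: ic|].
  by move=> x _; case/andP: (u0I x).
rewrite /cell_average; move: (Rintegral _ _ _) lo hi => I lo hi.
by rewrite mulrC ler_pdivlMr// ler_pdivrMr// lo hi.
Qed.

(** * The mesh estimates for the functions built from the scheme *)

Section D1Q2_estimates.
Context (R : realType) (phi : R -> R) (s lambda alpha beta : R).
Context (u0 : R -> R) (V : R).
Local Notation mu := (@lebesgue_measure R).
Local Notation line := (measurableTypeR R).
Local Notation plane := (measurableTypeR R * measurableTypeR R)%type.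
Hypotheses (hs : 0 < s <= 1) (lambda_gt0 : 0 < lambda).
Hypothesis phi_diff : forall x, derivable phi x 1.
Hypothesis phi_slope : forall x, x \in `[alpha, beta] ->
  `|derive1 phi x| <= lambda.
Hypothesis mu0 : measurable_fun [set: line] (u0 : line -> R).
Hypothesis u0I : forall x, alpha <= u0 x <= beta.
Hypothesis u0V : forall psi : R -> R, C1 psi -> compactly_supported setT psi ->
  (forall x, `|psi x| <= 1) -> \int[mu]_x (u0 x * derive1 psi x) <= V.

(** The distributions are taken after relaxation: they still add up to u, and the next step is their
    pure transport. *)
Definition fp_Delta (dx : R) : R * R -> R :=
  piecewise_constant (dx / lambda) dx
    (fun n => f_plus lambda (relax phi s (D1Q2 phi s lambda u0 dx n))).

Definition fm_Delta (dx : R) : R * R -> R :=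
  piecewise_constant (dx / lambda) dx
    (fun n => f_minus lambda (relax phi s (D1Q2 phi s lambda u0 dx n))).

Let ep := eq_plus_nondecreasing lambda_gt0 phi_diff phi_slope.
Let em := eq_minus_nondecreasing lambda_gt0 phi_diff phi_slope.

(** One crude constant for u, v and both distributions; the factor 1 + lambda accommodates the bound
    on v, which carries a lambda. *)
Definition moment_bound : R := (1 + lambda) * (`|alpha| + `|beta| +
  (`|eq_plus phi lambda alpha| + `|eq_plus phi lambda beta| +
   `|eq_minus phi lambda alpha| + `|eq_minus phi lambda beta|)).
Local Notation B := moment_bound.

Let u0B x : `|u0 x| <= `|alpha| + `|beta|.
Proof. exact: interval_bound (u0I x). Qed.

Let bound_ge : [/\ `|alpha| + `|beta| <= B,
  `|eq_plus phi lambda alpha| + `|eq_plus phi lambda beta| <= B &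
  `|eq_minus phi lambda alpha| + `|eq_minus phi lambda beta| <= B].
Proof.
have le_B x y z w (c := x + y + (z + w)) : 0 <= x + y -> 0 <= z -> 0 <= w ->
    [/\ x + y <= (1 + lambda) * c, z <= (1 + lambda) * c & w <= (1 + lambda) * c].
  move=> xy z0 w0; have c0 : 0 <= c by rewrite addr_ge0// addr_ge0.
  have := mulr_ge0 (ltW lambda_gt0) c0.
  by rewrite mulrDl mul1r /c => ?; split; lra.
rewrite /moment_bound -(addrA _ `|eq_minus _ _ _|).
by apply: le_B; rewrite addr_ge0.
Qed.

Lemma state_bound (x : R) : alpha <= x <= beta -> `|x| <= B.
Proof. by move=> /interval_bound/le_trans; apply; case: bound_ge. Qed.

Lemma eq_plus_bound (x : R) :
  eq_plus phi lambda alpha <= x <= eq_plus phi lambda beta -> `|x| <= B.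
Proof. by move=> /interval_bound/le_trans; apply; case: bound_ge. Qed.

Lemma eq_minus_bound (x : R) :
  eq_minus phi lambda alpha <= x <= eq_minus phi lambda beta -> `|x| <= B.
Proof. by move=> /interval_bound/le_trans; apply; case: bound_ge. Qed.

Lemma measurable_flux_comp (u : R * R -> R) :
  measurable_fun [set: plane] (u : plane -> R) ->
  measurable_fun [set: plane] ((phi \o u) : plane -> R).
Proof.
move=> mu_; apply: (@measurableT_comp _ _ _ plane line R (phi : line -> R)) => //.
apply: continuous_measurable_fun => x.
by apply: differentiable_continuous; apply/derivable1_diffP.
Qed.

Section one_mesh.
Context (dx : R) (dx_gt0 : 0 < dx).
Local Notation w := (D1Q2 phi s lambda u0 dx).
Local Notation U := (u_Delta phi s lambda u0 dx).
Local Notation W := (v_Delta phi s lambda u0 dx).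

Let dt_gt0 : 0 < dx / lambda. Proof. exact: divr_gt0. Qed.

Let avgI j : alpha <= cell_average u0 dx j <= beta.
Proof. exact: cell_average_itv. Qed.

Let avgV : bounded_sums (fun j => `|cell_average u0 dx (j + 1) - cell_average u0 dx j|) V.
Proof. exact: (cell_average_variation dx_gt0 mu0 u0B u0V). Qed.

Lemma u_Delta_itv p : alpha <= U p <= beta.
Proof. exact: (u_bounds hs lambda_gt0 ep em avgI). Qed.

Lemma v_Delta_bound p : `|W p| <= B.
Proof.
have := v_bounds hs lambda_gt0 ep em avgI (Num.truncn (p.1 / (dx / lambda)))
  (Num.floor (p.2 / dx)).
move=> h; apply: (le_trans h).
rewrite /moment_bound.
have y0 : 0 <= `|alpha| + `|beta| by rewrite addr_ge0.
have c0 : 0 <= `|eq_plus phi lambda alpha| + `|eq_plus phi lambda beta| +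
   `|eq_minus phi lambda alpha| + `|eq_minus phi lambda beta| by do ?apply: addr_ge0.
have l0 := ltW lambda_gt0.
move: (_ + `|beta|) (_ + `|eq_minus _ _ beta|) y0 c0 => y c y0 c0.
have := mulr_ge0 l0 y0; rewrite mulrDl mul1r (mulrDr lambda); lra.
Qed.

Let adm n : admissible phi lambda alpha beta (relax phi s (w n)).
Proof.
apply: relax_admissible => //; apply: iter_step_admissible => //.
exact: admissible_equilibrium.
Qed.

Lemma fp_Delta_bound p : `|fp_Delta dx p| <= B.
Proof.
apply: eq_plus_bound; exact: (proj1 (adm _ _)).
Qed.

Lemma fm_Delta_bound p : `|fm_Delta dx p| <= B.
Proof.
apply: eq_minus_bound; exact: (proj2 (adm _ _)).
Qed.

Lemma measurable_u_Delta : measurable_fun [set: plane] (U : plane -> R).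
Proof. exact: measurable_piecewise_constant. Qed.

Lemma measurable_v_Delta : measurable_fun [set: plane] (W : plane -> R).
Proof. exact: measurable_piecewise_constant. Qed.

Lemma measurable_fp_Delta : measurable_fun [set: plane] (fp_Delta dx : plane -> R).
Proof. exact: measurable_piecewise_constant. Qed.

Lemma measurable_fm_Delta : measurable_fun [set: plane] (fm_Delta dx : plane -> R).
Proof. exact: measurable_piecewise_constant. Qed.

Lemma u_Delta_split p : U p = fp_Delta dx p + fm_Delta dx p.
Proof. exact: (moment_u lambda_gt0 (relax phi s (w _))). Qed.

Lemma u_Delta_transport p : 0 <= p.1 -> U (translate (dx / lambda, 0) p) =
  fp_Delta dx (translate (0, - dx) p) + fm_Delta dx (translate (0, dx) p).
Proof.
move=> p0; rewrite /u_Delta /fp_Delta /fm_Delta /piecewise_constant /translate/=.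
rewrite !addr0 !(mulrDl _ _ dx^-1) mulNr divff ?lt0r_neq0//.
rewrite mulrDl divff ?lt0r_neq0//.
(* Truncation is 0 on all negative numbers, so it commutes with adding 1 here only because the time
   is nonnegative. *)
have -> : Num.truncn (p.1 / (dx / lambda) + 1) = (Num.truncn (p.1 / (dx / lambda))).+1.
  have /truncn_itv/andP[h1 h2] : 0 <= p.1 / (dx / lambda) by rewrite divr_ge0// ltW.
  by apply: truncn_def; rewrite -natr1 lerD2r h1 -[ltRHS]natr1 ltrD2r h2.
have fl (x : R) (i : int) : Num.floor (x + i%:~R) = Num.floor x + i.
  have /andP[h1 h2] := floor_itv x.
  by apply: floor_def; rewrite intrD lerD2r h1 addrAC intrD ltrD2r.
rewrite (fl _ 1) (fl _ (-1)).
exact: u_transport.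
Qed.

Lemma u_Delta_init p : 0 <= p.1 < dx / lambda ->
  U p = cell_average u0 dx (Num.floor (p.2 / dx)).
Proof.
move=> /andP[p0 p1]; rewrite /u_Delta /piecewise_constant.
have -> // : Num.truncn (p.1 / (dx / lambda)) = 0%N.
apply: truncn_def; apply/andP; split; first by rewrite divr_ge0// ltW.
by rewrite (@ltr_pdivrMr R)// mulr1n mul1r.
Qed.

Lemma u_Delta_moved (T N h : R) (s1 s2 : R -> R) : 0 <= T -> 0 <= N ->
  measurable_fun [set: line] (s1 : line -> line) ->
  measurable_fun [set: line] (s2 : line -> line) ->
  (forall t, 0 <= t -> 0 <= s1 t /\ `|s1 t - t| <= h) ->
  (forall x, `|s2 x - x| <= h) ->
  (\int[leb2 R]_(p in box T N) `|U p - U (s1 (p : R * R).1, s2 (p : R * R).2)|%:E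
   <= (T * (V * ((lambda + 2) * h + dx)))%:E)%E.
Proof.
apply: translation_estimate => //.
- exact: (u_space_variation hs lambda_gt0 ep em avgI avgV).
- exact: (u_time_variation hs lambda_gt0 ep em avgI avgV).
Qed.

Lemma relaxation_defect (T N : R) : 0 <= T -> 0 <= N ->
  (\int[leb2 R]_(p in box T N) `|W p - phi (U p)|%:E
   <= (T * (dx * (2 * lambda * V / s)))%:E)%E.
Proof.
move=> T0 N0; apply: (defect_estimate (c := fun n j => (w n).2 j - phi ((w n).1 j))) => //.
exact: (equilibrium_defect hs lambda_gt0 ep em avgI avgV).
Qed.

End one_mesh.
End D1Q2_estimates.

(** * From convergence on boxes to convergence and translation bounds on the half-plane *)

Section box_limits.
Context (R : realType).
Local Notation plane := (measurableTypeR R * measurableTypeR R)%type.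

Lemma bounded_Linfty2 (D : set (R * R)) (u : R * R -> R) (B : R) :
  measurable (D : set plane) ->
  measurable_fun [set: plane] (u : plane -> R) -> (forall p, `|u p| <= B) ->
  Linfty2 D u.
Proof.
move=> mD mu_ uB; rewrite /Linfty2.
have mf : measurable_fun [set: plane] (u \_ D : plane -> R).
  by apply/(measurable_restrictT _ mD); exact: measurable_funTS.
rewrite inE; apply/andP; split; first by rewrite inE.
rewrite inE/= /finite_norm unlock; case: ifPn => // _.
apply: (@le_lt_trans _ _ B%:E); last exact: ltry.
apply: (@ess_sup_ler _ plane R (leb2 R) (fun p => `|(u \_ D) p|)) => p.
rewrite lee_fin patchE; case: ifPn => // _.
by rewrite normr0 (le_trans _ (uB (0, 0))).
Qed.

Lemma measurable_half_plane : measurable (half_plane R : set plane).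
Proof. by apply: measurableX => //; exact: measurable_itv. Qed.

Lemma measurable_dist (f g : R * R -> R) :
  measurable_fun [set: plane] (f : plane -> R) ->
  measurable_fun [set: plane] (g : plane -> R) ->
  measurable_fun [set: plane] (fun p : plane => `|f p - g p|%:E).
Proof.
move=> mf mg; apply/measurable_EFinP; apply: measurableT_comp => //.
exact: measurable_funB.
Qed.

Lemma measurable_restrict_dist (D : set plane) (f g : plane -> R) :
  measurable D -> measurable_fun D f -> measurable_fun D g ->
  measurable_fun [set: plane] ((fun p : plane => `|f p - g p|%:E) \_ D).
Proof.
move=> mD mf mg; apply: (proj1 (measurable_restrictT _ mD)).
apply/measurable_EFinP; apply: measurableT_comp => //.
exact: measurable_funB.
Qed.

Lemma compact_sub_box (K : set (R * R)) : compact K -> K `<=` half_plane R ->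
  exists n : nat, K `<=` box n%:R n%:R.
Proof.
move=> cK KH; have [M [Mr hM]] := compact_bounded cK.
exists (Num.truncn (`|M| + 1)).+1 => p Kp; apply/boxP.
have h : M < `|M| + 1 by rewrite ltr_pwDr// ler_norm.
have : Num.max `|p.1| `|p.2| <= `|M| + 1 := hM (`|M| + 1) h p Kp.
have nM : `|M| + 1 <= (Num.truncn (`|M| + 1)).+1%:R.
  by apply/ltW; rewrite truncnS_gt.
rewrite ge_max => /andP[/le_trans/(_ nM) h1 /le_trans/(_ nM) h2].
rewrite -ler_norml h2; split => //.
rewrite (le_trans (ler_norm _) h1) andbT.
by have [/= ] := KH p Kp; rewrite in_itv/= andbT.
Qed.

Lemma cvg_L1loc2_of_boxes (B : R) (g_ : nat -> R * R -> R) (g : R * R -> R) :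
  (forall k, measurable_fun [set: plane] (g_ k : plane -> R)) ->
  measurable_fun [set: plane] (g : plane -> R) ->
  (forall k p, `|g_ k p| <= B) -> (forall p, `|g p| <= B) ->
  (forall (n : nat) (e : R), 0 < e -> \forall k \near \oo,
    (\int[leb2 R]_(p in box n%:R n%:R) `|g_ k p - g p|%:E <= e%:E)%E) ->
  cvg_L1loc2 (half_plane R) g_ g.
Proof.
move=> mg_ mg g_B gB h; split.
- by move=> k; exact: bounded_L1loc2 (mg_ k) (g_B k).
- exact: bounded_L1loc2 mg gB.
move=> K cK /(compact_sub_box cK)[n Kn].
have mK := compact_plane_measurable cK.
have I0 k : (0 <= \int[leb2 R]_(p in K) `|g_ k p - g p|%:E)%E by exact: integral_ge0.
have bnd (e : R) : 0 < e -> \forall k \near \oo,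
    (\int[leb2 R]_(p in K) `|g_ k p - g p|%:E <= e%:E)%E.
  move=> e0; apply: filterS (h n e e0) => k; apply: le_trans.
  apply: ge0_subset_integral => //; first exact: measurable_box.
  by apply: measurable_funTS; exact: measurable_dist.
apply/fine_cvgP; split.
  apply: filterS (bnd 1 ltr01) => k hk; rewrite ge0_fin_numE//.
  by apply: le_lt_trans hk _; exact: ltry.
apply/cvgrPdist_le => e e0; apply: filterS (bnd e e0) => k hk.
rewrite /= sub0r normrN ger0_norm ?fine_ge0//.
by rewrite -lee_fin fineK// ge0_fin_numE//; apply: le_lt_trans hk _; exact: ltry.
Qed.

(** Compare u with U_k, U_k with its translate, and this with the translate of u. The last distance
    becomes, by translation, an integral over a larger box; [a.1 >= 0] keeps that box at nonnegative
    times, where convergence is known. *)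
Lemma translation_bound_limit (U_ : nat -> R * R -> R) (u : R * R -> R)
    (b_ : nat -> R) (b T N : R) (a : R * R) : 0 <= T -> 0 <= a.1 ->
  (forall k, measurable_fun [set: plane] (U_ k : plane -> R)) ->
  measurable_fun [set: plane] (u : plane -> R) ->
  (forall (n : nat) (e : R), 0 < e -> \forall k \near \oo,
    (\int[leb2 R]_(p in box n%:R n%:R) `|U_ k p - u p|%:E <= e%:E)%E) ->
  (forall k, (\int[leb2 R]_(p in box T N) `|U_ k p - U_ k (translate a p)|%:E
     <= (b_ k)%:E)%E) ->
  b_ @ \oo --> b ->
  (\int[leb2 R]_(p in box T N) `|u p - u (translate a p)|%:E <= b%:E)%E.
Proof.
move=> T0 a0 mU mu_ cU hb b_b; apply/lee_addgt0Pr => e e0.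
have e3 : 0 < e / 3 by rewrite divr_gt0.
(* Large enough for the box of side n to contain both the given box and its translate. *)
pose n := (Num.truncn (T + a.1 + `|N| + `|a.2|)).+1.
have nM : T + a.1 + `|N| + `|a.2| <= n%:R by apply/ltW; rewrite truncnS_gt.
have sub1 : box T N `<=` box n%:R n%:R.
  move=> p /boxP[/andP[p0 pT] /andP[pN Np]]; apply/boxP.
  have := ler_norm N; have := normr_ge0 a.2.
  by split; apply/andP; split; lra.
have sub2 p : box T N p -> box n%:R n%:R (translate a p).
  move=> /boxP[/andP[p0 pT] /andP[pN Np]]; apply/boxP => /=.
  have := ler_norm N; have := ler_norm a.2.
  have : - a.2 <= `|a.2| by rewrite -normrN ler_norm.
  by split; apply/andP; split; lra.
have near : \forall k \near \oo, b_ k <= b + e / 3.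
  move/cvgrPdist_le : b_b => /(_ _ e3); apply: filterS => k.
  by rewrite ler_norml => /andP[? ?]; lra.
have [k []] := filter_ex (filterI near (cU n _ e3)) => bk Uk.
have mtr f : measurable_fun [set: plane] (f : plane -> R) ->
    measurable_fun (box T N : set plane) ((f \o translate a) : plane -> R).
  by move=> mf; apply: measurable_funTS; exact: measurable_comp_translate.
have mb := measurable_box T N.
have mbn := measurable_box (n%:R : R) n%:R.
have H1 := @L1_triangle _ plane R (leb2 R) _ u (U_ k) (u \o translate a) mb
  (measurable_funTS mu_) (measurable_funTS (mU k)) (mtr _ mu_).
have H2 := @L1_triangle _ plane R (leb2 R) _ (U_ k) (U_ k \o translate a)
  (u \o translate a) mb (measurable_funTS (mU k)) (mtr _ (mU k)) (mtr _ mu_).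
have K1 : (\int[leb2 R]_(p in box T N) `|u p - U_ k p|%:E <= (e / 3)%:E)%E.
  rewrite integral_dist_sym; apply: le_trans Uk.
  apply: ge0_subset_integral => //.
  by apply: measurable_funTS; exact: measurable_dist.
have K2 : (\int[leb2 R]_(p in box T N)
    `|(U_ k \o translate a) p - (u \o translate a) p|%:E <= (e / 3)%:E)%E.
  apply: le_trans Uk; rewrite [leRHS]integral_mkcond.
  pose F := (fun p : plane => `|U_ k p - u p|%:E) \_ (box n%:R n%:R : set plane).
  have mF : measurable_fun [set: plane] (F : plane -> \bar R).
    apply: (@measurable_restrict_dist (box n%:R n%:R) (U_ k) u mbn);
      exact: measurable_funTS.
  have F0 p : (0 <= F p)%E by exact: erestrict_ge0.
  rewrite -/F -(ge0_integral_translate a mF F0).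
  rewrite integral_mkcond; apply: ge0_le_integral => //.
  - by move=> p _; exact: erestrict_ge0.
  - by apply: (@measurable_restrict_dist (box T N) (U_ k \o translate a)
      (u \o translate a) mb); exact: mtr.
  - exact: (@measurableT_comp _ _ _ plane plane _ F _ (translate a) mF
      (measurable_translate a)).
  move=> p _; rewrite /F !patchE; case: ifPn => [/set_mem/sub2/mem_set -> //|_].
  by case: ifPn => // _; rewrite lee_fin.
have be : (b%:E + e%:E = (e / 3)%:E + (b + e / 3 + e / 3)%:E)%E.
  by rewrite -!EFinD; congr (_%:E); field.
apply: (le_trans H1); rewrite be; apply: leeD => //; apply: (le_trans H2).
rewrite (EFinD (b + _)); apply: leeD => //.
by apply: le_trans (hb k) _; rewrite lee_fin.
Qed.

End box_limits.

(** * Extraction of the subsequence and properties of its limit *)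

Section D1Q2_convergence.
Context (R : realType) (phi : R -> R) (s lambda alpha beta : R).
Context (u0 : R -> R) (V : R).
Local Notation mu := (@lebesgue_measure R).
Local Notation line := (measurableTypeR R).
Local Notation plane := (measurableTypeR R * measurableTypeR R)%type.
Hypotheses (hs : 0 < s <= 1) (lambda_gt0 : 0 < lambda).
Hypothesis phi_diff : forall x, derivable phi x 1.
Hypothesis phi_slope : forall x, x \in `[alpha, beta] ->
  `|derive1 phi x| <= lambda.
Hypothesis mu0 : measurable_fun [set: line] (u0 : line -> R).
Hypothesis u0I : forall x, alpha <= u0 x <= beta.
Hypothesis u0V : forall psi : R -> R, C1 psi -> compactly_supported setT psi ->
  (forall x, `|psi x| <= 1) -> \int[mu]_x (u0 x * derive1 psi x) <= V.

Lemma D1Q2_subsequence (dx : nat -> R) : (forall k, 0 < dx k) ->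
  dx @ \oo --> (0 : R) ->
  exists (sigma : nat -> nat) (u : R * R -> R),
  [/\ {homo sigma : m n / (m < n)%N},
      measurable_fun [set: plane] (u : plane -> R),
      forall p, alpha <= u p <= beta &
      forall (n : nat) (e : R), 0 < e -> \forall k \near \oo,
        (\int[leb2 R]_(p in box n%:R n%:R)
          `|u_Delta phi s lambda u0 (dx (sigma k)) p - u p|%:E <= e%:E)%E].
Proof.
move=> dx_gt0 dx0.
have V0 : 0 <= V.
  by apply: bounded_sums_ge0; exact: (cell_average_variation (dx_gt0 0%N) mu0
    (fun x => interval_bound (u0I x)) u0V).
have l0 := ltW lambda_gt0.
(* The mesh error is [dx] itself, and the constant V (lambda + 3) comes from (lambda + 2) eta + dx
   <= (lambda + 3) (eta + dx). *)
have [| | | |//| |sigma [u [sh mu_ uI h]]] := @L1_compactness R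
  (fun k => u_Delta phi s lambda u0 (dx k)) alpha beta (V * (lambda + 3)) dx.
- by move=> k; exact: measurable_u_Delta.
- by move=> k p; exact: u_Delta_itv.
- by rewrite mulr_ge0// addr_ge0.
- by move=> k; exact: ltW.
- move=> k T N eta T0 N0 eta0.
  apply: le_trans (u_Delta_moved hs lambda_gt0 phi_diff phi_slope mu0 u0I u0V
    (dx_gt0 k) (h := eta) (s1 := fun t => (Num.truncn (t / eta))%:R * eta)
    (s2 := fun x => (Num.floor (x / eta))%:~R * eta) T0 N0 _ _ _ _) _.
  + rewrite (_ : (fun t => _) = (fun t : line =>
      (fun j => (nat_of_int j)%:R * eta) (Num.floor ((t : R) / eta)))).
      exact: (measurable_floor_comp (fun j => (nat_of_int j)%:R * eta) eta0).
    by apply/funext => t; rewrite truncEfloor.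
  + exact: (measurable_floor_comp (fun j => j%:~R * eta)).
  + by move=> t t0; rewrite grid_t// mulr_ge0// ltW.
  + by move=> x; exact: grid_x.
  + rewrite lee_fin; apply: ler_wpM2l => //; rewrite -mulrA; apply: ler_wpM2l => //.
    have := ltW (dx_gt0 k) => d0; have := mulr_ge0 l0 d0; nra.
exists sigma, u; split => // n e e0.
have small : \forall k \near \oo, k.+1%:R^-1 < e := near_infty_natSinv_lt (PosNum e0).
apply: filterS2 (nbhs_infty_ge n) small => k nk ke.
by apply: le_trans (h n k nk) _; rewrite lee_fin ltW.
Qed.

Section limit.
Context (dx : nat -> R) (u : R * R -> R).
Hypothesis dx_gt0 : forall k, 0 < dx k.
Hypothesis dx_cvg0 : dx @ \oo --> (0 : R).
Hypothesis mu_ : measurable_fun [set: plane] (u : plane -> R).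
Hypothesis uI : forall p, alpha <= u p <= beta.
Local Notation U k := (u_Delta phi s lambda u0 (dx k)).
Local Notation W k := (v_Delta phi s lambda u0 (dx k)).
Hypothesis cvgU : forall (n : nat) (e : R), 0 < e -> \forall k \near \oo,
  (\int[leb2 R]_(p in box n%:R n%:R) `|U k p - u p|%:E <= e%:E)%E.

Let ep := eq_plus_nondecreasing lambda_gt0 phi_diff phi_slope.
Let em := eq_minus_nondecreasing lambda_gt0 phi_diff phi_slope.
Local Notation B := (moment_bound phi lambda alpha beta).

Let V_ge0 : 0 <= V.
Proof.
by apply: bounded_sums_ge0; exact: (cell_average_variation (dx_gt0 0%N) mu0
  (fun x => interval_bound (u0I x)) u0V).
Qed.

Let UI k p : alpha <= U k p <= beta.
Proof. exact: u_Delta_itv. Qed.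

Let mU k : measurable_fun [set: plane] (U k : plane -> R).
Proof. exact: measurable_u_Delta. Qed.

Let mW k : measurable_fun [set: plane] (W k : plane -> R).
Proof. exact: measurable_v_Delta. Qed.

Let flux_lip a b : alpha <= a <= beta -> alpha <= b <= beta ->
  `|phi a - phi b| <= lambda * `|a - b|.
Proof. by move=> aI bI; apply: (phi_lipschitz lambda_gt0 ep em); rewrite in_itv. Qed.

(** v and both relaxed distributions differ from their limits by at most a multiple of the defect,
    which is O(dx) in L^1, plus a multiple of the error on u; this treats the three of them
    together. *)
Lemma cvg_of_moments (G_ : nat -> R * R -> R) (G : R * R -> R) (c1 c2 : R) :
  0 <= c1 -> 0 <= c2 ->
  (forall k, measurable_fun [set: plane] (G_ k : plane -> R)) ->
  measurable_fun [set: plane] (G : plane -> R) ->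
  (forall k p, `|G_ k p - G p| <=
     c1 * `|W k p - phi (U k p)| + c2 * `|U k p - u p|) ->
  forall (n : nat) (e : R), 0 < e -> \forall k \near \oo,
    (\int[leb2 R]_(p in box n%:R n%:R) `|G_ k p - G p|%:E <= e%:E)%E.
Proof.
move=> c1_ge0 c2_ge0 mG_ mG GG n e e0.
have c2_gt0 : 0 < c2 + 1 by rewrite ltr_wpDl.
have e2 : 0 < e / 2 by rewrite divr_gt0.
have small : \forall k \near \oo,
    c1 * (n%:R * (dx k * (2 * lambda * V / s))) <= e / 2.
  have : c1 * (n%:R * (dx k * (2 * lambda * V / s))) @[k --> \oo] -->
      c1 * (n%:R * (0 * (2 * lambda * V / s))).
    by do 2 (apply: cvgM; first exact: cvg_cst); apply: cvgM => //; exact: cvg_cst.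
  rewrite mul0r !mulr0 => /cvgrPdist_le/(_ _ e2); apply: filterS => k.
  by rewrite sub0r normrN; apply: le_trans; exact: ler_norm.
apply: filterS2 small (cvgU n (divr_gt0 e2 c2_gt0)) => k hk Uk.
have mb := measurable_box (n%:R : R) n%:R.
have mphiU : measurable_fun [set: plane] ((fun p => phi (U k p)) : plane -> R).
  exact: (measurable_flux_comp phi_diff (mU k)).
pose D1 (p : plane) : \bar R := `|W k p - phi (U k p)|%:E.
pose D2 (p : plane) : \bar R := `|U k p - u p|%:E.
have mD1 : measurable_fun (box n%:R n%:R : set plane) D1.
  by apply: measurable_funTS; exact: measurable_dist (mW k) mphiU.
have mD2 : measurable_fun (box n%:R n%:R : set plane) D2.
  by apply: measurable_funTS; exact: measurable_dist (mU k) mu_.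
have mcD (c : R) (D : plane -> \bar R) : measurable_fun (box n%:R n%:R : set plane) D ->
    measurable_fun (box n%:R n%:R : set plane) (fun p => c%:E * D p)%E.
  by move=> mD; exact: emeasurable_funM.
apply: (@le_trans _ _ (\int[leb2 R]_(p in box n%:R n%:R)
    (c1%:E * D1 p + c2%:E * D2 p))%E).
  apply: ge0_le_integral => //.
  - by apply: measurable_funTS; exact: measurable_dist (mG_ k) mG.
  - by apply: emeasurable_funD; exact: mcD.
  by move=> p _; rewrite -!EFinM -EFinD lee_fin.
rewrite ge0_integralD//; last 4 first.
- by move=> p _; apply: mule_ge0; rewrite lee_fin.
- exact: mcD.
- by move=> p _; apply: mule_ge0; rewrite lee_fin.
- exact: mcD.
rewrite !ge0_integralZl_EFin//; last 2 first.
- by move=> p _; rewrite lee_fin.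
- by move=> p _; rewrite lee_fin.
have hd := relaxation_defect hs lambda_gt0 phi_diff phi_slope mu0 u0I u0V
  (dx_gt0 k) (ler0n R n) (ler0n R n).
rewrite [e in leRHS]splitr EFinD; apply: leeD.
  apply: (@le_trans _ _ (c1 * (n%:R * (dx k * (2 * lambda * V / s))))%:E).
    rewrite EFinM; apply: lee_wpmul2l; last exact: hd.
    by rewrite lee_fin.
  by rewrite lee_fin.
apply: (@le_trans _ _ (c2 * (e / 2 / (c2 + 1)))%:E).
  rewrite EFinM; apply: lee_wpmul2l; last exact: Uk.
  by rewrite lee_fin.
by rewrite lee_fin mulrA ler_pdivrMr// mulrC ler_wpM2l// ?lerDl// ltW.
Qed.

Lemma v_Delta_cvg (n : nat) (e : R) : 0 < e -> \forall k \near \oo,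
  (\int[leb2 R]_(p in box n%:R n%:R) `|W k p - phi (u p)|%:E <= e%:E)%E.
Proof.
apply: (cvg_of_moments ler01 (ltW lambda_gt0) mW).
  exact: (measurable_flux_comp phi_diff mu_).
move=> k p; rewrite mul1r -(subrKA (phi (U k p))).
by apply: (le_trans (ler_normD _ _)); rewrite lerD2l; exact: flux_lip.
Qed.

Let half_flux_lip k p : `|phi (U k p) / (2 * lambda) - phi (u p) / (2 * lambda)|
  <= `|U k p - u p| / 2.
Proof.
rewrite -mulrBl normrM (gtr0_norm (_ : 0 < (2 * lambda)^-1)); last first.
  by rewrite invr_gt0 mulr_gt0.
rewrite ler_pdivrMr ?mulr_gt0//; apply: le_trans (flux_lip (UI k p) (uI p)) _.
by rewrite [leRHS](_ : _ = lambda * `|U k p - u p|)//; field.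
Qed.

Let defect_le k p : `|(1 - s) * (W k p - phi (U k p)) / (2 * lambda)|
  <= (2 * lambda)^-1 * `|W k p - phi (U k p)|.
Proof.
case/andP: hs => s0 s1.
rewrite 2!normrM (gtr0_norm (_ : 0 < (2 * lambda)^-1)); last first.
  by rewrite invr_gt0 mulr_gt0.
rewrite mulrC; apply: ler_wpM2l; first by rewrite invr_ge0 mulr_ge0// ltW.
by rewrite ger0_norm ?subr_ge0// ler_piMl// gerBl ltW.
Qed.

Lemma fp_Delta_cvg (n : nat) (e : R) : 0 < e -> \forall k \near \oo,
  (\int[leb2 R]_(p in box n%:R n%:R)
    `|fp_Delta phi s lambda u0 (dx k) p - eq_plus phi lambda (u p)|%:E <= e%:E)%E.
Proof.
apply: (cvg_of_moments (c1 := (2 * lambda)^-1) _ ler01).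
- by rewrite invr_ge0 mulr_ge0// ltW.
- by move=> k; exact: measurable_fp_Delta.
- apply: measurable_funD; apply: measurable_funM => //.
  exact: (measurable_flux_comp phi_diff mu_).
move=> k p; rewrite mul1r.
(* The relaxed distribution is the equilibrium at U plus (1 - s) times the defect over 2 lambda; the
   other two terms are the increment of that equilibrium between U and u. *)
rewrite [X in `|X|](_ : _ = (1 - s) * (W k p - phi (U k p)) / (2 * lambda) +
  ((U k p - u p) / 2 + (phi (U k p) / (2 * lambda) - phi (u p) / (2 * lambda)))).
  apply: (le_trans (ler_normD _ _)); apply: lerD; first exact: defect_le.
  apply: (le_trans (ler_normD _ _)).
  rewrite normrM [`|2^-1|]gtr0_norm ?invr_gt0// [leRHS]splitr.
  by rewrite lerD2l; exact: half_flux_lip.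
rewrite /fp_Delta /u_Delta /v_Delta /piecewise_constant /f_plus /relax /eq_plus/=.
move: (u p) => y; move: (D1Q2 _ _ _ _ _ _).1 (D1Q2 _ _ _ _ _ _).2 => a b.
by field; rewrite lt0r_neq0.
Qed.

Lemma fm_Delta_cvg (n : nat) (e : R) : 0 < e -> \forall k \near \oo,
  (\int[leb2 R]_(p in box n%:R n%:R)
    `|fm_Delta phi s lambda u0 (dx k) p - eq_minus phi lambda (u p)|%:E <= e%:E)%E.
Proof.
apply: (cvg_of_moments (c1 := (2 * lambda)^-1) _ ler01).
- by rewrite invr_ge0 mulr_ge0// ltW.
- by move=> k; exact: measurable_fm_Delta.
- apply: measurable_funB; apply: measurable_funM => //.
  exact: (measurable_flux_comp phi_diff mu_).
move=> k p; rewrite mul1r.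
rewrite [X in `|X|](_ : _ = (U k p - u p) / 2 -
  (phi (U k p) / (2 * lambda) - phi (u p) / (2 * lambda)) -
  (1 - s) * (W k p - phi (U k p)) / (2 * lambda)).
  apply: (le_trans (ler_normB _ _)); rewrite addrC; apply: lerD; first exact: defect_le.
  apply: (le_trans (ler_normB _ _)).
  rewrite normrM [`|2^-1|]gtr0_norm ?invr_gt0// [leRHS]splitr.
  by rewrite lerD2l; exact: half_flux_lip.
rewrite /fm_Delta /u_Delta /v_Delta /piecewise_constant /f_minus /relax /eq_minus/=.
move: (u p) => y; move: (D1Q2 _ _ _ _ _ _).1 (D1Q2 _ _ _ _ _ _).2 => a b.
by field; rewrite lt0r_neq0.
Qed.

Lemma limit_weak_solution : weak_solution phi u0 u.
Proof.
apply: (@weak_solution_of_limit R phi lambda u0 B dx (fun k => U k)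
  (fun k => fp_Delta phi s lambda u0 (dx k))
  (fun k => fm_Delta phi s lambda u0 (dx k)) u
  (fun p => eq_plus phi lambda (u p)) (fun p => eq_minus phi lambda (u p))) => //.
- by move=> x; apply: state_bound.
- by move=> k; exact: measurable_fp_Delta.
- by move=> k; exact: measurable_fm_Delta.
- by move=> k p; exact: state_bound (UI k p).
- by move=> k p; exact: fp_Delta_bound.
- by move=> k p; exact: fm_Delta_bound.
- apply: measurable_funD; apply: measurable_funM => //.
  exact: (measurable_flux_comp phi_diff mu_).
- apply: measurable_funB; apply: measurable_funM => //.
  exact: (measurable_flux_comp phi_diff mu_).
- move=> p; apply: eq_plus_bound => //; case/andP: (uI p) => h1 h2.
  have h12 := le_trans h1 h2.
  by rewrite !ep// in_itv/= ?h1 ?h2 ?h12 ?lexx.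
- move=> p; apply: eq_minus_bound => //; case/andP: (uI p) => h1 h2.
  have h12 := le_trans h1 h2.
  by rewrite !em// in_itv/= ?h1 ?h2 ?h12 ?lexx.
- by move=> k p; exact: u_Delta_split.
- by move=> k p; exact: u_Delta_transport.
- by move=> k p; exact: u_Delta_init.
- exact: fp_Delta_cvg.
- exact: fm_Delta_cvg.
Qed.

(** The term dx of the mesh estimate disappears in the limit, leaving a bound linear in h, as the
    difference quotients of [BV2_of_translations] require. *)
Lemma limit_moved (T N h : R) (a : R * R) : 0 <= T -> 0 <= N -> 0 < h ->
  0 <= a.1 <= h -> `|a.2| <= h ->
  (\int[leb2 R]_(p in box T N) `|u p - u (translate a p)|%:E <=
    (h * (T * (V * (lambda + 2))))%:E)%E.
Proof.
move=> T0 N0 h0 /andP[a0 ah] a2h.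
apply: (@translation_bound_limit R (fun k => U k) u
  (fun k => T * (V * ((lambda + 2) * h + dx k)))) => //.
  move=> k; apply: (u_Delta_moved hs lambda_gt0 phi_diff phi_slope mu0 u0I u0V
    (dx_gt0 k) (h := h) (s1 := fun t => t + a.1) (s2 := fun x => x + a.2)) => //.
  - exact: measurable_fun_shift.
  - exact: measurable_fun_shift.
  - by move=> t t0; rewrite addr_ge0// addrAC subrr add0r ger0_norm.
  - by move=> x; rewrite addrAC subrr add0r.
rewrite (_ : h * _ = T * (V * ((lambda + 2) * h + 0))); last by ring.
apply: cvgM; first exact: cvg_cst.
apply: cvgM; first exact: cvg_cst.
by apply: cvgD => //; exact: cvg_cst.
Qed.

Lemma limit_flux_moved (T N h : R) (a : R * R) : 0 <= T -> 0 <= N -> 0 < h ->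
  0 <= a.1 <= h -> `|a.2| <= h ->
  (\int[leb2 R]_(p in box T N) `|phi (u p) - phi (u (translate a p))|%:E <=
    (h * (lambda * (T * (V * (lambda + 2)))))%:E)%E.
Proof.
move=> T0 N0 h0 a1h a2h; have mb := measurable_box T N.
pose D (p : plane) : \bar R := `|u p - u (translate a p)|%:E.
have mut := measurable_comp_translate a mu_.
have mD : measurable_fun (box T N : set plane) D.
  by apply: measurable_funTS; exact: measurable_dist mu_ mut.
apply: (@le_trans _ _ (\int[leb2 R]_(p in box T N) (lambda%:E * D p))%E).
  apply: ge0_le_integral => //.
  - apply: measurable_funTS; apply: measurable_dist.
      exact: (measurable_flux_comp phi_diff mu_).
    exact: (measurable_flux_comp phi_diff mut).
  - exact: emeasurable_funM.
  by move=> p _; rewrite -EFinM lee_fin; exact: flux_lip.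
rewrite ge0_integralZl_EFin//; last 2 first.
- by move=> p _; rewrite lee_fin.
- exact: ltW.
rewrite mulrCA EFinM; apply: lee_wpmul2l; first by rewrite lee_fin ltW.
exact: limit_moved.
Qed.

Let uB p : `|u p| <= B.
Proof. exact: state_bound. Qed.

Let phiuB p : `|phi (u p)| <= lambda * `|beta - alpha| + `|phi alpha|.
Proof.
rewrite -(subrK (phi alpha) (phi (u p))); apply: (le_trans (ler_normD _ _)).
rewrite lerD2r; case/andP: (uI p) => h1 h2; have h12 := le_trans h1 h2.
apply: le_trans (flux_lip _ _) _; rewrite ?h1 ?h2 ?h12 ?lexx//.
apply: ler_wpM2l; first exact: ltW.
by rewrite !ger0_norm ?subr_ge0// lerD2r.
Qed.

Let mphiu : measurable_fun [set: plane] ((fun p => phi (u p)) : plane -> R).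
Proof. exact: (measurable_flux_comp phi_diff mu_). Qed.

Lemma limit_BV (T : R) : 0 < T ->
  BV2 (strip T) u /\ BV2 (strip T) (fun p => phi (u p)).
Proof.
move=> T0; have T0' := ltW T0; split.
- apply: (BV2_of_translations mu_ uB) => N h N0 h0; have hh := ltW h0.
    by apply: limit_moved; rewrite /= ?normr0 ?lexx ?hh.
  by apply: limit_moved; rewrite /= ?(gtr0_norm h0) ?lexx ?hh.
- apply: (BV2_of_translations mphiu phiuB) => N h N0 h0; have hh := ltW h0.
    by apply: limit_flux_moved; rewrite /= ?normr0 ?lexx ?hh.
  by apply: limit_flux_moved; rewrite /= ?(gtr0_norm h0) ?lexx ?hh.
Qed.

Lemma limit_Linfty : Linfty2 (half_plane R) u /\
  Linfty2 (half_plane R) (fun p => phi (u p)).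
Proof.
have mH := @measurable_half_plane R.
by split; [exact: bounded_Linfty2 mH mu_ uB|exact: bounded_Linfty2 mH mphiu phiuB].
Qed.

Lemma limit_cvg_L1loc : cvg_L1loc2 (half_plane R) (fun k => U k) u /\
  cvg_L1loc2 (half_plane R) (fun k => W k) (fun p => phi (u p)).
Proof.
split; first by apply: (cvg_L1loc2_of_boxes (B := B)) => // k p; exact: state_bound.
apply: (cvg_L1loc2_of_boxes (B := B + (lambda * `|beta - alpha| + `|phi alpha|))) => //.
- move=> k p; apply: (le_trans (v_Delta_bound hs lambda_gt0 phi_diff phi_slope
    mu0 u0I (dx_gt0 k) p)).
  by rewrite lerDl addr_ge0// mulr_ge0// ltW.
- by move=> p; apply: (le_trans (phiuB p)); rewrite lerDr (le_trans _ (uB p)).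
- exact: v_Delta_cvg.
Qed.

End limit.

End D1Q2_convergence.

(** * Changing the initial datum on a null set *)

Section ae_modification.
Context (R : realType).
Local Notation mu := (@lebesgue_measure R).
Local Notation line := (measurableTypeR R).
Local Notation plane := (measurableTypeR R * measurableTypeR R)%type.
Context (u0 u1 : R -> R).
Hypothesis mu0 : measurable_fun [set: line] (u0 : line -> R).
Hypothesis mu1 : measurable_fun [set: line] (u1 : line -> R).
Hypothesis u01 : {ae mu, forall x, u0 x = u1 x}.

Lemma Rintegral_ae_mul (D : set line) (f : R -> R) : measurable D ->
  measurable_fun [set: line] (f : line -> R) ->
  \int[mu]_(x in D) (u0 x * f x) = \int[mu]_(x in D) (u1 x * f x).
Proof.
move=> mD mf; rewrite /Rintegral; congr fine; apply: ae_eq_integral => //.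
- by apply/measurable_EFinP; apply: measurable_funTS; exact: measurable_funM.
- by apply/measurable_EFinP; apply: measurable_funTS; exact: measurable_funM.
apply: (@filterS _ _ (ae_filter_ringOfSetsType mu) _ _ _ u01).
by move=> x u01x _ /=; rewrite u01x.
Qed.

Lemma D1Q2_init_ae (phi : R -> R) (dx : R) :
  D1Q2_init phi u0 dx = D1Q2_init phi u1 dx.
Proof.
have E (j : int) : \int[mu]_(x in `[j%:~R * dx, (j + 1)%:~R * dx]) u0 x =
    \int[mu]_(x in `[j%:~R * dx, (j + 1)%:~R * dx]) u1 x.
  have := @Rintegral_ae_mul `[j%:~R * dx, (j + 1)%:~R * dx]%classic (fun=> 1)
    (measurable_itv _) (measurable_cst _).
  under eq_Rintegral do rewrite mulr1.
  by under [X in _ = X -> _]eq_Rintegral do rewrite mulr1.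
by rewrite /D1Q2_init; congr pair; apply/funext => j; rewrite E.
Qed.

Lemma weak_solution_ae (phi : R -> R) (u : R * R -> R) :
  weak_solution phi u1 u -> weak_solution phi u0 u.
Proof.
move=> h psi cpsi spsi; rewrite -[RHS](h psi cpsi spsi); congr (_ + _).
apply: (@Rintegral_ae_mul setT (fun x => psi (0, x))) => //.
have mpsi := continuous_plane_measurable (cpsi 0%N).
have m0 : measurable_fun [set: line] (fun x : line => ((0, x) : plane)).
  by apply: measurable_fun_pair; [exact: measurable_cst|exact: measurable_id].
exact: (measurableT_comp mpsi m0).
Qed.

End ae_modification.

Theorem mainTheorem1 (R : realType) (phi : R -> R) (u0 : R -> R)
    (alpha beta M s lambda : R)
    (hphi : C1 phi)
    (hu0_Linfty : Linfty1 u0)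
    (hu0_BV : BV1 setT u0)
    (halpha : ess_inf lebesgue_measure (EFin \o u0) = alpha%:E)
    (hbeta : ess_sup lebesgue_measure (EFin \o u0) = beta%:E)
    (hM : is_max [set `|derive1 phi xi| | xi in `[alpha, beta]] M)
    (hs : 0 < s <= 1)
    (hlambda : 0 < lambda)
    (hlambdaM : M <= lambda)
    (dx : nat -> R)
    (hdx : forall k, 0 < dx k)
    (hdx0 : dx @ \oo --> (0 : R)) :
  exists (sigma : nat -> nat) (u v : R * R -> R),
    [/\ {homo sigma : m n / (m < n)%N},
        [/\ Linfty2 (half_plane R) u, Linfty2 (half_plane R) v &
            forall T : R, 0 < T -> BV2 (strip T) u /\ BV2 (strip T) v],
        cvg_L1loc2 (half_plane R)
          (fun k => u_Delta phi s lambda u0 (dx (sigma k))) u /\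
        cvg_L1loc2 (half_plane R)
          (fun k => v_Delta phi s lambda u0 (dx (sigma k))) v,
        weak_solution phi u0 u &
        {ae leb2 R, forall p, half_plane R p -> v p = phi (u p)}].
Proof.
(* The maximum is attained, so the segment [alpha, beta] has a point. *)
have ab : alpha <= beta.
  by have [[xi /=]] := hM; rewrite in_itv/= => /andP[/le_trans h1 /h1].
have [phi_diff _] := hphi.
have phi_slope x : x \in `[alpha, beta] -> `|derive1 phi x| <= lambda.
  by move=> xI; apply: le_trans hlambdaM; apply: hM.2; exists x.
have mu0 : measurable_fun [set: measurableTypeR R] (u0 : measurableTypeR R -> R).
  by move: hu0_Linfty; rewrite /Linfty1 inE => /andP[]; rewrite inE.
(* [u0] takes its values in [[alpha, beta]] only almost everywhere. *)
pose u1 x := Num.max alpha (Num.min beta (u0 x)).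
have mu1 : measurable_fun [set: measurableTypeR R] (u1 : measurableTypeR R -> R).
  by apply: measurable_maxr => //; exact: measurable_minr.
have u1I x : alpha <= u1 x <= beta.
  by rewrite /u1 le_max lexx/= ge_max ab ge_min lexx.
have u01 : {ae lebesgue_measure, forall x, u0 x = u1 x}.
  have := ess_inf_le lebesgue_measure (EFin \o u0); rewrite halpha => lo.
  have := ess_sup_ge lebesgue_measure (EFin \o u0); rewrite hbeta => hi.
  apply: (@filterS2 _ _ (ae_filter_ringOfSetsType (@lebesgue_measure R)) _ _ _ _ lo hi).
  move=> x /=; rewrite !lee_fin => h1 h2.
  by rewrite /u1 (min_idPr h2) (max_idPr h1).
have [V u1V] : exists V : R, forall psi : R -> R, C1 psi ->
    compactly_supported setT psi -> (forall x, `|psi x| <= 1) ->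
    \int[lebesgue_measure]_x (u1 x * derive1 psi x) <= V.
  (* Finiteness of the total variation yields a real bound, and testing does not distinguish u1 from
     u0. *)
  exists (fine (TV1 setT u0)) => psi cpsi spsi psi1.
  have mpsi : measurable_fun [set: measurableTypeR R]
      (derive1 psi : measurableTypeR R -> R).
    by apply: continuous_measurable_fun; exact: cpsi.2.
  rewrite -(Rintegral_ae_mul mu0 mu1 u01 measurableT mpsi).
  have : ((\int[lebesgue_measure]_x (u0 x * derive1 psi x))%:E <= TV1 setT u0)%E.
    by apply: ereal_sup_ubound; exists psi.
  by case: (TV1 setT u0) hu0_BV.2 => [r _| |//]; rewrite ?lee_fin.
have initE d : D1Q2_init phi u0 d = D1Q2_init phi u1 d by exact: D1Q2_init_ae.
have uE d : u_Delta phi s lambda u0 d = u_Delta phi s lambda u1 d.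
  by rewrite /u_Delta /D1Q2 initE.
have vE d : v_Delta phi s lambda u0 d = v_Delta phi s lambda u1 d.
  by rewrite /v_Delta /D1Q2 initE.
have [sigma [u [sigma_incr mu_ uI cvgU]]] := D1Q2_subsequence hs hlambda phi_diff
  phi_slope mu1 u1I u1V hdx hdx0.
have sdx k : 0 < dx (sigma k) by exact: hdx.
have sdx0 : (dx \o sigma) @ \oo --> (0 : R).
  have sigma_ge k : (k <= sigma k)%N.
    by elim: k => // k IH; apply: leq_ltn_trans IH _; exact: sigma_incr.
  move=> A /hdx0[n _ hn]; exists n => // k nk /=.
  by apply: hn; exact: leq_trans nk (sigma_ge k).
(* Taking [phi \o u] itself as v makes the last claim hold at every point. *)
exists sigma, u, (phi \o u); split => //.
- have [Lu Lv] := limit_Linfty hlambda phi_diff phi_slope mu_ uI.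
  split => // T T0.
  exact: (limit_BV hs hlambda phi_diff phi_slope mu1 u1I u1V sdx sdx0 mu_ uI cvgU T0).
- under [X in cvg_L1loc2 _ X u]eq_fun do rewrite uE.
  under [X in cvg_L1loc2 _ X (phi \o u)]eq_fun do rewrite vE.
  exact: (limit_cvg_L1loc hs hlambda phi_diff phi_slope mu1 u1I u1V sdx sdx0 mu_ uI cvgU).
- apply: (weak_solution_ae mu0 mu1 u01).
  exact: (limit_weak_solution hs hlambda phi_diff phi_slope mu1 u1I u1V sdx sdx0 mu_ uI cvgU).
- exact: aeW.
Qed.
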